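(* Let $C$ be a compact Riemann surface of genus greater than one, embedded as a smooth algebraic curve in $\mathbb CP^k$, and let $f:\mathbb H\to\Gamma\backslash\mathbb H\simeq C$ be the universal covering map, where $\mathbb H$ is the upper half-plane and $\Gamma\subset\mathrm{PSL}(2,\mathbb R)$ is a discrete subgroup acting freely on $\mathbb H$. Let $p\in C$ and let $x=(x_1,\ldots,x_k)$ be affine coordinates corresponding to an affine subspace $\mathbb C^k\subset\mathbb CP^k$, such that $p$ is in the finite part of $x$ and $dx_j|_C$ does not vanish at $p$ for $j=1,\ldots,k$. Set $f_j:=x_j\circ f$. Then there exists a neighborhood $U_p\subset C$ of $p$ such that $f_1,\ldots,f_k$ are complex Noetherian functions on every domain $\Omega_p$ whose closure is compact and contained in $f^{-1}(U_p)$.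
   Context: Complex Noetherian functions: for a bounded domain $\Omega\subset\mathbb C^n$ with coordinates $x$, a tuple of holomorphic functions $\phi=(\phi_1,\ldots,\phi_\ell):\Omega\to\mathbb C^\ell$ is a complex Noetherian chain if $\partial\phi_i/\partial x_j=P_{i,j}(x,\phi)$ for all $i,j$, with $P_{i,j}$ complex polynomials. A function on $\Omega$ is a complex Noetherian function if it has the form $P(x,\phi)$ for some complex Noetherian chain $\phi$ on $\Omega$ and some complex polynomial $P$. *)

(* Defs.v *)
From HB Require Import structures.
From mathcomp Require Import all_boot all_order all_algebra.
From mathcomp Require Import all_classical all_reals all_analysis.
From mathcomp Require Import complex.
(* The notations of [mpoly] clash with those of MathComp-Analysis. *)
From mathcomp Require mpoly.
Import (canonicals, coercions) mpoly.

Set Implicit Arguments.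
Unset Strict Implicit.
Unset Printing Implicit Defensive.

Import GRing.Theory Num.Theory.
Import numFieldNormedType.Exports.

Local Open Scope quotient_scope.
Local Open Scope ring_scope.
Local Open Scope classical_set_scope.

(* The alias gives R[i] its canonical topology and norm; with these, [derivable],
   ['D_v] and [differentiable] are complex differentiation. *)
Definition cplx (R : realType) : numClosedFieldType := R[i].

Definition domain (T : topologicalType) (D : set T) : Prop :=
  [/\ open D, connected D & D !=set0].

Section Noetherian.
Variables (R : realType) (n : nat).
Local Notation C := (cplx R).

(* P (x, phi), the variables of P being ordered as x_1 .. x_n phi_1 .. phi_l *)
Definition eval_at (l : nat) (phi : 'rV[C]_n -> 'rV[C]_l)
    (P : mpoly.mpoly (n + l) C) (x : 'rV[C]_n) : C :=
  mpoly.meval (fun i => row_mx x (phi x) 0 i) P.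

Definition noetherian_chain (D : set 'rV[C]_n) (l : nat)
    (phi : 'rV[C]_n -> 'rV[C]_l) : Prop :=
  (forall x, D x -> differentiable phi x) /\
  exists P : 'I_l -> 'I_n -> mpoly.mpoly (n + l) C,
    forall x, D x -> forall i j,
      ('D_(delta_mx 0 j) phi x) 0 i = eval_at phi (P i j) x.

Definition noetherian_function (D : set 'rV[C]_n) (h : 'rV[C]_n -> C) : Prop :=
  exists l (phi : 'rV[C]_n -> 'rV[C]_l), noetherian_chain D phi /\
    exists P : mpoly.mpoly (n + l) C, forall x, D x -> h x = eval_at phi P x.

End Noetherian.

(* the case of one variable, where C is identified with 'rV[C]_1 *)
Definition noetherian_function1 (R : realType) (D : set (cplx R))
    (h : cplx R -> cplx R) : Prop :=
  noetherian_function [set x : 'rV[cplx R]_1 | D (x 0 0)] (fun x => h (x 0 0)).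

(* CP^k: nonzero vectors of C^(k+1) up to spanning the same line, with the
   quotient topology *)
Definition nzrow (R : realType) (k : nat) : Type :=
  [set v : 'rV[cplx R]_k.+1 | v != 0].
HB.instance Definition _ (R : realType) (k : nat) := Topological.on (nzrow R k).

Definition same_line (R : realType) (k : nat) (v w : nzrow R k) : bool :=
  (val v == val w)%MS.

Lemma same_line_equiv (R : realType) (k : nat) : equiv_class_of (@same_line R k).
Proof.
split=> [v|v w|w u v]; first exact/eqmxP.
  by rewrite /same_line andbC.
by move=> /eqmxP uw /eqmxP wv; apply/eqmxP; exact: eqmx_trans uw wv.
Qed.
Canonical same_line_equiv_rel (R : realType) (k : nat) :=
  EquivRelPack (@same_line_equiv R k).

Definition CP (R : realType) (k : nat) : Type :=
  quotient_topology {eq_quot @same_line_equiv_rel R k}.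
HB.instance Definition _ (R : realType) (k : nat) := Topological.on (CP R k).
HB.instance Definition _ (R : realType) (k : nat) := Quotient.on (CP R k).

Section Curves.
Variables (R : realType) (k : nat).
Local Notation C := (cplx R).

(* homogeneous coordinates, defined up to a nonzero factor *)
Definition hcoord (q : CP R k) : 'rV[C]_k.+1 := val (repr q).

(* The affine coordinate system attached to an invertible matrix A has
   x_j = L_j / L_0, where L_0, .., L_k are the linear forms given by the columns
   of A; its finite part is the complement of the hyperplane L_0 = 0. *)
Definition finite_part (A : 'M[C]_k.+1) : set (CP R k) :=
  [set q | (hcoord q *m A) 0 0 != 0].

Definition affine_coord (A : 'M[C]_k.+1) (j : 'I_k) (q : CP R k) : C :=
  (hcoord q *m A) 0 (lift ord0 j) / (hcoord q *m A) 0 0.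

Definition holomorphic_to_CP (D : set C) (u : C -> CP R k) : Prop :=
  forall t, D t -> {for t, continuous u} /\
    forall A, A \in unitmx -> finite_part A (u t) ->
      forall j, derivable (affine_coord A j \o u) t 1.

Definition eval_row (v : nzrow R k) (G : mpoly.mpoly k.+1 C) : C :=
  mpoly.meval (fun i => val v 0 i) G.

Definition vanishes_on (S : set (CP R k)) (G : mpoly.mpoly k.+1 C) : Prop :=
  forall v : nzrow R k, S (\pi v) -> eval_row v G = 0.

Definition jacobian_mx (m : nat) (F : 'I_m -> mpoly.mpoly k.+1 C) (v : nzrow R k) :
    'M[C]_(m, k.+1) :=
  \matrix_(i, j) eval_row v (mpoly.mderiv j (F i)).

(* S is the zero locus of homogeneous polynomials F_1, .., F_m which generate
   its ideal, and satisfies the Jacobian criterion for smoothness in dimension 1: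
   the rank of the Jacobian matrix is k - 1 everywhere on S. *)
Definition smooth_algebraic_curve (S : set (CP R k)) : Prop :=
  exists (m : nat) (d : 'I_m -> nat)
         (F : forall i : 'I_m, mpoly.dhomog k.+1 C (d i)),
  [/\ forall v : nzrow R k, S (\pi v) <-> forall i, eval_row v (F i) = 0,
      forall G, vanishes_on S G ->
        exists B : 'I_m -> mpoly.mpoly k.+1 C, G = \sum_i B i * F i &
      forall v : nzrow R k, S (\pi v) ->
        (\rank (jacobian_mx F v)).+1 = k].

(* Local parametrizations of a smooth curve S, i.e. inverses of charts: an
   injective holomorphic map between Riemann surfaces is biholomorphic onto its
   image, which is open. *)
Definition parametrization (S : set (CP R k)) (D : set C) (u : C -> CP R k) :
    Prop :=
  [/\ open D, u @` D `<=` S, set_inj D u & holomorphic_to_CP D u].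

(* A differential form of type (1,0) on S is given by its coefficients in local
   parametrizations: w D u is the function h such that u^*w = h(t) dt on D. *)
Definition form1 : Type := set C -> (C -> CP R k) -> C -> C.

Definition holomorphic_form1 (S : set (CP R k)) (w : form1) : Prop :=
  (forall D u, parametrization S D u ->
     forall t, D t -> derivable (w D u) t 1) /\
  forall D u D' u' (s : C -> C),
    parametrization S D u -> parametrization S D' u' ->
    (forall t, D' t -> [/\ D (s t), derivable s t 1 & u' t = u (s t)]) ->
    forall t, D' t -> w D' u' t = w D u (s t) * derive1 s t.

(* the dimension of the space of holomorphic differentials on S is g *)
Definition has_genus (S : set (CP R k)) (g : nat) : Prop :=
  exists w : 'I_g -> form1,
    (forall i, holomorphic_form1 S (w i)) /\
    forall w', holomorphic_form1 S w' ->
      exists! c : 'rV[C]_g, forall D u t, parametrization S D u -> D t ->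
        w' D u t = \sum_i c 0 i * w i D u t.

(* the differential of (the restriction to a curve of) a function on CP^k *)
Definition dform (x : CP R k -> C) : form1 := fun _ u t => derive1 (x \o u) t.

Definition vanishes_at (S : set (CP R k)) (w : form1) (p : CP R k) : Prop :=
  forall D u t, parametrization S D u -> D t -> u t = p -> w D u t = 0.

End Curves.

Definition homeomorphic_onto (X Y : topologicalType) (A : set X) (B : set Y)
    (f : X -> Y) : Prop :=
  exists g : Y -> X, [/\ set_bij A B f, {in A, cancel f g},
    {within A, continuous f} & {within B, continuous g}].

(* f restricts to a covering map from the open set A onto B *)
Definition covering_map (X Y : topologicalType) (A : set X) (B : set Y)
    (f : X -> Y) : Prop :=
  [/\ {within A, continuous f}, f @` A = B &
   forall y, B y -> exists V : set Y, [/\ open V, V y &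
     exists sheets : set (set X),
       [/\ forall W, sheets W -> open W,
           trivIset sheets id,
           \bigcup_(W in sheets) W = A `&` f @^-1` V &
           forall W, sheets W -> homeomorphic_onto W (B `&` V) f]]].

Section Uniformization.
Variables (R : realType).
Local Notation C := (cplx R).

Definition upper_half_plane : set C := [set z : C | 0 < complex.Im z].

(* A subgroup of PSL(2,R) = SL(2,R)/{1, -1} is represented by its preimage in
   SL(2,R), that is, by a subgroup of SL(2,R) containing -1. *)
Definition PSL2_subgroup (G : set 'M[R]_2) : Prop :=
  [/\ forall a, G a -> \det a = 1, G 1, G (- 1),
      forall a b, G a -> G b -> G (a * b) & forall a, G a -> G a^-1].

Definition discrete_set (T : topologicalType) (A : set T) : Prop :=
  A `<=` isolated A.

Definition mobius (a : 'M[R]_2) (z : C) : C :=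
  ((a 0 0)%:C%C * z + (a 0 1)%:C%C) / ((a 1 0)%:C%C * z + (a 1 1)%:C%C).

Definition acts_freely (G : set 'M[R]_2) : Prop :=
  forall a z, G a -> upper_half_plane z -> mobius a z = z -> a = 1 \/ a = - 1.

(* f induces an isomorphism from G\H onto S and is the resulting covering map;
   it is universal since H is simply connected. *)
Definition uniformization (k : nat) (G : set 'M[R]_2) (S : set (CP R k))
    (f : C -> CP R k) : Prop :=
  [/\ holomorphic_to_CP upper_half_plane f,
      covering_map upper_half_plane S f &
      forall z w, upper_half_plane z -> upper_half_plane w ->
        (f z = f w <-> exists2 a, G a & w = mobius a z)].

End Uniformization.

(* Main.v *)
From HB Require Import structures.
Require Import Defs.
From mathcomp Require Import all_boot all_order all_algebra.
From mathcomp Require Import all_classical all_reals all_analysis.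
From mathcomp Require Import perm complex.
From mathcomp Require Import ring lra zify.
From mathcomp Require mpoly.
Import (canonicals, coercions) mpoly.
Import numFieldNormedType.Exports.
Import Order.TTheory GRing.Theory Num.Theory.

Set Implicit Arguments.
Unset Strict Implicit.
Unset Printing Implicit Defensive.

Local Open Scope ring_scope.
Local Open Scope classical_set_scope.

(** Let y be one of the functions x_j o f, and let r = {y; z} / y'^2, where
    {y; z} = y''' / y' - 3/2 (y'' / y')^2 is the Schwarzian derivative. Two lifts of a
    point of the curve differ by a Moebius map, which does not change r: like y, r is a
    function on the curve. The definition of r is a differential equation
    y''' = r y'^3 + 3/2 y''^2 / y', and it remains to treat r.

    The curve being compact, y and r satisfy an algebraic relation P(y,r) = 0. This is
    Siegel's argument ([siegel]): the polynomials in y and r of bidegree at most n form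
    a space of dimension (n + 1)^2, large enough for some of them to vanish to an order
    proportional to n at the centers of a fixed finite atlas, and the Schwarz lemma
    forces such a polynomial to vanish identically. To cope with poles, y and r are
    written with linear forms along local lifts of f to C^(k+1), whose changes are
    bounded; the Schwarzian derivative is accordingly replaced by a polynomial in the
    jets of a numerator and a denominator ([schwarzian_change], [chart_change]).

    At the given point p, r may be a multiple root of P. But y - y(p) is a local
    coordinate there, and the remainder s of a sufficiently long Taylor expansion
    r = T(y) + (y - y(p))^M s is a simple root of another polynomial Q ([newton]). So
    s' = - Q_y(y,s) y' / Q_s(y,s), and y, y', y'', 1 / y', s, 1 / Q_s(y,s) form a chain.
    These functions of a point of the curve are defined over a neighborhood of p, hence
    at all of its lifts ([noetherian_near]).

    That y' does not vanish over p is deduced from the hypothesis on dx_j, which is about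
    parametrizations of the curve, by lifting one of them to the half plane
    ([affine_unramified]).

    Holomorphic functions are only assumed to be complex differentiable. Goursat's
    theorem on rectangles yields the maximum modulus principle, with finitely many
    exceptional points at which mere continuity is required ([maximum_modulus]).
    Applied to divided differences, it shows that these are holomorphic
    ([divdiff_holo]); differentiability of the derivative, Taylor expansions and the
    Schwarz lemma follow. *)

(** * Complex differentiation *)

Section Norm.
Variable R : realType.
Local Notation C := (cplx R).
Implicit Types z w : C.

(** The norm of [cplx R] takes its values in [cplx R]; estimates are made with its
    real version. *)
Definition cn (z : C) : R := ComplexField.Normc.normc z.

Lemma cnE z : (cn z)%:C%C = `|z| :> C.
Proof. by []. Qed.

Lemma cn_ge0 z : 0 <= cn z.
Proof. by case: z => a b; rewrite /cn /= sqrtr_ge0. Qed.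

Lemma cnM z w : cn (z * w) = cn z * cn w.
Proof. exact: ComplexField.Normc.normcM. Qed.

Lemma cnD z w : cn (z + w) <= cn z + cn w.
Proof. exact: le_normcD. Qed.

Lemma cnN z : cn (- z) = cn z.
Proof. exact: normcN. Qed.

Lemma cnV z : cn (z^-1) = (cn z)^-1.
Proof. exact: ComplexField.Normc.normcV. Qed.

Lemma cn0 : cn 0 = 0.
Proof. exact: ComplexField.Normc.normc0. Qed.

Lemma cn1 : cn 1 = 1.
Proof. exact: ComplexField.Normc.normc1. Qed.

Lemma cnX z n : cn (z ^+ n) = cn z ^+ n.
Proof. by elim: n => [|n IH]; rewrite ?expr0 ?cn1// !exprS cnM IH. Qed.

Lemma cn_eq0 z : (cn z == 0) = (z == 0).
Proof.
apply/eqP/eqP => [|->]; last exact: cn0.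
exact: ComplexField.Normc.eq0_normc.
Qed.

Lemma cn_gt0 z : (0 < cn z) = (z != 0).
Proof. by rewrite lt_neqAle cn_ge0 andbT eq_sym cn_eq0. Qed.

Lemma cnB z w : cn (z - w) = cn (w - z).
Proof. by rewrite -cnN opprB. Qed.

Lemma cnBD z w : cn z <= cn (z - w) + cn w.
Proof. by rewrite -{1}(subrK w z) cnD. Qed.

Lemma cn_Re z : `|complex.Re z| <= cn z.
Proof. by have := normc_ge_Re z; rewrite -cnE lecR. Qed.

Lemma cn_Im z : `|complex.Im z| <= cn z.
Proof.
case: z => a b; rewrite /cn /=; rewrite -sqrtr_sqr ler_wsqrtr//.
by rewrite lerDr sqr_ge0.
Qed.

Lemma cn_real (a : R) : cn a%:C%C = `|a|.
Proof. by rewrite /cn /= expr0n /= addr0 sqrtr_sqr. Qed.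

Lemma cn_i : cn 'i%C = 1.
Proof. by rewrite /cn /= expr0n /= expr1n add0r sqrtr1. Qed.

Lemma cn_le z : cn z <= `|complex.Re z| + `|complex.Im z|.
Proof.
rewrite [z in cn z]complexE (le_trans (cnD _ _))// cnM cn_i mul1r !cn_real.
by rewrite lexx.
Qed.

Lemma Re_B z w : complex.Re (z - w) = complex.Re z - complex.Re w.
Proof. by case: z; case: w. Qed.
Lemma Im_B z w : complex.Im (z - w) = complex.Im z - complex.Im w.
Proof. by case: z; case: w. Qed.
Lemma Re_D z w : complex.Re (z + w) = complex.Re z + complex.Re w.
Proof. by case: z; case: w. Qed.
Lemma Im_D z w : complex.Im (z + w) = complex.Im z + complex.Im w.
Proof. by case: z; case: w. Qed.
Lemma Re_M z w : complex.Re (z * w) =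
  complex.Re z * complex.Re w - complex.Im z * complex.Im w.
Proof. by case: z; case: w. Qed.
Lemma Im_M z w : complex.Im (z * w) =
  complex.Re z * complex.Im w + complex.Im z * complex.Re w.
Proof. by case: z; case: w. Qed.

Lemma nbhsC (z : C) (U : set C) : nbhs z U <->
  exists2 e : R, 0 < e & forall w, cn (w - z) < e -> U w.
Proof.
split.
  move=> /nbhs_ballP [e /= e0 H].
  have er : e \is Num.real by exact: gtr0_real.
  move: er e0 H => /complex_realP [k ->]; rewrite ltcR => k0 H.
  by exists k => // w wz; apply: H; rewrite /ball /= -normrN opprB -cnE ltcR.
move=> [e e0 H]; apply/nbhs_ballP; exists e%:C%C; first by rewrite /= ltcR.
by move=> w; rewrite /ball /= => wz; apply: H; move: wz; rewrite distrC -cnE ltcR.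
Qed.

Lemma cvgC (f : C -> C) z (l : C) : f x @[x --> z] --> l <->
  forall e : R, 0 < e -> exists2 d : R, 0 < d &
    forall w, cn (w - z) < d -> cn (f w - l) < e.
Proof.
split.
  move=> fl e e0; apply/nbhsC; apply: (fl [set y | cn (y - l) < e]).
  by apply/nbhsC; exists e.
move=> H U /nbhsC [e e0 eU].
have [d d0 dH] := H _ e0.
by apply/nbhsC; exists d => // w /dH /eU.
Qed.

Lemma cvg_dC (f : C -> C) z (l : C) : f x @[x --> z^'] --> l <->
  forall e : R, 0 < e -> exists2 d : R, 0 < d &
    forall w, w != z -> cn (w - z) < d -> cn (f w - l) < e.
Proof.
split.
  move=> fl e e0.
  have /nbhsC[d d0 H] : (\forall x \near z^', cn (f x - l) < e).
    apply: (fl [set y | cn (y - l) < e]).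
    by apply/nbhsC; exists e.
  by exists d => // w wz wd; exact: H.
move=> H U /nbhsC [e e0 eU].
have [d d0 dH] := H _ e0.
by apply/nbhsC; exists d => // w wd wz; exact/eU/dH.
Qed.

Lemma is_deriveC (f : C -> C) z (d : C) : is_derive z (1 : C) f d <->
  forall e : R, 0 < e -> exists2 r : R, 0 < r &
    forall w, cn (w - z) < r -> cn (f w - f z - d * (w - z)) <= e * cn (w - z).
Proof.
pose g (h : C) : C := h^-1 *: (f (h *: 1 + z) - f z).
have gE h : h != 0 -> g h - d = h^-1 * (f (h + z) - f z - d * h).
  by move=> h0; rewrite /g /GRing.scale /= mulr1 !mulrBr mulrCA mulVf// mulr1.
split.
  move=> [/= df dE] e e0.
  have : g h @[h --> 0^'] --> d.
    by rewrite -dE; exact: df.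
  move=> /cvg_dC/(_ e e0)[r r0 H]; exists r => // w wz.
  have [->|wz0] := eqVneq w z; first by rewrite !subrr mulr0 subr0 cn0 mulr0.
  have h0 : w - z != 0 by rewrite subr_eq0.
  have := H _ h0; rewrite subr0 => /(_ wz).
  rewrite gE// subrK cnM cnV mulrC => /ltW.
  by rewrite ler_pdivrMr ?cn_gt0.
move=> H.
have gd : g h @[h --> 0^'] --> d.
  apply/cvg_dC => e e0.
  have e20 : 0 < e / 2 by rewrite divr_gt0.
  have [r r0 rH] := H _ e20; exists r => // h h0; rewrite subr0 => hr.
  rewrite gE// cnM cnV mulrC ltr_pdivrMr ?cn_gt0//.
  have := rH (h + z); rewrite addrK => /(_ hr) /le_lt_trans; apply.
  by rewrite ltr_pM2r ?cn_gt0// ltr_pdivrMr// ltr_pMr// ltr1n.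
by apply: DeriveDef; [exact: (cvgP d)|exact/cvg_lim].
Qed.

End Norm.

Section PathDerivative.
Variable R : realType.
Local Notation C := (cplx R).

(** Derivative of a path in the plane, taken componentwise because [cplx R] is not
    a normed space over R. *)
Definition pder (F : R -> C) (x : R) (d : C) :=
  is_derive x (1 : R) (fun t => complex.Re (F t)) (complex.Re d) /\
  is_derive x (1 : R) (fun t => complex.Im (F t)) (complex.Im d).

Lemma pderD F G x d e : pder F x d -> pder G x e ->
  pder (fun t => F t + G t) x (d + e).
Proof.
move=> [F1 F2] [G1 G2]; split.
  under eq_fun do rewrite Re_D.
  by rewrite Re_D; exact: is_deriveD.
under eq_fun do rewrite Im_D.
by rewrite Im_D; exact: is_deriveD.
Qed.

Lemma pderZ F x d (c : C) : pder F x d -> pder (fun t => c * F t) x (c * d).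
Proof.
move=> [F1 F2]; split.
  under eq_fun do rewrite Re_M.
  by rewrite Re_M; apply: is_deriveB; apply: is_deriveZ.
under eq_fun do rewrite Im_M.
by rewrite Im_M; apply: is_deriveD; apply: is_deriveZ.
Qed.

Lemma pderB F G x d e : pder F x d -> pder G x e ->
  pder (fun t => F t - G t) x (d - e).
Proof.
move=> dF /(pderZ (-1)) dG; have := pderD dF dG.
rewrite mulN1r => H; congr (pder _ x (d - e)) : H.
by apply/funext => t; rewrite mulN1r.
Qed.

Lemma pder_real (p q : R -> R) x (a b : R) :
  is_derive x (1 : R) p a -> is_derive x (1 : R) q b ->
  pder (fun t => Complex (p t) (q t)) x (Complex a b).
Proof. by split. Qed.

Lemma mean_value_real (F f : R -> R) (a b M : R) : a <= b ->
  (forall x, a <= x <= b -> is_derive x (1 : R) F (f x)) ->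
  (forall x, a <= x <= b -> `|f x| <= M) ->
  `|F b - F a| <= M * (b - a).
Proof.
move=> ab dF fM.
have [||c cab ->] := @MVT_segment R F f a b ab.
- by move=> x xab; apply: dF; rewrite !(itvP xab).
- apply: derivable_within_continuous => x xab.
  by have [|//] := dF x; rewrite !(itvP xab).
rewrite normrM [`|b - a|]ger0_norm ?subr_ge0//.
by rewrite ler_wpM2r ?subr_ge0// fM// !(itvP cab).
Qed.

(** The factor 2, which comes from treating the two components separately, is
    harmless: all bounds obtained by integration are sharpened by taking powers in
    [maximum_modulus]. *)
Lemma mean_value F f (a b M : R) : a <= b ->
  (forall x, a <= x <= b -> pder F x (f x)) ->
  (forall x, a <= x <= b -> cn (f x) <= M) ->
  cn (F b - F a) <= 2 * M * (b - a).
Proof.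
move=> ab dF fM; apply: (le_trans (cn_le _)).
rewrite -mulrA mulr_natl mulr2n Re_B Im_B lerD//.
  apply: (@mean_value_real (fun t => complex.Re (F t)) (fun t => complex.Re (f t))) => // x /[dup] xab.
    by move=> /dF[].
  by move=> /fM; apply: le_trans; exact: cn_Re.
apply: (@mean_value_real (fun t => complex.Im (F t)) (fun t => complex.Im (f t))) => // x /[dup] xab.
  by move=> /dF[].
by move=> /fM; apply: le_trans; exact: cn_Im.
Qed.

Lemma primitive_real (f : R -> R) (a b : R) : continuous f ->
  exists F : R -> R, forall x, a <= x <= b -> is_derive x (1 : R) F (f x).
Proof.
move=> cf.
pose F x : R := (\int[lebesgue_measure]_(t in [set` `[a - 1, x]]) f t)%R.
exists F => x /andP[ax xb].
have [||||dF F'] := @continuous_FTC1_closed R f (a - 1) x (b + 1).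
- by rewrite (le_lt_trans xb)// ltrDl.
- apply: continuous_compact_integrable; first exact: segment_compact.
  exact: continuous_subspaceT.
- by rewrite (lt_le_trans _ ax)// gtrBl.
- exact: cf.
by apply: DeriveDef; [exact: dF|move: F'; rewrite derive1E].
Qed.

Definition clamp (a b x : R) : R := Num.max a (Num.min x b).

Lemma clamp_in a b x : a <= b -> a <= clamp a b x <= b.
Proof.
by move=> ab; rewrite /clamp le_max lexx/= ge_max ab ge_min lexx orbT.
Qed.

Lemma clamp_id a b x : a <= x <= b -> clamp a b x = x.
Proof. by move=> /andP[ax xb]; rewrite /clamp (min_idPl xb) (max_idPr ax). Qed.

Lemma clamp_dist a b x y : a <= b -> `|clamp a b x - clamp a b y| <= `|x - y|.
Proof.
move=> ab.
have H u v d : 0 <= d -> u <= v + d -> clamp a b u <= clamp a b v + d.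
  move=> d0 uv; rewrite {1}/clamp ge_max; apply/andP; split.
    by rewrite (le_trans (_ : _ <= clamp a b v)) ?lerDl// le_max lexx.
  apply: (@le_trans _ _ (Num.min v b + d)); last first.
    by rewrite lerD2r le_max lexx orbT.
  by case: (leP v b) => _; rewrite ge_min ?uv// lerDl d0 orbT.
rewrite ler_distl lerBlDr !H//.
- by rewrite -lerBlDl ler_norm.
- by rewrite -lerBlDl distrC ler_norm.
Qed.

(** A path is extended continuously beyond its endpoints by clamping, so that the
    primitive has a two-sided derivative at the endpoints as well. *)
Lemma primitive (f : R -> C) (a b : R) : a <= b ->
  (forall x, a <= x <= b -> forall e, 0 < e -> exists2 d, 0 < d &
     forall y, a <= y <= b -> `|y - x| < d -> cn (f y - f x) < e) ->
  exists F, forall x, a <= x <= b -> pder F x (f x).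
Proof.
move=> ab fc.
have cont (p : C -> R) : (forall z w, `|p z - p w| <= cn (z - w)) ->
    continuous (fun x => p (f (clamp a b x))).
  move=> pl x; apply/(@cvgrPdist_lt _ R) => e e0.
  have [d d0 H] := fc _ (clamp_in x ab) _ e0.
  near=> y.
  rewrite distrC; apply: (le_lt_trans (pl _ _)); apply: H; first exact: clamp_in.
  apply: (le_lt_trans (clamp_dist _ _ ab)).
  by near: y; apply: cvgr_distC_lt.
have [|F1 H1] := @primitive_real (fun x => complex.Re (f (clamp a b x))) a b.
  by apply: cont => z w; rewrite -Re_B cn_Re.
have [|F2 H2] := @primitive_real (fun x => complex.Im (f (clamp a b x))) a b.
  by apply: cont => z w; rewrite -Im_B cn_Im.
exists (fun t => Complex (F1 t) (F2 t)) => x /[dup] xab /clamp_id xE; split => /=.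
  by have := H1 _ xab; rewrite xE.
by have := H2 _ xab; rewrite xE.
Unshelve. all: by end_near. Qed.

End PathDerivative.

Section ComplexDerivative.
Variable R : realType.
Local Notation C := (cplx R).
Implicit Types (f g : C -> C) (z : C).

(** The rules below are stated for pointwise expressions rather than for the ring
    operations on functions, so that derivatives are assembled as proof terms. *)
Definition cder f z (d : C) : Prop := is_derive z (1 : C) f d.

Lemma cder_eq f z d d' : cder f z d -> d = d' -> cder f z d'.
Proof. by move=> + <-. Qed.

Lemma cder_derivable f z d : cder f z d -> derivable f z 1.
Proof. by case. Qed.

Lemma derivable_cder f z : derivable f z 1 -> cder f z ('D_1 f z).
Proof. exact: derivableP. Qed.

Lemma cder_unique f z d d' : cder f z d -> cder f z d' -> d = d'.
Proof. by case=> _ <- [_ <-]. Qed.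

Lemma cder_continuous f z d : cder f z d -> {for z, continuous f}.
Proof. by move=> /cder_derivable/derivable1_diffP/differentiable_continuous. Qed.

Lemma cder_near f g z d : (\forall w \near z, f w = g w) -> cder f z d -> cder g z d.
Proof. exact: near_eq_is_derive. Qed.

Lemma cder_cst (k : C) z : cder (fun=> k) z 0.
Proof. exact: is_derive_cst. Qed.

Lemma cder_id z : cder (fun w => w) z 1.
Proof. exact: is_derive_id. Qed.

Lemma cderD f g z a b : cder f z a -> cder g z b ->
  cder (fun w => f w + g w) z (a + b).
Proof. by move=> df dg; exact: (@is_deriveD C C C f g). Qed.

Lemma cderB f g z a b : cder f z a -> cder g z b ->
  cder (fun w => f w - g w) z (a - b).
Proof. by move=> df dg; exact: (@is_deriveB C C C f g). Qed.

Lemma cderM f g z a b : cder f z a -> cder g z b ->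
  cder (fun w => f w * g w) z (a * g z + f z * b).
Proof.
move=> df dg; apply: cder_eq (@is_deriveM C C f g z 1 a b df dg) _.
by rewrite /GRing.scale /= addrC mulrC.
Qed.

Lemma cderX f n z a : cder f z a ->
  cder (fun w => f w ^+ n) z (n%:R * f z ^+ n.-1 * a).
Proof.
move=> df; elim: n => [|n IH].
  by rewrite mul0r mul0r; under eq_fun do rewrite expr0; exact: cder_cst.
under eq_fun do rewrite exprS.
apply: cder_eq (cderM df IH) _.
case: n {IH} => [|n]; first by rewrite expr0 /=; ring.
by rewrite /= exprS -[in RHS]natr1; ring.
Qed.

Lemma cderV f z a : f z != 0 -> cder f z a ->
  cder (fun w => (f w)^-1) z (- a / f z ^+ 2).
Proof.
move=> f0 [df dE]; split; first exact: (@derivableV C C f).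
by rewrite (@deriveV C C f)// dE /GRing.scale /= mulrC mulNr mulrN.
Qed.

Lemma cder_div f g z a b : g z != 0 -> cder f z a -> cder g z b ->
  cder (fun w => f w / g w) z ((a * g z - f z * b) / g z ^+ 2).
Proof.
move=> g0 df dg; apply: cder_eq (cderM df (cderV g0 dg)) _.
by field.
Qed.

Lemma cder_comp f g z a b : cder g (f z) b -> cder f z a ->
  cder (fun w => g (f w)) z (b * a).
Proof.
move=> /[dup] dg' /is_deriveC dg /[dup] df' /is_deriveC df.
apply/is_deriveC => e e0.
pose e1 := Num.min 1 (e / (cn b + cn a + 1 + 1)).
have k0 : 0 < cn b + cn a + 1 + 1 by rewrite !ltr_wpDl ?addr_ge0 ?cn_ge0.
have e10 : 0 < e1 by rewrite lt_min ltr01 divr_gt0.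
have [r1 r10 H1] := dg _ e10; have [r2 r20 H2] := df _ e10.
have /cvgC/(_ _ r10)[r3 r30 H3] := cder_continuous df'.
exists (Num.min r2 r3); first by rewrite lt_min r20.
move=> w; rewrite lt_min => /andP[/H2 w2 /H3/H1 w3].
have -> : g (f w) - g (f z) - b * a * (w - z) =
  (g (f w) - g (f z) - b * (f w - f z)) + b * (f w - f z - a * (w - z)) by ring.
rewrite (le_trans (cnD _ _))// cnM.
have fl : cn (f w - f z) <= (cn a + 1) * cn (w - z).
  rewrite (le_trans (cnBD _ (a * (w - z))))// mulrDl cnM addrC lerD2l.
  by rewrite (le_trans w2)// ler_wpM2r ?cn_ge0// ge_min lexx.
apply: (@le_trans _ _ (e1 * ((cn a + 1) * cn (w - z)) + cn b * (e1 * cn (w - z)))).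
  rewrite lerD ?ler_wpM2l ?cn_ge0// (le_trans w3)// ler_wpM2l// ltW//.
have -> : e1 * ((cn a + 1) * cn (w - z)) + cn b * (e1 * cn (w - z)) =
  e1 * (cn b + cn a + 1) * cn (w - z) by ring.
rewrite ler_wpM2r ?cn_ge0// (le_trans (ler_wpM2l (ltW e10) (_ : _ <= cn b + cn a + 1 + 1)))//.
  by rewrite lerDl.
by rewrite -ler_pdivlMr// ge_min lexx orbT.
Qed.

Lemma cder_sum (I : Type) (r : seq I) (F : I -> C -> C) z (d : I -> C) :
  (forall i, cder (F i) z (d i)) ->
  cder (fun w => \sum_(i <- r) F i w) z (\sum_(i <- r) d i).
Proof.
move=> dF; elim: r => [|i r IH].
  by rewrite big_nil; under eq_fun do rewrite big_nil; exact: cder_cst.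
rewrite big_cons; under eq_fun do rewrite big_cons.
exact: cderD.
Qed.

Lemma cder_shift w z : cder (fun t => t - w) z 1.
Proof. by apply: cder_eq (cderB (cder_id z) (cder_cst w z)) _; rewrite subr0. Qed.

Lemma derivable_quotient f (k : C) w z : derivable f z 1 -> z != w ->
  derivable (fun t => (f t - k) / (t - w)) z 1.
Proof.
move=> /derivable_cder df zw; have zw0 : z - w != 0 by rewrite subr_eq0.
exact: cder_derivable (@cder_div (fun t => f t - k) (fun t => t - w) _ _ _ zw0
  (cderB df (cder_cst k z)) (cder_shift w z)).
Qed.

End ComplexDerivative.

(** * Goursat's theorem on rectangles *)

Section Bisection.
Variable R : realType.

Lemma nested_intervals (u : nat -> R) (w : R) : 0 <= w ->
  (forall n, u n <= u n.+1 <= u n + w / 2 ^+ n.+1) ->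
  exists x, forall n, u n <= x <= u n + w / 2 ^+ n.
Proof.
move=> w0 hu.
have wS n : w / 2 ^+ n = w / 2 ^+ n.+1 + w / 2 ^+ n.+1.
  rewrite exprS; have : (2 ^+ n : R) != 0 by rewrite expf_neq0// pnatr_eq0.
  by move=> ?; field.
have ui n m : u n <= u (n + m)%N.
  elim: m => [|m IH]; first by rewrite addn0.
  by rewrite addnS (le_trans IH)//; have /andP[] := hu (n + m)%N.
have vd n m : u (n + m)%N + w / 2 ^+ (n + m) <= u n + w / 2 ^+ n.
  elim: m => [|m IH]; first by rewrite addn0.
  rewrite addnS (le_trans _ IH)//; have /andP[_ h] := hu (n + m)%N.
  by rewrite (wS (n + m)%N) addrA lerD2r.
have uv n m : u n <= u m + w / 2 ^+ m.
  have w2 k : 0 <= w / 2 ^+ k by rewrite divr_ge0// exprn_ge0.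
  have [nm|/ltnW mn] := leqP n m.
    by rewrite -(subnKC nm) (le_trans (ui n (m - n)%N))// lerDl.
  rewrite -(subnKC mn); apply: le_trans (vd m (n - m)%N).
  by rewrite lerDl.
have hs : has_sup (range u).
  by split; [exists (u 0%N); exists 0%N|exists (u 0%N + w / 2 ^+ 0) => _ [n _ <-]].
exists (sup (range u)) => n; apply/andP; split.
  by apply: sup_upper_bound => //; exists n.
by apply: ge_sup => [|_ [m _ <-]//]; case: hs.
Qed.

Lemma bisection (P : R * R -> nat -> Prop) (w h : R) (p0 : R * R) :
  0 <= w -> 0 <= h -> P p0 0%N ->
  (forall p n, P p n -> exists q, [/\ P q n.+1,
     p.1 <= q.1 <= p.1 + w / 2 ^+ n.+1 & p.2 <= q.2 <= p.2 + h / 2 ^+ n.+1]) ->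
  exists x y, forall n, exists p, [/\ P p n,
    p.1 <= x <= p.1 + w / 2 ^+ n & p.2 <= y <= p.2 + h / 2 ^+ n].
Proof.
move=> w0 h0 P0 PS.
have /choice[g gP] : forall pn : (R * R) * nat, exists q, P pn.1 pn.2 ->
    [/\ P q pn.2.+1, pn.1.1 <= q.1 <= pn.1.1 + w / 2 ^+ pn.2.+1 &
       pn.1.2 <= q.2 <= pn.1.2 + h / 2 ^+ pn.2.+1].
  move=> [p n]; have [/PS[q qP]|nP] := pselect (P p n); last by exists p.
  by exists q.
pose s := fix s n := if n is m.+1 then g (s m, m) else p0.
have sP n : P (s n) n by elim: n => // n IH /=; have [] := gP (s n, n) IH.
have [n|x xP] := @nested_intervals (fun n => (s n).1) _ w0.
  by have [] := gP (s n, n) (sP n).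
have [n|y yP] := @nested_intervals (fun n => (s n).2) _ h0.
  by have [] := gP (s n, n) (sP n).
by exists x, y => n; exists (s n); split.
Qed.

End Bisection.

Section Goursat.
Variable R : realType.
Local Notation C := (cplx R).
Implicit Types (f : C -> C) (H V : R -> R -> C) (z : C).

Definition rect (a b c d : R) : set C :=
  [set z | a <= complex.Re z <= b /\ c <= complex.Im z <= d].

Definition edges (a b c d : R) : set C :=
  [set z | rect a b c d z /\
    (complex.Re z = a \/ complex.Re z = b \/
     complex.Im z = c \/ complex.Im z = d)].

Definition cont_on (Q : set C) f := forall z, Q z -> forall e, 0 < e ->
  exists2 r, 0 < r & forall w, Q w -> cn (w - z) < r -> cn (f w - f z) < e.

Definition diff_on (Q : set C) f (z : C) := exists d : C, forall e, 0 < e ->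
  exists2 r, 0 < r & forall w, Q w -> cn (w - z) < r ->
    cn (f w - f z - d * (w - z)) <= e * cn (w - z).

(** [H y] is a primitive of f along the horizontal line of ordinate y, and 'i * [V x]
    one along the vertical line of abscissa x: integrals over edges are increments of
    primitives, and their additivity is an identity of rings. *)
Definition primitives a b c d f H V :=
  (forall y, c <= y <= d -> forall x, a <= x <= b ->
     pder (H y) x (f (Complex x y : C))) /\
  (forall x, a <= x <= b -> forall y, c <= y <= d ->
     pder (V x) y (f (Complex x y : C))).

Definition edge_primitives a b c d f H V :=
  (forall y, y = c \/ y = d -> forall x, a <= x <= b ->
     pder (H y) x (f (Complex x y : C))) /\
  (forall x, x = a \/ x = b -> forall y, c <= y <= d ->
     pder (V x) y (f (Complex x y : C))).

(** The integral over the boundary of the rectangle, counterclockwise. *)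
Definition contour H V (a b c d : R) : C :=
  (H c b - H c a) - (H d b - H d a) +
  'i%C * ((V b d - V b c) - (V a d - V a c)).

Lemma rect_sub a b c d a' b' c' d' : a <= a' -> b' <= b -> c <= c' -> d' <= d ->
  rect a' b' c' d' `<=` rect a b c d.
Proof.
move=> h1 h2 h3 h4 z [/andP[z1 z2] /andP[z3 z4]]; split; apply/andP; split;
  by [apply: le_trans h1 z1|apply: le_trans z2 h2|apply: le_trans h3 z3|
      apply: le_trans z4 h4].
Qed.

Lemma primitives_sub a b c d a' b' c' d' f H V :
  a <= a' -> b' <= b -> c <= c' -> d' <= d ->
  primitives a b c d f H V -> primitives a' b' c' d' f H V.
Proof.
move=> h1 h2 h3 h4 [hH hV]; split=> [y|x] /andP[u v].
  move=> x /andP[s t]; apply: hH; apply/andP; split;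
  by [apply: le_trans h3 u|apply: le_trans v h4|apply: le_trans h1 s|
      apply: le_trans t h2].
move=> y /andP[s t]; apply: hV; apply/andP; split;
  by [apply: le_trans h1 u|apply: le_trans v h2|apply: le_trans h3 s|
      apply: le_trans t h4].
Qed.

Lemma horizontal_primitive (Q : set C) f a b y : a <= b ->
  (forall x, a <= x <= b -> Q (Complex x y : C)) -> cont_on Q f ->
  exists F, forall x, a <= x <= b -> pder F x (f (Complex x y : C)).
Proof.
move=> ab Qy fc.
apply: (@primitive R (fun x => f (Complex x y : C)) _ _ ab) => x xab e e0.
have [|r r0 rP] := fc (Complex x y : C) _ _ e0; first exact: Qy.
exists r => // x' x'ab x'x; apply: rP; first exact: Qy.
rewrite (le_lt_trans _ x'x)// (le_trans (cn_le _))//=.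
by rewrite subrr normr0 addr0.
Qed.

Lemma vertical_primitive (Q : set C) f c d x : c <= d ->
  (forall y, c <= y <= d -> Q (Complex x y : C)) -> cont_on Q f ->
  exists F, forall y, c <= y <= d -> pder F y (f (Complex x y : C)).
Proof.
move=> cd Qx fc.
apply: (@primitive R (fun y => f (Complex x y : C)) _ _ cd) => y ycd e e0.
have [|r r0 rP] := fc (Complex x y : C) _ _ e0; first exact: Qx.
exists r => // y' y'cd y'y; apply: rP; first exact: Qx.
rewrite (le_lt_trans _ y'y)// (le_trans (cn_le _))//=.
by rewrite subrr normr0 add0r.
Qed.

Lemma primitives_exist a b c d f : a <= b -> c <= d ->
  cont_on (rect a b c d) f -> exists H V, primitives a b c d f H V.
Proof.
move=> ab cd fc.
have /choice[H hH] : forall y, exists F, c <= y <= d ->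
    forall x, a <= x <= b -> pder F x (f (Complex x y : C)).
  move=> y; have [ycd|] := boolP (c <= y <= d); last by exists (fun=> 0).
  by have [|F ?] := horizontal_primitive ab _ fc (y := y); last by exists F.
have /choice[V hV] : forall x, exists F, a <= x <= b ->
    forall y, c <= y <= d -> pder F y (f (Complex x y : C)).
  move=> x; have [xab|] := boolP (a <= x <= b); last by exists (fun=> 0).
  by have [|F ?] := vertical_primitive cd _ fc (x := x); last by exists F.
by exists H, V.
Qed.

Lemma edge_primitives_exist a b c d f : a <= b -> c <= d ->
  cont_on (edges a b c d) f -> exists H V, edge_primitives a b c d f H V.
Proof.
move=> ab cd fc.
have /choice[H hH] : forall y, exists F, y = c \/ y = d ->
    forall x, a <= x <= b -> pder F x (f (Complex x y : C)).
  move=> y; have [ycd|] := pselect (y = c \/ y = d); last by exists (fun=> 0).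
  have [|F ?] := horizontal_primitive ab _ fc (y := y); last by exists F.
  move=> x xab; split; last by case: ycd => ->; right; right; [left|right].
  by split => //=; case: ycd => ->; rewrite ?lexx ?cd.
have /choice[V hV] : forall x, exists F, x = a \/ x = b ->
    forall y, c <= y <= d -> pder F y (f (Complex x y : C)).
  move=> x; have [xab|] := pselect (x = a \/ x = b); last by exists (fun=> 0).
  have [|F ?] := vertical_primitive cd _ fc (x := x); last by exists F.
  move=> y ycd; split; last by case: xab => ->; [left|right; left].
  by split => //=; case: xab => ->; rewrite ?lexx ?ab.
by exists H, V.
Qed.

Lemma primitives_edges a b c d f H V : a <= b -> c <= d ->
  primitives a b c d f H V -> edge_primitives a b c d f H V.
Proof.
move=> ab cd [hH hV]; split=> [y yE|x xE]; [apply: hH|apply: hV].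
  by case: yE => ->; rewrite ?lexx ?cd.
by case: xE => ->; rewrite ?lexx ?ab.
Qed.

Lemma contour_bound a b c d f H V M : a <= b -> c <= d ->
  edge_primitives a b c d f H V ->
  (forall z, edges a b c d z -> cn (f z) <= M) ->
  cn (contour H V a b c d) <= 4 * M * ((b - a) + (d - c)).
Proof.
move=> ab cd [hH hV] fM.
have hor y : y = c \/ y = d -> cn (H y b - H y a) <= 2 * M * (b - a).
  move=> ycd.
  have ycd' : c <= y <= d by case: ycd => ->; rewrite ?lexx ?cd.
  apply: (@mean_value R _ (fun x => f (Complex x y : C))) => // x xab.
    exact: hH.
  by apply: fM; split; [split|case: ycd => ->; right; right; [left|right]].
have ver x : x = a \/ x = b -> cn (V x d - V x c) <= 2 * M * (d - c).
  move=> xab.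
  have xab' : a <= x <= b by case: xab => ->; rewrite ?lexx ?ab.
  apply: (@mean_value R _ (fun y => f (Complex x y : C))) => // y ycd.
    exact: hV.
  by apply: fM; split; [split|case: xab => ->; [left|right; left]].
rewrite /contour (le_trans (cnD _ _))//.
rewrite cnM cn_i mul1r.
have := hor c (or_introl erefl); have := hor d (or_intror erefl).
have := ver a (or_introl erefl); have := ver b (or_intror erefl).
have := cnD (H c b - H c a) (- (H d b - H d a)); rewrite cnN.
have := cnD (V b d - V b c) (- (V a d - V a c)); rewrite cnN.
lra.
Qed.

Lemma contour_affine (al de : C) a b c d H V :
  (forall x y, H y x = al * Complex x 0 + de * Complex (x ^+ 2 / 2) (y * x)) ->
  (forall x y, V x y = al * Complex y 0 + de * Complex (x * y) (y ^+ 2 / 2)) ->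
  contour H V a b c d = 0.
Proof.
move=> hH hV; rewrite /contour !hH !hV.
case: al de {hH hV} => [a1 a2] [d1 d2].
by apply/eqP; rewrite eq_complex /=; apply/andP; split; apply/eqP; field.
Qed.

(** Up to an error e |z - z0|, f is affine, and affine functions have vanishing
    contour integrals. *)
Lemma contour_local f H V a b c d z0 (l : C) (e : R) : a <= b -> c <= d ->
  0 <= e -> rect a b c d z0 -> primitives a b c d f H V ->
  (forall z, rect a b c d z -> cn (f z - f z0 - l * (z - z0)) <= e * cn (z - z0)) ->
  cn (contour H V a b c d) <= 4 * e * ((b - a) + (d - c)) ^+ 2.
Proof.
move=> ab cd e0 Qz0 [hH hV] fe.
pose al := f z0 - l * z0.
pose A (y x : R) : C := al * Complex x 0 + l * Complex (x ^+ 2 / 2) (y * x).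
pose B (x y : R) : C := al * Complex y 0 + l * Complex (x * y) (y ^+ 2 / 2).
have dsq (x : R) : is_derive x (1 : R) (fun t => t ^+ 2 / 2) x.
  have -> : (fun t : R => t ^+ 2 / 2) = (2^-1 \*: (@GRing.exp R)^~ 2%N).
    by apply/funext => t; rewrite /= /GRing.scale /= mulrC.
  by apply: is_derive_eq; rewrite /GRing.scale /= -[RHS]mul1r; field.
have dlin (k x : R) : is_derive x (1 : R) (fun t => k * t) k.
  by apply: is_derive_eq; rewrite /GRing.scale /= mulr1.
have dA y x : pder (A y) x (al + l * Complex x y).
  rewrite -[al in X in pder _ _ X]mulr1.
  apply: pderD; apply: pderZ; apply: pder_real => //.
have dB x y : pder (B x) y (al + l * Complex x y).
  rewrite -[al in X in pder _ _ X]mulr1.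
  apply: pderD; apply: pderZ; apply: pder_real => //.
pose f' z := f z - (al + l * z).
have pr : primitives a b c d f' (fun y x => H y x - A y x) (fun x y => V x y - B x y).
  by split=> [y ycd x xab|x xab y ycd]; apply: pderB; auto.
have /(contour_bound ab cd (primitives_edges ab cd pr)) : forall z, edges a b c d z ->
    cn (f' z) <= e * ((b - a) + (d - c)).
  move=> z [Qz _]; rewrite /f' /al.
  have -> : f z - (f z0 - l * z0 + l * z) = f z - f z0 - l * (z - z0) by ring.
  apply: (le_trans (fe _ Qz)); rewrite ler_wpM2l// (le_trans (cn_le _))//.
  rewrite Re_B Im_B; case: Qz Qz0 => z1 z2 [z3 z4].
  by rewrite lerD// ler_norml; apply/andP; split; lra.
have -> : contour (fun y x => H y x - A y x) (fun x y => V x y - B x y) a b c d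
    = contour H V a b c d - contour A B a b c d by rewrite /contour; ring.
rewrite (@contour_affine al l a b c d A B)// subr0 => /le_trans; apply.
by rewrite le_eqVlt; apply/orP; left; apply/eqP; ring.
Qed.

Lemma contour_quarter H V x y s t : contour H V x (x + (s + s)) y (y + (t + t)) =
  contour H V x (x + s) y (y + t) + contour H V (x + s) (x + s + s) y (y + t) +
  (contour H V x (x + s) (y + t) (y + t + t) +
   contour H V (x + s) (x + s + s) (y + t) (y + t + t)).
Proof. by rewrite /contour !addrA; ring. Qed.

(** The bound |I| <= 4 e (w + h)^2 passes from the four quarters of a rectangle of
    size w x h to the whole, since w + h is halved while the integrals add up. So a
    rectangle violating it contains arbitrarily small ones shrinking to a point,
    where [contour_local] applies. *)
Theorem goursat f H V a b c d : a <= b -> c <= d ->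
  primitives a b c d f H V ->
  (forall z, rect a b c d z -> diff_on (rect a b c d) f z) ->
  contour H V a b c d = 0.
Proof.
move=> ab cd pr df.
pose w := b - a; pose h := d - c.
have w0 : 0 <= w by rewrite subr_ge0.
have h0 : 0 <= h by rewrite subr_ge0.
pose I (p : R * R) n :=
  contour H V p.1 (p.1 + w / 2 ^+ n) p.2 (p.2 + h / 2 ^+ n).
have two n : (2 ^+ n : R) != 0 by rewrite expf_neq0// pnatr_eq0.
have half (k : R) n : k / 2 ^+ n = k / 2 ^+ n.+1 + k / 2 ^+ n.+1.
  by rewrite exprS; have := two n => ?; field.
have main e : 0 < e -> cn (contour H V a b c d) <= 4 * e * (w + h) ^+ 2.
  move=> e0; apply: contrapT => Q0.
  pose P (p : R * R) n := ~ (cn (I p n) <= 4 * e * ((w + h) / 2 ^+ n) ^+ 2) /\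
    [/\ a <= p.1, p.1 + w / 2 ^+ n <= b, c <= p.2 & p.2 + h / 2 ^+ n <= d].
  have P0 : P (a, c) 0%N.
    rewrite /P /I /= expr0 !divr1 /w /h !subrKC !lexx; split => //.
  have [||||x [y xyP]] := @bisection R P w h (a, c) => //.
    move=> [p1 p2] n [Ip [/= pa pb pc pd]].
    set s := w / 2 ^+ n.+1; set t := h / 2 ^+ n.+1.
    have s0 : 0 <= s by rewrite divr_ge0// exprn_ge0.
    have t0 : 0 <= t by rewrite divr_ge0// exprn_ge0.
    have sE : w / 2 ^+ n = s + s by rewrite half.
    have tE : h / 2 ^+ n = t + t by rewrite half.
    apply: contrapT => /forallNP no.
    have good q1 q2 : p1 <= q1 <= p1 + s -> p2 <= q2 <= p2 + t ->
        cn (I (q1, q2) n.+1) <= 4 * e * ((w + h) / 2 ^+ n.+1) ^+ 2.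
      move=> q1P q2P; apply: contrapT => bad; apply: (no (q1, q2)).
      split => //; split => //=.
      by move: pb pd q1P q2P; rewrite sE tE -/s -/t => *; split; lra.
    apply: Ip; rewrite /I /= sE tE contour_quarter.
    have g1 := good p1 p2; have g2 := good (p1 + s) p2.
    have g3 := good p1 (p2 + t); have g4 := good (p1 + s) (p2 + t).
    move: g1 g2 g3 g4; rewrite /I /= -/s -/t !lexx !lerDl s0 t0 /=.
    move=> /(_ isT isT) g1 /(_ isT isT) g2 /(_ isT isT) g3 /(_ isT isT) g4.
    rewrite (le_trans (cnD _ _))// (le_trans (lerD (cnD _ _) (cnD _ _)))//.
    have -> : (w + h) / 2 ^+ n = 2 * ((w + h) / 2 ^+ n.+1).
      by rewrite half; ring.
    move: g1 g2 g3 g4; set X := (w + h) / _ => g1 g2 g3 g4.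
    have -> : 4 * e * (2 * X) ^+ 2 = 4 * e * X ^+ 2 + 4 * e * X ^+ 2 +
        (4 * e * X ^+ 2 + 4 * e * X ^+ 2) by ring.
    by rewrite !lerD.
  have [p [[_ [pa pb pc pd]] hx hy]] := xyP 0%N.
  have Qxy : rect a b c d (Complex x y : C).
    by split => /=; lra.
  have [l lP] := df _ Qxy; have [r r0 rP] := lP _ e0.
  have [n nr] : exists n, (w + h) / 2 ^+ n < r.
    have [k kr] : exists k : nat, (w + h) / r < k%:R.
      exists (Num.trunc ((w + h) / r)).+1.
      exact: truncnS_gt.
    exists k; rewrite ltr_pdivrMr ?exprn_gt0// mulrC -ltr_pdivrMr//.
    apply: (lt_trans kr); rewrite -natrX ltr_nat; exact: ltn_expl.
  have {hx hy pa pb pc pd p} [p [[+ [pa pb pc pd]] hx hy]] := xyP n; apply.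
  have s0 : 0 <= w / 2 ^+ n by rewrite divr_ge0// exprn_ge0.
  have t0 : 0 <= h / 2 ^+ n by rewrite divr_ge0// exprn_ge0.
  have sub := rect_sub pa pb pc pd.
  have -> : (w + h) / 2 ^+ n =
      (p.1 + w / 2 ^+ n - p.1) + (p.2 + h / 2 ^+ n - p.2).
    by rewrite mulrDl; ring.
  apply: (@contour_local f H V _ _ _ _ (Complex x y : C) l) => //.
  - by rewrite lerDl.
  - by rewrite lerDl.
  - exact: ltW.
  - exact: primitives_sub pr.
  move=> z Qz; apply: rP; first exact: sub.
  rewrite (le_lt_trans _ nr)// mulrDl (le_trans (cn_le _))// Re_B Im_B /=.
  by case: Qz => Qz1 Qz2; rewrite lerD// ler_norml; apply/andP; split; lra.
apply/eqP; rewrite -cn_eq0 eq_le cn_ge0 andbT.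
apply/ler_addgt0Pr => e e0; rewrite add0r.
have k0 : 0 < 4 * (w + h) ^+ 2 + 1.
  by rewrite ltr_wpDl// mulr_ge0// sqr_ge0.
have := main (e / (4 * (w + h) ^+ 2 + 1)); rewrite divr_gt0// => /(_ isT).
move=> /le_trans; apply.
have -> : 4 * (e / (4 * (w + h) ^+ 2 + 1)) * (w + h) ^+ 2 =
  e * (4 * (w + h) ^+ 2 / (4 * (w + h) ^+ 2 + 1)) by ring.
rewrite -[leRHS]mulr1; apply: ler_wpM2l; first exact: ltW.
by rewrite ler_pdivrMr// mul1r lerDl.
Qed.

End Goursat.

(** * The maximum modulus principle *)

Section MaximumModulus.
Variable R : realType.
Local Notation C := (cplx R).
Implicit Types (f g : C -> C) (H V : R -> R -> C) (z : C).

Lemma derivable_diff_on (Q : set C) f z : derivable f z 1 -> diff_on Q f z.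
Proof.
move=> /derivableP/is_deriveC df; exists ('D_1 f z) => e /df[r r0 H].
by exists r => // w _; exact: H.
Qed.

Lemma derivable_continuous f z : derivable f z 1 -> {for z, continuous f}.
Proof. by move=> /derivable1_diffP/differentiable_continuous. Qed.

Lemma continuous_cont_on (Q : set C) f :
  (forall z, Q z -> {for z, continuous f}) -> cont_on Q f.
Proof.
move=> fc z Qz e e0; have /cvgC/(_ e e0)[r r0 rP] := fc z Qz.
by exists r => // w _; exact: rP.
Qed.

Lemma Re_V z : complex.Re z^-1 =
  complex.Re z / (complex.Re z ^+ 2 + complex.Im z ^+ 2).
Proof. by case: z. Qed.

Lemma Im_V z : complex.Im z^-1 =
  - (complex.Im z / (complex.Re z ^+ 2 + complex.Im z ^+ 2)).
Proof. by case: z. Qed.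

Lemma increment_gt0 (F f : R -> R) (a b : R) : a < b ->
  (forall x, a <= x <= b -> is_derive x (1 : R) F (f x)) ->
  (forall x, a <= x <= b -> 0 < f x) -> 0 < F b - F a.
Proof.
move=> ab dF f0.
have [||c cab ->] := @MVT_segment R F f a b (ltW ab).
- by move=> x xab; apply: dF; rewrite !(itvP xab).
- apply: derivable_within_continuous => x xab.
  by have [|//] := dF x; rewrite !(itvP xab).
by rewrite mulr_gt0 ?subr_gt0// f0// !(itvP cab).
Qed.

(** The divided difference of f at w, with the value f'(w) at w. *)
Definition divdiff f w z :=
  if z == w then 'D_1 f w else (f z - f w) / (z - w).

Lemma divdiff_id f w : divdiff f w w = 'D_1 f w.
Proof. by rewrite /divdiff eqxx. Qed.

Lemma divdiff_ne f w z : z != w -> divdiff f w z = (f z - f w) / (z - w).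
Proof. by rewrite /divdiff => /negbTE ->. Qed.

Lemma divdiffE f w z : f z = f w + (z - w) * divdiff f w z.
Proof.
have [->|zw] := eqVneq z w; first by rewrite subrr mul0r addr0.
by rewrite divdiff_ne// mulrC divfK ?subr_eq0// subrKC.
Qed.

Lemma divdiff_derivable_ne f w z : derivable f z 1 -> z != w ->
  derivable (divdiff f w) z 1.
Proof.
move=> df zw; have := derivable_quotient (k := f w) df zw.
apply: near_eq_derivable; apply/nbhsC; exists (cn (z - w)).
  by rewrite cn_gt0 subr_eq0.
move=> t tz; rewrite /divdiff; case: eqP => // tE.
by move: tz; rewrite tE cnB ltxx.
Qed.

Lemma divdiff_continuous f w z : derivable f z 1 ->
  {for z, continuous (divdiff f w)}.
Proof.
move=> df; have [zw|zw] := eqVneq z w; last first.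
  by apply: derivable_continuous; exact: divdiff_derivable_ne.
rewrite -zw in df *; apply/cvgC => e e0; rewrite divdiff_id.
have e20 : 0 < e / 2 by rewrite divr_gt0.
have /is_deriveC/(_ _ e20)[r r0 rP] := derivableP df.
exists r => // t tr; rewrite /divdiff; case: eqP => [_|/eqP tz].
  by rewrite subrr cn0.
have z0t : 0 < cn (t - z) by rewrite cn_gt0 subr_eq0.
have -> : (f t - f z) / (t - z) - 'D_1 f z =
    (f t - f z - 'D_1 f z * (t - z)) / (t - z).
  by rewrite [RHS]mulrBl mulfK// subr_eq0.
rewrite cnM cnV ltr_pdivrMr// (le_lt_trans (rP _ tr))// ltr_pM2r//.
by rewrite ltr_pdivrMr// ltr_pMr// ltr1n.
Qed.

Section Rectangle.
Variables (a b c d : R) (z0 : C).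
Hypotheses (az : a < complex.Re z0) (zb : complex.Re z0 < b).
Hypotheses (cz : c < complex.Im z0) (zd : complex.Im z0 < d).
Let x0 := complex.Re z0.
Let y0 := complex.Im z0.

Let ab : a < b. Proof. exact: lt_trans zb. Qed.
Let cd : c < d. Proof. exact: lt_trans zd. Qed.

Lemma edge_dist : exists2 r, 0 < r &
  forall z, edges a b c d z -> r <= cn (z - z0).
Proof.
pose r := Num.min (Num.min (x0 - a) (b - x0)) (Num.min (y0 - c) (d - y0)).
have [r1 r2 r3 r4] : [/\ r <= x0 - a, r <= b - x0, r <= y0 - c & r <= d - y0].
  by rewrite /r !ge_min !lexx /= !orbT.
exists r; first by rewrite !lt_min !subr_gt0 az zb cz zd.
move=> z [_ [|[|[|]]] zE].
- rewrite (le_trans r1)// (le_trans _ (cn_Re _))// Re_B zE distrC; exact: ler_norm.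
- rewrite (le_trans r2)// (le_trans _ (cn_Re _))// Re_B zE; exact: ler_norm.
- rewrite (le_trans r3)// (le_trans _ (cn_Im _))// Im_B zE distrC; exact: ler_norm.
- rewrite (le_trans r4)// (le_trans _ (cn_Im _))// Im_B zE; exact: ler_norm.
Qed.

(** A winding number: on each of the four edges the integrand contributes to the
    imaginary part with a positive sign, so that its exact value is not needed. *)
Lemma winding : exists H V,
  edge_primitives a b c d (fun z => (z - z0)^-1) H V /\ contour H V a b c d != 0.
Proof.
have [r r0 rP] := edge_dist.
have co : cont_on (edges a b c d) (fun z => (z - z0)^-1).
  apply: continuous_cont_on => z /rP rz; apply: derivable_continuous.
  have nz : z - z0 != 0 by rewrite -cn_gt0 (lt_le_trans r0).
  exact: cder_derivable (@cderV R (fun t => t - z0) _ _ nz (cder_shift z0 z)).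
have [H [V HV]] := edge_primitives_exist (ltW ab) (ltW cd) co.
exists H, V; split => //; case: HV => hH hV.
apply/eqP => /(congr1 (@complex.Im R)).
apply/eqP; rewrite gt_eqF//.
have sq0 (u v : R) : v != 0 -> 0 < u ^+ 2 + v ^+ 2.
  by move=> v0; rewrite ltr_wpDl ?sqr_ge0// exprn_even_gt0.
have h1 : 0 < complex.Im (H c b) - complex.Im (H c a).
  apply: (@increment_gt0 (fun x => complex.Im (H c x)) (fun x => complex.Im ((Complex x c : C) - z0)^-1)) => // x xab.
    by have [_ h] := hH c (or_introl erefl) x xab; exact: h.
  rewrite /= Im_V Re_B Im_B /= -mulNr divr_gt0 ?oppr_gt0 ?subr_lt0//.
  by rewrite sq0// subr_eq0 lt_eqF.
have h2 : 0 < - complex.Im (H d b) - (- complex.Im (H d a)).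
  apply: (@increment_gt0 (fun x => - complex.Im (H d x)) (fun x => - complex.Im ((Complex x d : C) - z0)^-1)) => // x xab.
    have [_ h] := hH d (or_intror erefl) x xab; exact: is_deriveN h.
  rewrite /= Im_V Re_B Im_B /= opprK divr_gt0 ?subr_gt0//.
  by rewrite sq0// subr_eq0 gt_eqF.
have h3 : 0 < complex.Re (V b d) - complex.Re (V b c).
  apply: (@increment_gt0 (fun x => complex.Re (V b x)) (fun y => complex.Re ((Complex b y : C) - z0)^-1)) => // y ycd.
    by have [h _] := hV b (or_intror erefl) y ycd; exact: h.
  rewrite /= Re_V Re_B Im_B /= divr_gt0 ?subr_gt0//.
  by rewrite addrC sq0// subr_eq0 gt_eqF.
have h4 : 0 < - complex.Re (V a d) - (- complex.Re (V a c)).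
  apply: (@increment_gt0 (fun x => - complex.Re (V a x)) (fun y => - complex.Re ((Complex a y : C) - z0)^-1)) => // y ycd.
    have [h _] := hV a (or_introl erefl) y ycd; exact: is_deriveN h.
  rewrite /= Re_V Re_B Im_B /= -mulNr divr_gt0 ?oppr_gt0 ?subr_lt0//.
  by rewrite addrC sq0// subr_eq0 lt_eqF.
rewrite /contour Im_D !Im_M !Im_B !Re_B /=.
lra.
Qed.

(** Off z0 the integrand is differentiable, so by [goursat] the integral equals that
    over an arbitrarily small square around z0, where the integrand is bounded. *)
Lemma contour_divdiff f H V : (forall z, rect a b c d z -> derivable f z 1) ->
  primitives a b c d (divdiff f z0) H V -> contour H V a b c d = 0.
Proof.
set g := divdiff f z0 => df pr.
have Qz0 : rect a b c d z0 by split; apply/andP; split; exact: ltW.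
have [r1 r10 gb] : exists2 r, 0 < r &
    forall z, cn (z - z0) < r -> cn (g z) <= cn (g z0) + 1.
  have /cvgC/(_ 1 ltr01)[r r0 rP] := divdiff_continuous (w := z0) (df _ Qz0).
  exists r => // z /rP h; rewrite (le_trans (cnBD _ (g z0)))// addrC lerD2l.
  exact: ltW.
pose B := cn (g z0) + 1.
have B0 : 0 < B by rewrite ltr_wpDl ?cn_ge0.
pose r2 := Num.min (Num.min (x0 - a) (b - x0)) (Num.min (y0 - c) (d - y0)).
have r20 : 0 < r2 by rewrite !lt_min !subr_gt0 az zb cz zd.
have [r21 r22 r23 r24] : [/\ r2 <= x0 - a, r2 <= b - x0, r2 <= y0 - c & r2 <= d - y0].
  by rewrite /r2 !ge_min !lexx /= !orbT.
have main r : 0 < r -> r < r2 -> r < r1 / 2 -> cn (contour H V a b c d) <= 16 * B * r.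
  move=> r0 rr2 rr1.
  have z a' b' c' d' : a <= a' -> a' <= b' -> b' <= b -> c <= c' -> c' <= d' -> d' <= d ->
      ~ rect a' b' c' d' z0 -> contour H V a' b' c' d' = 0.
    move=> h1 h2 h3 h4 h5 h6 nz0; apply: (@goursat R g) => //.
      exact: primitives_sub pr.
    move=> z Qz; apply: derivable_diff_on; apply: divdiff_derivable_ne.
      by apply: df; exact: rect_sub Qz.
    by apply/eqP => zE; apply: nz0; rewrite -zE.
  have z1 : contour H V a (x0 - r) c d = 0.
    by apply: z; rewrite ?lexx//; [lra|lra|exact: ltW|move=> [/=]; rewrite -/x0; lra].
  have z2 : contour H V (x0 + r) b c d = 0.
    by apply: z; rewrite ?lexx//; [lra|lra|exact: ltW|move=> [/=]; rewrite -/x0; lra].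
  have z3 : contour H V (x0 - r) (x0 + r) c (y0 - r) = 0.
    by apply: z; rewrite ?lexx//; [lra|lra|lra|lra|lra|move=> [/= _]; rewrite -/y0; lra].
  have z4 : contour H V (x0 - r) (x0 + r) (y0 + r) d = 0.
    by apply: z; rewrite ?lexx//; [lra|lra|lra|lra|lra|move=> [/= _]; rewrite -/y0; lra].
  have -> : contour H V a b c d = contour H V (x0 - r) (x0 + r) (y0 - r) (y0 + r) +
    contour H V a (x0 - r) c d + contour H V (x0 + r) b c d +
    contour H V (x0 - r) (x0 + r) c (y0 - r) +
    contour H V (x0 - r) (x0 + r) (y0 + r) d.
    by rewrite /contour; ring.
  rewrite z1 z2 z3 z4 !addr0.
  have -> : 16 * B * r = 4 * B * ((x0 + r - (x0 - r)) + (y0 + r - (y0 - r))) by ring.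
  have l1 : x0 - r <= x0 + r by lra.
  have l2 : y0 - r <= y0 + r by lra.
  apply: (@contour_bound R _ _ _ _ g) => //.
    apply: primitives_edges => //; apply: primitives_sub pr; lra.
  move=> w [[w1 w2] _]; apply: gb; rewrite (le_lt_trans (cn_le _))//.
  rewrite Re_B Im_B -/x0 -/y0 (_ : r1 = r1 / 2 + r1 / 2); last by field.
  by rewrite ltrD// (le_lt_trans _ rr1)// ler_norml; apply/andP; split; lra.
apply/eqP; rewrite -cn_eq0 eq_le cn_ge0 andbT.
apply/ler_addgt0Pr => e e0; rewrite add0r.
pose r := Num.min (Num.min (r2 / 2) (r1 / 4)) (e / (16 * B)).
have r0 : 0 < r by rewrite !lt_min !divr_gt0// mulr_gt0.
have [s1 s2 s3] : [/\ r <= r2 / 2, r <= r1 / 4 & r <= e / (16 * B)].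
  by rewrite /r !ge_min !lexx /= !orbT.
apply: (@le_trans _ _ (16 * B * r)); first by apply: main => //; lra.
by rewrite mulrC -ler_pdivlMr// mulr_gt0.
Qed.

(** On the boundary, f / (z - z0) is the sum of the divided difference, of integral 0,
    and of f(z0) / (z - z0), whose integral is f(z0) times a non-zero constant. *)
Lemma crude_bound : exists2 K, 0 <= K & forall f M,
  (forall z, rect a b c d z -> derivable f z 1) ->
  (forall z, edges a b c d z -> cn (f z) <= M) -> cn (f z0) <= K * M.
Proof.
have [r r0 rP] := edge_dist.
have [H' [V' [HV' w0]]] := winding.
have w1 : 0 < cn (contour H' V' a b c d) by rewrite cn_gt0.
exists (4 / r * ((b - a) + (d - c)) / cn (contour H' V' a b c d)).
  rewrite !mulr_ge0 ?invr_ge0 ?(ltW r0) ?(ltW w1)//.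
  by rewrite addr_ge0// subr_ge0 ltW.
move=> f M df fM.
pose g := divdiff f z0.
have gc z : rect a b c d z -> {for z, continuous g}.
  by move=> /df; exact: divdiff_continuous.
have [H [V HV]] := primitives_exist (ltW ab) (ltW cd) (continuous_cont_on gc).
have I0 := contour_divdiff df HV.
have [hH hV] := primitives_edges (ltW ab) (ltW cd) HV.
have [hH' hV'] := HV'.
have key (z : C) : edges a b c d z -> g z + f z0 * (z - z0)^-1 = f z / (z - z0).
  move=> /rP rz; rewrite /g divdiff_ne.
    by rewrite -mulrDl subrK.
  by apply/eqP => zE; move: rz; rewrite zE subrr cn0 leNgt r0.
pose H2 y x := H y x + f z0 * H' y x.
pose V2 x y := V x y + f z0 * V' x y.
have pr2 : edge_primitives a b c d (fun z => f z / (z - z0)) H2 V2.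
  split=> [y yE x xab|x xE y ycd].
    rewrite -key; first by apply: pderD; [exact: hH|apply: pderZ; exact: hH'].
    split; last by case: yE => ->; right; right; [left|right].
    by split => //=; case: yE => ->; rewrite ?lexx ltW.
  rewrite -key; first by apply: pderD; [exact: hV|apply: pderZ; exact: hV'].
  split; last by case: xE => ->; [left|right; left].
  by split => //=; case: xE => ->; rewrite ?lexx ltW.
have /(contour_bound (ltW ab) (ltW cd) pr2) : forall z, edges a b c d z ->
    cn (f z / (z - z0)) <= M / r.
  move=> z Ez; rewrite cnM cnV ler_pM ?cn_ge0 ?invr_ge0 ?cn_ge0//.
    exact: fM.
  by rewrite lef_pV2 ?posrE ?rP// (lt_le_trans r0)// rP.
have -> : contour H2 V2 a b c d = contour H V a b c d + f z0 * contour H' V' a b c d.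
  by rewrite /contour /H2 /V2; ring.
rewrite I0 add0r cnM -ler_pdivlMr// => /le_trans; apply.
by rewrite le_eqVlt; apply/orP; left; apply/eqP; ring.
Qed.

End Rectangle.

Lemma geometric_le (A B c K : R) : 0 <= A -> 0 <= B -> 0 < c ->
  (forall n, c * A ^+ n <= K * B ^+ n) -> A <= B.
Proof.
move=> A0 B0 c0 H; rewrite leNgt; apply/negP => BA.
have [B00|] := eqVneq B 0.
  move: (H 1%N) BA; rewrite B00 !expr1 mulr0 pmulr_rle0// => A1 A2.
  by move: (lt_le_trans A2 A1); rewrite ltxx.
move=> /eqP Bn0; have {}B0 : 0 < B by rewrite lt_neqAle B0 andbT eq_sym; apply/eqP.
pose t := A / B - 1.
have t0 : 0 < t by rewrite subr_gt0 ltr_pdivlMr// mul1r.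
have bern n : 1 + n%:R * t <= (1 + t) ^+ n.
  elim: n => [|n IH]; first by rewrite mul0r addr0 expr0.
  rewrite exprS; apply: (@le_trans _ _ ((1 + t) * (1 + n%:R * t))).
    rewrite -natr1; have : 0 <= t * (n%:R * t).
      by rewrite !mulr_ge0// ?(ltW t0).
    by move=> h; lra.
  by rewrite ler_pM2l// addr_gt0.
have AE n : A ^+ n = B ^+ n * (1 + t) ^+ n.
  by rewrite -exprMn /t subrKC mulrC divfK ?gt_eqF.
have bd n : n%:R < K / c / t.
  rewrite ltr_pdivlMr// ltr_pdivlMr//.
  have := H n; rewrite AE mulrCA mulrC ler_pM2r ?exprn_gt0// => h.
  apply: lt_le_trans h; rewrite mulrC ltr_pM2l//.
  by apply: lt_le_trans (bern n); rewrite ltrDr.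
have := bd (Num.trunc (K / c / t)).+1; apply/negP; rewrite -leNgt ltW//.
exact: truncnS_gt.
Qed.

Lemma prod_derivable (E : seq C) z : derivable (fun w => \prod_(e <- E) (w - e)) z 1.
Proof.
elim: E => [|e E IH].
  under eq_fun do rewrite big_nil; exact: derivable_cst.
under eq_fun do rewrite big_cons.
exact: cder_derivable (cderM (cder_shift e z) (derivable_cder IH)).
Qed.

Lemma prod_bounded (a b c d : R) (E : seq C) : exists2 M, 0 <= M &
  forall z, rect a b c d z -> cn (\prod_(e <- E) (z - e)) <= M.
Proof.
elim: E => [|e E [M M0 MP]].
  by exists 1 => // z _; rewrite big_nil cn1.
exists ((`|a| + `|b| + `|c| + `|d| + cn e) * M).
  by rewrite mulr_ge0// addr_ge0 ?cn_ge0// !addr_ge0.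
move=> z Qz; rewrite big_cons cnM ler_pM ?cn_ge0 ?MP//.
rewrite (le_trans (cnD _ _))// cnN lerD2r (le_trans (cn_le _))//.
case: Qz => [/andP[z1 z2] /andP[z3 z4]].
have bnd (u v w : R) : u <= w -> w <= v -> `|w| <= `|u| + `|v|.
  move=> uw wv; rewrite ler_norml.
  have := ler_norm v; have := ler_norm (- u); rewrite normrN.
  have := normr_ge0 u; have := normr_ge0 v.
  by move=> *; apply/andP; split; lra.
by rewrite -addrA lerD// bnd.
Qed.

(** The product of f^n with a polynomial vanishing on E is differentiable everywhere,
    so that [crude_bound] applies to it; the constant and the polynomial disappear on
    taking n-th roots. *)
Theorem maximum_modulus (a b c d : R) (E : seq C) f (M : R) :
  (forall z, rect a b c d z -> {for z, continuous f}) ->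
  (forall z, rect a b c d z -> z \notin E -> derivable f z 1) ->
  (forall z, edges a b c d z -> cn (f z) <= M) ->
  forall z, rect a b c d z -> z \notin E -> cn (f z) <= M.
Proof.
move=> fc fd fM z0 Qz0 z0E.
have [/fM//|int] := pselect (edges a b c d z0).
have [[/andP[az zb] /andP[cz zd]]] := Qz0.
have nE : [/\ complex.Re z0 <> a, complex.Re z0 <> b, complex.Im z0 <> c &
    complex.Im z0 <> d] by split => h; apply: int; split => //; tauto.
case: nE => /eqP n1 /eqP n2 /eqP n3 /eqP n4.
have {az}az : a < complex.Re z0 by rewrite lt_neqAle eq_sym n1.
have {zb}zb : complex.Re z0 < b by rewrite lt_neqAle n2.
have {cz}cz : c < complex.Im z0 by rewrite lt_neqAle eq_sym n3.
have {zd}zd : complex.Im z0 < d by rewrite lt_neqAle n4.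
have ab := lt_trans az zb; have cd := lt_trans cz zd.
have [K K0 KP] := crude_bound az zb cz zd.
have [Mq Mq0 MqP] := prod_bounded a b c d E.
have M0 : 0 <= M.
  apply: le_trans (cn_ge0 _) (fM (Complex a c : C) _).
  by split; [split => /=; rewrite lexx ltW|left].
pose q z := \prod_(e <- E) (z - e).
have q0 : 0 < cn (q z0).
  rewrite cn_gt0 prodf_seq_neq0; apply/allP => e eE /=.
  by rewrite subr_eq0; apply: contraNneq z0E => ->.
apply: (@geometric_le _ _ (cn (q z0)) (K * Mq)) => // [|n]; first exact: cn_ge0.
rewrite -cnX -cnM -mulrA.
apply: (KP (fun z => q z * f z ^+ n)) => [z Qz|z Ez]; last first.
  rewrite cnM cnX ler_pM ?cn_ge0 ?exprn_ge0 ?cn_ge0//; first by apply: MqP; case: Ez.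
  by rewrite lerXn2r ?nnegrE ?cn_ge0 ?fM.
have [zE|zE] := boolP (z \in E); last first.
  exact: cder_derivable (cderM (derivable_cder (@prod_derivable E z))
    (cderX n (derivable_cder (fd _ Qz zE)))).
pose k w := (\prod_(e <- rem z E) (w - e)) * f w ^+ n.
have kc : {for z, continuous k}.
  have c1 : (fun w => \prod_(e <- rem z E) (w - e)) x @[x --> z] -->
      \prod_(e <- rem z E) (z - e).
    exact: (derivable_continuous (@prod_derivable (rem z E) z)).
  have c2 : f x ^+ n @[x --> z] --> f z ^+ n.
    apply: (@continuous_cvg _ _ _ _ (nbhs_filter z) _ (fun x : C => x ^+ n)); last exact: fc.
    exact: (cder_continuous (cderX n (cder_id (f z)))).
  exact: (cvgM c1 c2).
have qk w : q w * f w ^+ n = (w - z) * k w.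
  by rewrite /q (perm_big _ (perm_to_rem zE)) big_cons /= mulrA.
apply: (@cder_derivable R _ z (k z)); rewrite /cder.
apply/is_deriveC => e e0; have /cvgC/(_ e e0)[r r0 rP] := kc.
exists r => // w wr; rewrite !qk subrr mul0r subr0 mulrC -mulrBl cnM.
by rewrite ler_wpM2r ?cn_ge0// ltW// rP.
Qed.

End MaximumModulus.

(** * Holomorphic functions *)

Section Holomorphic.
Variable R : realType.
Local Notation C := (cplx R).
Implicit Types (f g : C -> C) (D : set C) (z w : C).

Definition holo D f := forall z, D z -> derivable f z 1.

Definition square w (r : R) : set C :=
  rect (complex.Re w - r) (complex.Re w + r) (complex.Im w - r) (complex.Im w + r).

Definition square_edges w (r : R) : set C :=
  edges (complex.Re w - r) (complex.Re w + r) (complex.Im w - r) (complex.Im w + r).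

Lemma squareP w r z : square w r z <->
  `|complex.Re (z - w)| <= r /\ `|complex.Im (z - w)| <= r.
Proof.
by rewrite Re_B Im_B !ler_distl.
Qed.

Lemma square_edges_dist w r z : square_edges w r z -> r <= cn (z - w).
Proof.
move=> [_ zE]; have [h|h|h|h] : [\/ complex.Re (z - w) = - r,
  complex.Re (z - w) = r, complex.Im (z - w) = - r | complex.Im (z - w) = r].
- rewrite Re_B Im_B; case: zE => [->|[->|[->|->]]];
  [constructor 1|constructor 2|constructor 3|constructor 4]; ring.
- by rewrite (le_trans _ (cn_Re _))// h normrN ler_norm.
- by rewrite (le_trans _ (cn_Re _))// h ler_norm.
- by rewrite (le_trans _ (cn_Im _))// h normrN ler_norm.
- by rewrite (le_trans _ (cn_Im _))// h ler_norm.
Qed.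

Lemma ball_square w r z : cn (z - w) <= r -> square w r z.
Proof.
by move=> zr; apply/squareP; rewrite !(le_trans _ zr)// ?cn_Re ?cn_Im.
Qed.

Lemma square_cn w r z : square w r z -> cn (z - w) <= r + r.
Proof. by move=> /squareP[z1 z2]; rewrite (le_trans (cn_le _))// lerD. Qed.

Lemma square_trans w r w' r' : square w r w' ->
  square w' r' `<=` square w (r + r').
Proof.
move=> /squareP[h1 h2] z /squareP[h3 h4]; apply/squareP.
have -> : z - w = (w' - w) + (z - w') by ring.
by rewrite Re_D Im_D !(le_trans (ler_normD _ _))// lerD.
Qed.

Lemma nbhs_square D w : nbhs w D -> exists2 r : R, 0 < r & square w r `<=` D.
Proof.
move=> /nbhsC[r r0 rD]; exists (r / 4); first by rewrite divr_gt0.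
move=> z /square_cn zr; apply: rD; apply: (le_lt_trans zr); lra.
Qed.

Lemma open_square D w : open D -> D w -> exists2 r : R, 0 < r & square w r `<=` D.
Proof. by move=> oD Dw; apply: nbhs_square; exact: open_nbhs_nbhs. Qed.

Lemma rect_compact (a b c d : R) : compact (rect a b c d : set C).
Proof.
pose F (p : R * R) : C := Complex p.1 p.2.
have -> : rect a b c d = F @` (`[a, b]%classic `*` `[c, d]%classic).
  apply/seteqP; split=> [z [z1 z2]|_ [[x y] [/= x1 y1] <-]].
    exists (complex.Re z, complex.Im z); last by case: z {z1 z2}.
    by split; rewrite /= in_itv.
  by split; rewrite /= ?(itvP x1) ?(itvP y1).
apply: continuous_compact; last by apply: compact_setX; exact: segment_compact.
apply: continuous_subspaceT => -[x y] U /nbhsC[e e0 eU].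
exists (ball x (e / 2), ball y (e / 2)).
  by split; apply: nbhsx_ballx; rewrite divr_gt0.
move=> [x' y'] [/= hx hy]; apply: eU; rewrite (le_lt_trans (cn_le _))//=.
rewrite [ltRHS](splitr e) ltrD//.
  by rewrite distrC; exact: hx.
by rewrite distrC; exact: hy.
Qed.

Lemma cn_continuous : continuous (@cn R : C -> R).
Proof.
move=> z; apply/(@cvgrPdist_lt _ R _ _ (nbhs_filter z)) => e e0.
apply/nbhsC; exists e => // w wz.
rewrite (le_lt_trans _ wz)// ler_norml.
have := cnBD w z; have := cnBD z w; rewrite (cnB z w) => *.
by apply/andP; split; lra.
Qed.

Lemma compact_bound (K : set C) f : compact K ->
  (forall z, K z -> {for z, continuous f}) ->
  exists2 M : R, 0 < M & forall z, K z -> cn (f z) <= M.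
Proof.
move=> cK fc; have [->|/set0P K0] := eqVneq K set0; first by exists 1.
have [|z _ zM] := @compact_EVT_max _ R (fun z => cn (f z)) K K0 cK.
  apply: continuous_in_subspaceT => z /set_mem Kz.
  apply: continuous_comp; first exact: fc.
  exact: cn_continuous.
exists (cn (f z) + 1); first by rewrite ltr_wpDl ?cn_ge0.
by move=> t Kt; rewrite (le_trans (zM t _)) ?inE// lerDl.
Qed.

Lemma maximum_modulus_square w r f (M : R) : holo (square w r) f ->
  (forall z, square_edges w r z -> cn (f z) <= M) ->
  forall z, square w r z -> cn (f z) <= M.
Proof.
move=> hf fM z Qz.
have c t (Qt : square w r t) : {for t, continuous f}.
  exact: derivable_continuous (hf t Qt).
have d t (Qt : square w r t) (_ : t \notin [::]) : derivable f t 1 by exact: hf.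
exact: (maximum_modulus c d fM Qz).
Qed.

Lemma square_shift w r : 0 < r -> square w r w.
Proof.
by move=> r0; apply/squareP; rewrite subrr /= normr0 ltW.
Qed.

Section Removable.
Variables (D : set C) (f : C -> C) (w : C).
Hypotheses (oD : open D) (hf : holo D f) (Dw : D w).
Let g := divdiff f w.
Let S t z := (g z - g t) / (z - t).

Let gc z : D z -> {for z, continuous g}.
Proof. by move=> /hf; exact: divdiff_continuous. Qed.

Let SE t z : t != w -> z != w -> z != t ->
  S t z = (divdiff f t z - divdiff f w z) / (t - w).
Proof.
move=> tw zw zt; rewrite /S /g (divdiff_ne _ tw) (divdiff_ne _ zw) (divdiff_ne _ zt).
have n1 : t - w != 0 by rewrite subr_eq0.
have n2 : z - w != 0 by rewrite subr_eq0.
have n3 : z - t != 0 by rewrite subr_eq0.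
by field; rewrite n1 n2 n3.
Qed.

(** On the boundary of a square, S t is uniformly close to S w as t tends to w; the
    maximum modulus principle, with w, t and t' as exceptional points, carries the
    resulting Cauchy estimate to the inside. *)
Let S_cauchy (e : R) : 0 < e -> exists2 r, 0 < r &
  forall t t', t != w -> t' != w -> cn (t - w) < r -> cn (t' - w) < r ->
  forall z, z != w -> z != t -> z != t' -> cn (z - w) < r ->
    cn (S t z - S t' z) <= e.
Proof.
move=> e0; have [r r0 rD] := open_square oD Dw.
have [B B0 BP] := compact_bound (@rect_compact _ _ _ _) (fun z Qz => gc (rD z Qz)).
have e'0 : 0 < e / 2 * (r / 2) / 2 by rewrite !mulr_gt0 ?invr_gt0.
have /cvgC/(_ _ e'0)[r1 r10 r1P] := gc Dw.
pose r2 := e / 2 * (r * (r / 2)) / (4 * B).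
have r20 : 0 < r2 by rewrite !mulr_gt0 ?invr_gt0 ?mulr_gt0.
exists (Num.min (r / 2) (Num.min r1 r2)); first by rewrite !lt_min divr_gt0// r10.
move=> t t' tw t'w; rewrite 2!lt_min => /and3P[t1 t2 t3].
rewrite 2!lt_min => /and3P[t'1 t'2 t'3].
have near_edge s z : s != w -> cn (s - w) < r / 2 -> cn (s - w) < r1 -> cn (s - w) < r2 ->
    square_edges w r z -> [/\ z != s, z != w & cn (S s z - S w z) <= e / 2].
  move=> sw s1 s2 s3 Ez; have rz := square_edges_dist Ez.
  have rs : r / 2 <= cn (z - s).
    have := cnD (z - s) (s - w); rewrite subrKA => h; lra.
  have zs : z - s != 0 by rewrite -cn_gt0 (lt_le_trans _ rs)// divr_gt0.
  have zw : z - w != 0 by rewrite -cn_gt0 (lt_le_trans _ rz).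
  split; [by rewrite -subr_eq0|by rewrite -subr_eq0|].
  have -> : S s z - S w z = (g w - g s) / (z - s) +
      (g z - g w) * (s - w) / ((z - s) * (z - w)).
    by rewrite /S; field; rewrite zs zw.
  rewrite (le_trans (cnD _ _))// !cnM !cnV !cnM.
  have h1 : cn (g w - g s) / cn (z - s) <= e / 2 / 2.
    have h := ltW (r1P _ s2).
    rewrite ler_pdivrMr ?cn_gt0// (cnB (g w)) (le_trans h)// mulrAC.
    by rewrite ler_wpM2l// !divr_ge0// ltW.
  have h2 : cn (g z - g w) * cn (s - w) / (cn (z - s) * cn (z - w)) <= e / 2 / 2.
    have Qz : square w r z by case: Ez.
    rewrite ler_pdivrMr ?mulr_gt0 ?cn_gt0//.
    apply: (@le_trans _ _ ((B + B) * r2)).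
      rewrite ler_pM ?cn_ge0// ?(ltW s3)// (le_trans (cnD _ _))// cnN.
      by rewrite lerD// BP//; exact: square_shift.
    have -> : (B + B) * r2 = e / 2 / 2 * (r / 2 * r).
      by rewrite /r2; field; rewrite gt_eqF.
    by rewrite ler_wpM2l// ?ler_pM// ?(ltW r0) ?ltW// !divr_gt0.
  by rewrite [leRHS]splitr lerD.
move=> z zw zt zt'; rewrite 2!lt_min => /and3P[z1 _ _].
pose G s z := (divdiff f s z - divdiff f w z) / (s - w).
have Ds s : cn (s - w) < r / 2 -> D s.
  by move=> sr; apply: rD; apply: ball_square; lra.
have dG s x : s != w -> D x -> x != s -> x != w -> derivable (G s) x 1.
  move=> sw Dx xs xw; apply: cder_derivable.
  apply: (@cderM R (fun z => divdiff f s z - divdiff f w z)); last exact: cder_cst.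
  by apply: cderB; apply: derivable_cder; apply: divdiff_derivable_ne => //; exact: hf.
have cG s x : s != w -> D x -> {for x, continuous (G s)}.
  move=> sw Dx; have c1 := divdiff_continuous (w := s) (hf Dx).
  have c2 := divdiff_continuous (w := w) (hf Dx).
  exact: (cvgM (cvgB c1 c2) (cvg_cst _)).
have Ez : square w r z by apply: ball_square; lra.
rewrite !SE//.
apply: (@maximum_modulus R _ _ _ _ [:: w; t; t'] (fun z => G t z - G t' z) e _ _ _ z Ez).
- move=> x /rD Dx; exact: (cvgB (cG _ _ tw Dx) (cG _ _ t'w Dx)).
- move=> x /rD Dx; rewrite !inE !negb_or => /and3P[xw xt xt'].
  by apply: (@cder_derivable R _ _ _ (cderB (derivable_cder _) (derivable_cder _)));
    exact: dG.
- move=> x Ex; have [xt xw h1] := near_edge t x tw t1 t2 t3 Ex.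
  have [xt' _ h2] := near_edge t' x t'w t'1 t'2 t'3 Ex.
  rewrite /G -!SE//.
  have -> : S t x - S t' x = (S t x - S w x) - (S t' x - S w x) by ring.
  by rewrite (le_trans (cnD _ _))// cnN (splitr e) lerD.
- by rewrite !inE !negb_or zw zt zt'.
Qed.

(** t' tends to w in the Cauchy estimate; the symmetry of S in its two arguments then
    compares the values of S w at t and z. *)
Let S_limit (e : R) : 0 < e -> exists2 r, 0 < r &
  forall t z, t != w -> z != w -> cn (t - w) < r -> cn (z - w) < r ->
    cn (S w t - S w z) <= e.
Proof.
move=> e0; have e20 : 0 < e / 2 by rewrite divr_gt0.
have [r r0 rP] := S_cauchy e20; exists r => // t z.
have half x y : x != y -> x != w -> y != w -> cn (x - w) < r -> cn (y - w) < r ->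
    cn (S x y - S w y) <= e / 2.
  move=> xy xw yw xr yr; apply/ler_addgt0Pr => n n0.
  have yw0 : y - w != 0 by rewrite subr_eq0.
  have c1 : {for w, continuous (fun s => S s y)}.
    have i1 : (fun s => y - s) s @[s --> w] --> y - w.
      exact: (cvgB (cvg_cst _) cvg_id).
    exact: (cvgM (cvgB (cvg_cst _) (gc Dw)) (cvgV yw0 i1)).
  have /cvgC/(_ _ n0)[q q0 qP] := c1.
  pose m := Num.min (Num.min q r) (cn (y - w)) / 2.
  have m0 : 0 < m by rewrite divr_gt0// !lt_min q0 r0 cn_gt0.
  have [m1 m2 m3] : [/\ m < q, m < r & m < cn (y - w)].
    have h : m < Num.min (Num.min q r) (cn (y - w)).
      by rewrite ltr_pdivrMr// ltr_pMr ?ltr1n// !lt_min q0 r0 cn_gt0.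
    by move: h; rewrite !lt_min => /andP[/andP[]].
  pose s := w + m%:C%C; have sw : s - w = m%:C%C by rewrite /s addrC addKr.
  have cs : cn (s - w) = m by rewrite sw cn_real gtr0_norm.
  have sw0 : s != w by rewrite -subr_eq0 -cn_gt0 cs.
  have ys : y != s.
    by apply/eqP => ys; move: m3; rewrite ys cs ltxx.
  have -> : S x y - S w y = (S x y - S s y) + (S s y - S w y) by ring.
  rewrite (le_trans (cnD _ _))// lerD//.
    by apply: rP => //; rewrite ?cs// eq_sym.
  by rewrite ltW// qP// cs.
move=> tw zw tr zr; have [->|tz] := eqVneq t z; first by rewrite subrr cn0 ltW.
have St : S z t = S t z.
  by rewrite /S -[in LHS]opprB -[(t - z)]opprB invrN mulrNN.
have -> : S w t - S w z = (S t z - S w z) - (S z t - S w t) by rewrite St; ring.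
rewrite (le_trans (cnD _ _))// cnN (splitr e) lerD// half//.
by rewrite eq_sym.
Qed.

Lemma divdiff_derivable_at : derivable g w 1.
Proof.
have cauchy_part (p : C -> R) : (forall x y, `|p x - p y| <= cn (x - y)) ->
    cvg (p (S w z) @[z --> w^']).
  move=> pl; apply: cauchy_cvg; apply: cauchy_exP => e e0.
  have e20 : 0 < e / 2 by rewrite divr_gt0.
  have [r r0 rP] := S_limit e20.
  pose t := w + (r / 2)%:C%C.
  have tw : cn (t - w) = r / 2.
    by rewrite /t addrC addKr cn_real gtr0_norm// divr_gt0.
  have tw0 : t != w by rewrite -subr_eq0 -cn_gt0 tw divr_gt0.
  exists (p (S w t)); apply/nbhsC; exists r => // z zr zw.
  rewrite /= /ball /= (le_lt_trans (pl _ _))//.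
  apply: (le_lt_trans (rP t z _ _ _ _)) => //.
    by rewrite tw ltr_pdivrMr// ltr_pMr// ltr1n.
  by rewrite ltr_pdivrMr// ltr_pMr// ltr1n.
have /cvg_ex[/= a aP] := cauchy_part (@complex.Re R)
  (fun x y => ltac:(rewrite -Re_B; exact: cn_Re)).
have /cvg_ex[/= b bP] := cauchy_part (@complex.Im R)
  (fun x y => ltac:(rewrite -Im_B; exact: cn_Im)).
apply: (@cder_derivable R _ _ (Complex a b)); apply/is_deriveC => e e0.
have e20 : 0 < e / 2 by rewrite divr_gt0.
have near_limit (p : C -> R) (l : R) : p (S w z) @[z --> w^'] --> l ->
    exists2 r, 0 < r & forall z, cn (z - w) < r -> z != w ->
      `|p (S w z) - l| < e / 2.
  move=> pl; apply/nbhsC; apply: (pl [set x | `|x - l| < e / 2]).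
  by apply/nbhs_ballP; exists (e / 2) => // x; rewrite /ball /= distrC.
have {aP} [r1 r10 aP] := near_limit _ _ aP.
have {bP} [r2 r20 bP] := near_limit _ _ bP.
exists (Num.min r1 r2); first by rewrite lt_min r10.
move=> z; rewrite lt_min => /andP[z1 z2].
have [->|zw] := eqVneq z w; first by rewrite !subrr mulr0 subr0 cn0 mulr0.
have zw0 : z - w != 0 by rewrite subr_eq0.
have -> : g z - g w - Complex a b * (z - w) = (S w z - Complex a b) * (z - w).
  by rewrite mulrBl /S divfK.
rewrite cnM ler_wpM2r ?cn_ge0// (le_trans (cn_le _))// Re_B Im_B /= (splitr e).
have h1 := aP z z1 zw; have h2 := bP z z2 zw.
by rewrite lerD// ltW.
Qed.

End Removable.

(** In place of Cauchy's formula, all regularity of holomorphic functions is derived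
    from this statement. *)
Theorem divdiff_holo D f w : open D -> holo D f -> D w -> holo D (divdiff f w).
Proof.
move=> oD hf Dw z Dz; have [->|zw] := eqVneq z w.
  exact: divdiff_derivable_at Dw.
by apply: divdiff_derivable_ne => //; exact: hf.
Qed.

(** The maximum modulus principle for the divided difference at the centre. *)
Lemma cauchy_estimate D f z r B : open D -> holo D f -> 0 < r ->
  square z r `<=` D -> (forall t, square z r t -> cn (f t) <= B) ->
  cn ('D_1 f z) <= (B + B) / r.
Proof.
move=> oD hf r0 QD fB; rewrite -divdiff_id.
have Qz : square z r z by exact: square_shift.
apply: (@maximum_modulus_square z r) => //.
  by move=> t /QD; exact: (divdiff_holo oD hf (QD _ Qz)).
move=> t Et; have rt := square_edges_dist Et.
have tz : t != z by rewrite -subr_eq0 -cn_gt0 (lt_le_trans r0).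
have Qt : square z r t by case: Et.
rewrite divdiff_ne// cnM cnV ler_pM ?cn_ge0 ?invr_ge0 ?cn_ge0//.
  by rewrite (le_trans (cnD _ _))// cnN lerD// fB.
by rewrite lef_pV2 ?posrE// (lt_le_trans r0).
Qed.

Lemma deriv_divdiffE D f w z : open D -> holo D f -> D w -> D z ->
  'D_1 f z = divdiff f w z + (z - w) * 'D_1 (divdiff f w) z.
Proof.
move=> oD hf Dw Dz; have hg := divdiff_holo oD hf Dw.
have := cderD (cder_cst (f w) z) (cderM (cder_shift w z) (derivable_cder (hg _ Dz))).
rewrite add0r mul1r; apply: cder_unique.
have -> : (fun t => f w + (t - w) * divdiff f w t) = f.
  by apply/funext => t; rewrite -divdiffE.
exact/derivable_cder/hf.
Qed.

Lemma deriv_continuous D f w : open D -> holo D f -> D w ->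
  {for w, continuous (fun z => 'D_1 f z)}.
Proof.
move=> oD hf Dw; have hg := divdiff_holo oD hf Dw.
have [r r0 rD] := open_square oD Dw.
have [B B0 BP] := compact_bound (@rect_compact _ _ _ _)
  (fun z Qz => derivable_continuous (hg z (rD z Qz))).
have r20 : 0 < r / 2 by rewrite divr_gt0.
have dgB z : cn (z - w) < r / 2 -> cn ('D_1 (divdiff f w) z) <= (B + B) / (r / 2).
  move=> zr; have Qs : square z (r / 2) `<=` square w r.
    have /square_trans : square w (r / 2) z by apply: ball_square; exact: ltW.
    by move=> /(_ (r / 2)); rewrite -splitr.
  apply: (cauchy_estimate oD hg r20) => [t /Qs/rD//|t /Qs]; exact: BP.
apply/cvgC => e e0; have e20 : 0 < e / 2 by rewrite divr_gt0.
have /cvgC/(_ _ e20)[r1 r10 r1P] := derivable_continuous (hg _ Dw).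
pose k := (B + B) / (r / 2); have k0 : 0 < k by rewrite divr_gt0// addr_gt0.
exists (Num.min (Num.min r1 (r / 2)) (e / 2 / k)).
  by rewrite !lt_min r10 r20 divr_gt0.
move=> z; rewrite !lt_min => /andP[/andP[z1 z2] z3].
have Dz : D z by apply: rD; apply: ball_square; lra.
rewrite /= (deriv_divdiffE oD hf Dw Dz) -(divdiff_id f w).
rewrite addrAC (le_lt_trans (cnD _ _))// [ltRHS]splitr ltrD//; first exact: r1P.
rewrite cnM; apply: (@le_lt_trans _ _ (cn (z - w) * k)).
  by rewrite ler_wpM2l ?cn_ge0// dgB.
by rewrite -ltr_pdivlMr.
Qed.

(** With g the divided difference of f at w, f' = g + (z - w) g', so that f' has the
    derivative 2 g'(w) at w as soon as g' is continuous there. *)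
Theorem deriv_holo D f : open D -> holo D f -> holo D (fun z => 'D_1 f z).
Proof.
move=> oD hf w Dw; have hg := divdiff_holo oD hf Dw.
pose l := 'D_1 (divdiff f w) w.
apply: (@cder_derivable R _ _ (l + l)); apply/is_deriveC => e e0.
have e20 : 0 < e / 2 by rewrite divr_gt0.
have /is_deriveC/(_ _ e20)[r1 r10 r1P] := derivable_cder (hg _ Dw).
have /cvgC/(_ _ e20)[r2 r20 r2P] := deriv_continuous oD hg Dw.
have [r r0 rD] := open_square oD Dw.
exists (Num.min (Num.min r1 r2) r); first by rewrite !lt_min r10 r20.
move=> z; rewrite !lt_min => /andP[/andP[z1 z2] z3].
have Dz : D z by apply: rD; apply: ball_square; exact: ltW.
rewrite /= (deriv_divdiffE oD hf Dw Dz) -(divdiff_id f w).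
have -> : divdiff f w z + (z - w) * 'D_1 (divdiff f w) z - divdiff f w w -
    (l + l) * (z - w) = (divdiff f w z - divdiff f w w - l * (z - w)) +
    ('D_1 (divdiff f w) z - l) * (z - w) by ring.
have -> : e * cn (z - w) = e / 2 * cn (z - w) + e / 2 * cn (z - w) by field.
rewrite (le_trans (cnD _ _))// lerD//; first exact: r1P.
by rewrite cnM ler_wpM2r ?cn_ge0// ltW// r2P.
Qed.

Lemma taylor D f b w m : open D -> holo D f -> holo D b -> D w -> b w = 0 ->
  (forall z, D z -> b z = 0 -> z = w) -> 'D_1 b w != 0 ->
  exists (a : nat -> C) t, holo D t /\
    forall z, D z -> f z = \sum_(k < m) a k * b z ^+ k + b z ^+ m * t z.
Proof.
move=> oD hf hb Dw bw b0 b1; elim: m => [|m [a [t [ht tE]]]].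
  by exists (fun=> 0), f; split => // z _; rewrite big_ord0 add0r expr0 mul1r.
have u0 z : D z -> divdiff b w z != 0.
  move=> Dz; have [->|zw] := eqVneq z w; first by rewrite divdiff_id.
  rewrite divdiff_ne// bw subr0 mulf_neq0 ?invr_eq0 ?subr_eq0//.
  by apply: contraNneq zw => /(b0 z Dz) ->.
exists (fun k => if (k < m)%N then a k else t w).
exists (fun z => divdiff t w z / divdiff b w z); split.
  move=> z Dz; have hg := divdiff_holo oD ht Dw; have hu := divdiff_holo oD hb Dw.
  exact: cder_derivable (cder_div (u0 _ Dz) (derivable_cder (hg _ Dz))
    (derivable_cder (hu _ Dz))).
move=> z Dz; rewrite tE// big_ord_recr /= ltnn -addrA; congr (_ + _).
  by apply: eq_bigr => k _; rewrite ltn_ord.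
have bE : b z = (z - w) * divdiff b w z by have := divdiffE b w z; rewrite bw add0r.
have tb : (z - w) * divdiff t w z = b z * (divdiff t w z / divdiff b w z).
  by rewrite bE -mulrA [divdiff b w z * _]mulrC divfK// u0.
by rewrite {1}(divdiffE t w z) tb exprSr; ring.
Qed.

(** The maximum modulus principle for t, as |z - w| >= r on the edges of the square. *)
Lemma schwarz D w r m g t (M : R) : 0 < r -> square w r `<=` D -> holo D t ->
  (forall z, D z -> g z = (z - w) ^+ m * t z) ->
  (forall z, square w r z -> cn (g z) <= M) ->
  forall z, cn (z - w) <= r / 2 -> cn (g z) <= M / 2 ^+ m.
Proof.
move=> r0 QD ht gE gM z zr.
have Qz : square w r z by apply: ball_square; rewrite (le_trans zr)// ler_pdivrMr// ler_pMr// ler1n.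
have : cn (t z) <= M / r ^+ m.
  apply: (@maximum_modulus_square w r) => // [x /QD|x Ex]; first exact: ht.
  have Qx : square w r x by case: Ex.
  rewrite ler_pdivlMr ?exprn_gt0// (le_trans _ (gM _ Qx))// gE ?cnM; last exact: QD.
  rewrite cnX mulrC ler_wpM2r ?cn_ge0// lerXn2r ?nnegrE ?cn_ge0 ?(ltW r0)//.
  exact: square_edges_dist.
move=> tz; rewrite gE ?cnM; last exact: QD.
apply: (@le_trans _ _ ((r / 2) ^+ m * (M / r ^+ m))).
  rewrite ler_pM ?cn_ge0// cnX lerXn2r ?nnegrE ?cn_ge0//.
  by rewrite divr_ge0// ltW.
have r1 : r ^+ m != 0 by rewrite expf_neq0// gt_eqF.
have two : (2 ^+ m : R) != 0 by rewrite expf_neq0// pnatr_eq0.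
by rewrite expr_div_n mulrC mulrA divfK.
Qed.

(** A function divisible by all powers of z - w vanishes near w, by [schwarz]. *)
Lemma holo_order D f w : open D -> holo D f -> D w ->
  ~ (\forall z \near w, f z = 0) ->
  exists e h, [/\ holo D h, h w != 0 & forall z, D z -> f z = (z - w) ^+ e * h z].
Proof.
move=> oD hf Dw nz; apply: contrapT => no.
have all m : exists t, holo D t /\ forall z, D z -> f z = (z - w) ^+ m * t z.
  elim: m => [|m [t [ht tE]]].
    by exists f; split => // z _; rewrite expr0 mul1r.
  exists (divdiff t w); split; first exact: divdiff_holo.
  have tw : t w = 0.
    by apply: contrapT => /eqP tw; apply: no; exists m, t.
  move=> z Dz; rewrite tE// {1}(divdiffE t w z) tw add0r exprSr mulrA; ring.
apply: nz; have [r r0 rD] := open_square oD Dw.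
have [B B0 BP] := compact_bound (@rect_compact _ _ _ _)
  (fun z Qz => derivable_continuous (hf z (rD z Qz))).
apply/nbhsC; exists (r / 2); first by rewrite divr_gt0.
move=> z /ltW zr; apply/eqP; apply: contraT; rewrite -cn_gt0 => fz0.
have : (2 : R) <= 1.
  apply: (@geometric_le R _ _ (cn (f z)) B) => // n.
  rewrite expr1n mulr1 -ler_pdivlMr ?exprn_gt0//.
  have [t [ht tE]] := all n.
  exact: (schwarz r0 rD ht tE BP zr).
by rewrite leNgt ltr1n.
Qed.

End Holomorphic.

(** * Schwarzian derivatives and Moebius maps *)

(** Locked, so that unification does not compare the underlying limits. *)
HB.lock Definition der (R : realType) (f : cplx R -> cplx R) : cplx R -> cplx R :=
  fun z => 'D_1 f z.

Section Jets.
Variable R : realType.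
Local Notation C := (cplx R).
Implicit Types (f g : C -> C) (D O : set C) (z w : C).

Definition wronskian (x0 x1 y0 y1 : C) : C := y1 * x0 - y0 * x1.

(** For y = Y / X with Wronskian w = Y' X - Y X', this is 2 w^2 {y; z} in terms of the
    jets of X and Y, where {y; z} = y''' / y' - 3/2 (y'' / y')^2. Unlike {y; z} it has
    no poles at the zeros of X and w. *)
Definition schwarzian (x0 x1 x2 x3 y0 y1 y2 y3 : C) : C :=
  let w0 := wronskian x0 x1 y0 y1 in
  let w1 := y2 * x0 - y0 * x2 in
  let w2 := y3 * x0 + y2 * x1 - y1 * x2 - y0 * x3 in
  2 * w0 * w2 - 3 * w1 ^+ 2 + 4 * w0 * (y2 * x1 - y1 * x2).

Lemma derE f z : der f z = 'D_1 f z.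
Proof. by rewrite der.unlock. Qed.

Lemma cder_der f z d : cder f z d -> der f z = d.
Proof. by case=> _ <-; exact: derE. Qed.

Lemma der_holo D f : open D -> holo D f -> holo D (der f).
Proof. by move=> oD hf; rewrite der.unlock; exact: deriv_holo. Qed.

Definition wronskian_of X Y z := wronskian (X z) (der X z) (Y z) (der Y z).

Definition schwarzian_of X Y z := schwarzian
  (X z) (der X z) (der (der X) z) (der (der (der X)) z)
  (Y z) (der Y z) (der (der Y) z) (der (der (der Y)) z).

Lemma der_on O f h h' : open O -> (forall z, O z -> f z = h z) ->
  (forall z, O z -> cder h z (h' z)) -> forall z, O z -> der f z = h' z.
Proof.
move=> oO fh dh z Oz; apply: cder_der; apply: cder_near (dh z Oz).
have : nbhs z O by exact: open_nbhs_nbhs.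
by apply: filterS => w /fh ->.
Qed.

Lemma holo_cder D f z : holo D f -> D z -> cder f z (der f z).
Proof. by move=> hf Dz; rewrite derE; exact/derivable_cder/hf. Qed.

(** The jet of l * (u o g), where u0, .., u3 stand for the composites of g with u and
    its derivatives, and g1, g2, g3 for the derivatives of g. *)
Lemma product_jet O f (l0 l1 l2 l3 u0 u1 u2 u3 g1 g2 g3 : C -> C) : open O ->
  (forall z, O z -> [/\ cder l0 z (l1 z), cder l1 z (l2 z) & cder l2 z (l3 z)]) ->
  (forall z, O z -> [/\ cder u0 z (u1 z * g1 z), cder u1 z (u2 z * g1 z) &
     cder u2 z (u3 z * g1 z)]) ->
  (forall z, O z -> cder g1 z (g2 z) /\ cder g2 z (g3 z)) ->
  (forall z, O z -> f z = l0 z * u0 z) ->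
  forall z, O z ->
  [/\ der f z = l1 z * u0 z + l0 z * (u1 z * g1 z),
      der (der f) z = l2 z * u0 z + 2 * l1 z * (u1 z * g1 z) +
        l0 z * (u2 z * g1 z ^+ 2 + u1 z * g2 z) &
      der (der (der f)) z = l3 z * u0 z + 3 * l2 z * (u1 z * g1 z) +
        3 * l1 z * (u2 z * g1 z ^+ 2 + u1 z * g2 z) +
        l0 z * (u3 z * g1 z ^+ 3 + 3 * u2 z * (g1 z * g2 z) + u1 z * g3 z)].
Proof.
move=> oO hl hu hg fE.
have d1 : forall z, O z -> der f z = l1 z * u0 z + l0 z * (u1 z * g1 z).
  apply: (der_on oO fE) => z Oz; have [a1 a2 a3] := hl z Oz.
  by have [b1 b2 b3] := hu z Oz; exact: cderM.
have d2 : forall z, O z -> der (der f) z = l2 z * u0 z + 2 * l1 z * (u1 z * g1 z) +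
        l0 z * (u2 z * g1 z ^+ 2 + u1 z * g2 z).
  apply: (der_on oO d1) => z Oz; have [a1 a2 a3] := hl z Oz.
  have [b1 b2 b3] := hu z Oz; have [c1 c2] := hg z Oz.
  by apply: cder_eq (cderD (cderM a2 b1) (cderM a1 (cderM b2 c1))) _; ring.
move=> z Oz; split; [exact: d1|exact: d2|].
move: z Oz; apply: (der_on oO d2) => z Oz; have [a1 a2 a3] := hl z Oz.
have [b1 b2 b3] := hu z Oz; have [c1 c2] := hg z Oz.
have t1 := cderM a3 b1.
have t2 := cderM (cderM (cder_cst 2 z) a2) (cderM b2 c1).
have t3 := cderM a1 (cderD (cderM b3 (cderX 2 c1)) (cderM b2 c2)).
by apply: cder_eq (cderD (cderD t1 t2) t3) _; rewrite /= expr1; ring.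
Qed.

Lemma schwarzian_jet (X0 X1 X2 X3 Y0 Y1 Y2 Y3 x0 x1 x2 x3 y0 y1 y2 y3
    l0 l1 l2 l3 g1 g2 g3 : C) :
  X0 = l0 * x0 -> X1 = l1 * x0 + l0 * (x1 * g1) ->
  X2 = l2 * x0 + 2 * l1 * (x1 * g1) + l0 * (x2 * g1 ^+ 2 + x1 * g2) ->
  X3 = l3 * x0 + 3 * l2 * (x1 * g1) + 3 * l1 * (x2 * g1 ^+ 2 + x1 * g2) +
    l0 * (x3 * g1 ^+ 3 + 3 * x2 * (g1 * g2) + x1 * g3) ->
  Y0 = l0 * y0 -> Y1 = l1 * y0 + l0 * (y1 * g1) ->
  Y2 = l2 * y0 + 2 * l1 * (y1 * g1) + l0 * (y2 * g1 ^+ 2 + y1 * g2) ->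
  Y3 = l3 * y0 + 3 * l2 * (y1 * g1) + 3 * l1 * (y2 * g1 ^+ 2 + y1 * g2) +
    l0 * (y3 * g1 ^+ 3 + 3 * y2 * (g1 * g2) + y1 * g3) ->
  2 * g1 * g3 = 3 * g2 ^+ 2 ->
  wronskian X0 X1 Y0 Y1 = l0 ^+ 2 * g1 * wronskian x0 x1 y0 y1 /\
  schwarzian X0 X1 X2 X3 Y0 Y1 Y2 Y3 =
    l0 ^+ 4 * g1 ^+ 4 * schwarzian x0 x1 x2 x3 y0 y1 y2 y3.
Proof.
move=> -> -> -> -> -> -> -> -> gS; split; first by rewrite /wronskian; ring.
apply/eqP; rewrite -subr_eq0; apply/eqP.
transitivity (l0 ^+ 4 * wronskian x0 x1 y0 y1 ^+ 2 * (2 * g1 * g3 - 3 * g2 ^+ 2)).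
  by rewrite /schwarzian /wronskian; ring.
by rewrite gS subrr mulr0.
Qed.

(** The hypothesis on g says that {g; z} = 0, as for Moebius maps; by the cocycle rule
    for Schwarzian derivatives, {y o g; z} = g'^2 {y; g(z)}. The factor l does not
    change the quotient of X and Y. *)
Lemma schwarzian_change O D X Y X' Y' l g : open O -> open D ->
  holo O l -> holo O g -> (forall z, O z -> D (g z)) -> holo D X' -> holo D Y' ->
  (forall z, O z -> X z = l z * X' (g z)) ->
  (forall z, O z -> Y z = l z * Y' (g z)) ->
  (forall z, O z -> 2 * der g z * der (der (der g)) z = 3 * der (der g) z ^+ 2) ->
  forall z, O z ->
  wronskian_of X Y z = l z ^+ 2 * der g z * wronskian_of X' Y' (g z) /\
  schwarzian_of X Y z = l z ^+ 4 * der g z ^+ 4 * schwarzian_of X' Y' (g z).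
Proof.
move=> oO oD hl hg gOD hX hY XE YE gS z Oz.
have jl z' : O z' -> [/\ cder l z' (der l z'), cder (der l) z' (der (der l) z') &
    cder (der (der l)) z' (der (der (der l)) z')].
  move=> Oz'; have h1 := der_holo oO hl; have h2 := der_holo oO h1.
  by split; [exact: holo_cder hl Oz'|exact: holo_cder h1 Oz'|exact: holo_cder h2 Oz'].
have jg z' : O z' -> cder (der g) z' (der (der g) z') /\
    cder (der (der g)) z' (der (der (der g)) z').
  move=> Oz'; have h1 := der_holo oO hg; have h2 := der_holo oO h1.
  by split; [exact: holo_cder h1 Oz'|exact: holo_cder h2 Oz'].
have ju (u : C -> C) : holo D u -> forall z', O z' ->
  [/\ cder (fun z => u (g z)) z' (der u (g z') * der g z'),
      cder (fun z => der u (g z)) z' (der (der u) (g z') * der g z') &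
      cder (fun z => der (der u) (g z)) z' (der (der (der u)) (g z') * der g z')].
  move=> hu z' Oz'; have h1 := der_holo oD hu; have h2 := der_holo oD h1.
  have dg := holo_cder hg Oz'; have Dg := gOD _ Oz'.
  split; apply: cder_comp dg.
  - exact: holo_cder hu Dg.
  - exact: holo_cder h1 Dg.
  - exact: holo_cder h2 Dg.
have [x1 x2 x3] := product_jet oO jl (ju _ hX) jg XE Oz.
have [y1 y2 y3] := product_jet oO jl (ju _ hY) jg YE Oz.
exact: schwarzian_jet (XE z Oz) x1 x2 x3 (YE z Oz) y1 y2 y3 (gS z Oz).
Qed.

End Jets.

Section Moebius.
Variable R : realType.
Local Notation C := (cplx R).
Implicit Types (a : 'M[R]_2) (z : C).
Local Notation H := (@upper_half_plane R).

Definition automorphy a z : C := (a 1 0)%:C%C * z + (a 1 1)%:C%C.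

Lemma open_half_plane : open H.
Proof.
rewrite openE => z Hz; apply/nbhsC; exists (complex.Im z) => // w wz.
have := le_lt_trans (cn_Im _) wz; rewrite Im_B ltr_norml => /andP[h _].
by rewrite /upper_half_plane /=; lra.
Qed.

Lemma det_mx2 a : \det a = a 0 0 * a 1 1 - a 0 1 * a 1 0.
Proof.
rewrite (expand_det_row _ ord0) !big_ord_recl big_ord0 addr0 /cofactor !det_mx11.
rewrite !mxE /= addn0 expr0 mul1r addn1 expr1 mulN1r.
rewrite mulrN; congr (_ * _ - _ * _); congr (a _ _); exact/val_inj.
Qed.

Lemma automorphy_neq0 a z : \det a = 1 -> H z -> automorphy a z != 0.
Proof.
rewrite det_mx2 /automorphy => da Hz; apply/eqP => h.
have := congr1 (@complex.Im R) h; have := congr1 (@complex.Re R) h.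
rewrite !Im_D !Re_D !Im_M !Re_M /= !mul0r subr0 !addr0 => hr.
move=> /eqP; rewrite mulf_eq0 (gt_eqF Hz) orbF => /eqP a10.
move: hr da; rewrite a10 mul0r add0r => ->; rewrite !mulr0 subr0 => /eqP.
by rewrite eq_sym oner_eq0.
Qed.

Lemma mobius_cder a z : \det a = 1 -> H z ->
  cder (mobius a) z ((automorphy a z)^-2).
Proof.
move=> da Hz; have J0 := automorphy_neq0 da Hz.
have lin (p q : C) : cder (fun z => p * z + q) z p.
  apply: cder_eq (cderD (cderM (cder_cst p z) (cder_id z)) (cder_cst q z)) _.
  by ring.
apply: cder_eq (cder_div J0 (lin _ _) (lin _ _)) _.
have da' : (a 0 0)%:C%C * (a 1 1)%:C%C - (a 0 1)%:C%C * (a 1 0)%:C%C = 1 :> C.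
  by rewrite -!rmorphM -rmorphB -det_mx2 da.
rewrite -[(_ - _)]/((_ - _) : C).
have -> : (a 0 0)%:C%C * automorphy a z -
  ((a 0 0)%:C%C * z + (a 0 1)%:C%C) * (a 1 0)%:C%C = 1 :> C.
  by rewrite -da' /automorphy; ring.
by rewrite mul1r.
Qed.

Lemma mobius_holo a : \det a = 1 -> holo H (mobius a).
Proof. by move=> da z Hz; exact: cder_derivable (mobius_cder da Hz). Qed.

Lemma mobius_derE a z : \det a = 1 -> H z -> der (mobius a) z = (automorphy a z)^-2.
Proof. by move=> da Hz; exact: cder_der (mobius_cder da Hz). Qed.

Lemma mobius_schwarzian a z : \det a = 1 -> H z ->
  2 * der (mobius a) z * der (der (der (mobius a))) z =
  3 * der (der (mobius a)) z ^+ 2.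
Proof.
move=> da Hz; pose c : C := (a 1 0)%:C%C.
have dJ t : cder (automorphy a) t c.
  apply: cder_eq (cderD (cderM (cder_cst c t) (cder_id t))
    (cder_cst (a 1 1)%:C%C t)) _; by ring.
have dX n t : H t -> cder (fun s => (automorphy a s ^+ n)^-1) t
    (- (n%:R * c) / automorphy a t ^+ n.+1).
  move=> Ht; have J0 := automorphy_neq0 da Ht.
  apply: cder_eq (cderV _ (cderX n (dJ t))) _; first by rewrite expf_neq0.
  case: n => [|n]; first by rewrite !mul0r oppr0 !mul0r.
  have Jn : automorphy a t ^+ n != 0 by rewrite expf_neq0.
  by rewrite /= !exprS; field; rewrite J0 Jn.
have d1 := mobius_derE da.
have d2 t : H t -> der (der (mobius a)) t = - (2 * c) / automorphy a t ^+ 3.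
  move: t; apply: (der_on open_half_plane (fun t Ht => mobius_derE da Ht)).
  exact: (dX 2%N).
have d3 t : H t -> der (der (der (mobius a))) t = 6 * c ^+ 2 / automorphy a t ^+ 4.
  move: t; apply: (der_on open_half_plane d2) => t Ht.
  by apply: cder_eq (cderM (cder_cst (- (2 * c)) t) (dX 3%N t Ht)) _; ring.
have J0 := automorphy_neq0 da Hz.
by rewrite d1// d2// d3//; field.
Qed.

Lemma mobius_Im a z : \det a = 1 -> H z ->
  complex.Im (mobius a z) = complex.Im z * cn (der (mobius a) z).
Proof.
move=> da Hz; rewrite mobius_derE// cnV cnX.
have J0 := automorphy_neq0 da Hz; move: da; rewrite det_mx2.
rewrite -/(automorphy a z) in J0 *.
move=> da; rewrite /mobius -/(automorphy a z) Im_M Im_V Re_V.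
have -> : cn (automorphy a z) ^+ 2 = complex.Re (automorphy a z) ^+ 2 +
   complex.Im (automorphy a z) ^+ 2.
  rewrite /cn; case: (automorphy a z) => u v /=.
  by rewrite sqr_sqrtr// addr_ge0// sqr_ge0.
rewrite mulrN !mulrA addrC -mulrBl; congr (_ / _).
rewrite /automorphy !Re_D !Im_D !Re_M !Im_M /=.
rewrite -[RHS]mulr1 -da; ring.
Qed.

End Moebius.

(** * Charts of the curve along the covering map *)

(** Near coverings are applied to the filter of the families containing a given finite
    family. *)
Lemma compact_subcover (T : topologicalType) (I : eqType) (K : set T)
    (D : set I) (O : I -> set T) : compact K ->
  (forall i, D i -> open (O i)) -> (forall x, K x -> exists2 i, D i & O i x) ->
  exists2 s : seq I, (forall i, i \in s -> D i) &
    forall x, K x -> exists2 i, i \in s & O i x.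
Proof.
move=> /compact_near_coveringP cK oO KO.
pose F : set_system (seq I) := [set U | exists2 s0 : seq I,
  (forall i, i \in s0 -> D i) &
  forall s : seq I, (forall i, i \in s -> D i) -> {subset s0 <= s} -> U s].
have FF : Filter F.
  split.
  - by exists [::].
  - move=> P Q [s1 D1 P1] [s2 D2 Q2]; exists (s1 ++ s2).
      by move=> i; rewrite mem_cat => /orP[/D1|/D2].
    move=> s Ds sub; split; [apply: P1 => //|apply: Q2 => //] => i si;
      by apply: sub; rewrite mem_cat si ?orbT.
  - by move=> P Q PQ [s0 D0 P0]; exists s0 => // s Ds sub; apply/PQ/P0.
have [x Kx|s0 D0 sP] := cK (seq I) F (fun s x => exists2 i, i \in s & O i x) FF.
  have [i Di Oix] := KO x Kx.
  exists (O i, [set s : seq I | i \in s]).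
    split; first by apply: open_nbhs_nbhs; split => //; exact: oO.
    exists [:: i]; first by move=> j; rewrite inE => /eqP ->.
    by move=> s _; apply; rewrite inE.
  by move=> [y s] [/= Oy si]; exists i.
by exists s0 => //; apply: sP.
Qed.

Lemma nbhs_preimage (X Y : topologicalType) (f : X -> Y) x (U : set Y) :
  {for x, continuous f} -> open U -> U (f x) -> nbhs x (f @^-1` U).
Proof. by move=> cf oU Ux; apply: cf; exact: open_nbhs_nbhs. Qed.

(** A covering map is open and has continuous local sections; the continuity of s is
    expressed by the last clause, together with s (f x) = x on W. *)
Lemma covering_local (X Y : topologicalType) (A : set X) (B : set Y) (f : X -> Y) z :
  covering_map A B f -> A z -> exists (W : set X) (s : Y -> X),
  [/\ open W, W z, W `<=` A, (forall x, W x -> s (f x) = x) &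
    forall U, open U -> exists2 O, open O &
      forall y, O y /\ B y <-> exists x, [/\ W x, U x & f x = y]].
Proof.
move=> [_ fAB cov] Az; have Bz : B (f z) by rewrite -fAB; exists z.
have [V [oV Vz [sheets [oW _ sheetsE homeo]]]] := cov _ Bz.
have [W sW Wz] : (\bigcup_(W in sheets) W) z by rewrite sheetsE.
have [g [bij gK _ gc]] := homeo W sW.
have fW x : W x -> B (f x) /\ V (f x).
  by move=> Wx; case: bij => im _ _; apply: im.
have gf y : B y -> V y -> W (g y) /\ f (g y) = y.
  case: bij => _ _ surj By Vy; have [x Wx <-] := surj y (conj By Vy).
  by rewrite gK ?inE.
exists W, g; split => //.
- exact: oW.
- move=> x Wx; have h : (\bigcup_(W in sheets) W) x by exists W.
  by move: h; rewrite sheetsE => -[].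
- by move=> x Wx; rewrite gK ?inE.
move=> U oU; have /continuousP/(_ U oU)/open_subspaceP [N openN OE] := gc.
exists (N `&` V); first exact: openI.
move=> y; split=> [[[Ny Vy] By]|[x [Wx Ux <-]]].
  have [Wg fg] := gf y By Vy; exists (g y); split => //.
  have : (N `&` (B `&` V)) y by [].
  by rewrite OE => -[].
have [Bx Vx] := fW x Wx; split => //; split => //.
have : (g @^-1` U `&` (B `&` V)) (f x) by split => //=; rewrite gK ?inE.
by rewrite -OE => -[].
Qed.

Local Open Scope quotient_scope.

Section ProjectiveCharts.
Variables (R : realType) (k : nat).
Local Notation C := (cplx R).
Implicit Types (q : CP R k) (A : 'M[C]_k.+1) (v : 'cV[C]_k.+1).

(** The linear form of coefficients v, normalized by the first linear form of the
    coordinate system A. *)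
Definition ratio A v q : C := (hcoord q *m v) 0 0 / (hcoord q *m A) 0 0.

Lemma mulmx_col A (h : 'rV[C]_k.+1) c : (h *m col c A) 0 0 = (h *m A) 0 c.
Proof. by rewrite !mxE; apply: eq_bigr => i _; rewrite mxE. Qed.

Lemma affine_ratio A j q :
  affine_coord A j q = ratio A (col (lift ord0 j) A) q.
Proof. by rewrite /affine_coord /ratio mulmx_col. Qed.

Lemma ratio_id A q : finite_part A q -> ratio A (col ord0 A) q = 1.
Proof. by move=> Aq; rewrite /ratio mulmx_col divff. Qed.

Lemma ratio_change A A' v q : finite_part A' q ->
  ratio A v q = ratio A (col ord0 A') q * ratio A' v q.
Proof. by move=> A'q; rewrite /ratio mulmx_col [RHS]mulrC mulrA divfK. Qed.

Lemma ratioE A v q : A \in unitmx -> finite_part A q ->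
  ratio A v q = (invmx A *m v) 0 0 +
    \sum_(j < k) affine_coord A j q * (invmx A *m v) (lift ord0 j) 0.
Proof.
move=> uA Aq; rewrite /ratio.
have -> : hcoord q *m v = (hcoord q *m A) *m (invmx A *m v).
  by rewrite -mulmxA mulKVmx.
rewrite mxE mulr_suml big_ord_recl mulrAC divff// mul1r; congr (_ + _).
by apply: eq_bigr => j _; rewrite mulrAC.
Qed.

Lemma hcoord_neq0 q : hcoord q != 0.
Proof. by have := valP (repr q); rewrite inE. Qed.

Lemma chart_exists q : exists2 A, A \in unitmx & finite_part A q.
Proof.
have /rV0Pn[i hi] := hcoord_neq0 q.
exists (tperm_mx ord0 i); first exact: unitmx_perm.
by rewrite /finite_part /= -xcolE mxE tpermL.
Qed.

Lemma same_line_finite A (v w : nzrow R k) : same_line v w ->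
  (val v *m A) 0 0 != 0 -> (val w *m A) 0 0 != 0.
Proof.
move=> /andP[/sub_rVP[c vE] _]; rewrite vE -scalemxAl mxE.
by apply: contraNneq => ->; rewrite mulr0.
Qed.

Lemma open_finite_part A : open (finite_part A).
Proof.
pose Q : quotType (nzrow R k) := {eq_quot @same_line_equiv_rel R k}.
rewrite /open /= /quotient_open.
have -> : \pi_(quotient_topology Q) @^-1` finite_part A =
    [set v : nzrow R k | (val v *m A) 0 0 != 0].
  have sl (v : nzrow R k) : same_line (repr (\pi_(quotient_topology Q) v)) v.
    apply/(@eqquotP _ (@same_line_equiv_rel R k) Q).
    exact: reprK.
  apply/seteqP; split=> v; rewrite /finite_part /= /hcoord.
    exact: same_line_finite (sl v).
  apply: same_line_finite; rewrite /same_line andbC; exact: sl v.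
have cont : continuous (fun v : nzrow R k => (val v *m A) 0 0).
  have -> : (fun v : nzrow R k => (val v *m A) 0 0) =
      (fun v : nzrow R k => \sum_i (val v) 0 i * A i 0) by apply/funext => x; rewrite mxE.
  move=> x; elim: (index_enum _) => [|i r IH].
    have -> : (fun v : nzrow R k => \sum_(i <- [::]) \val v 0 i * A i 0) = fun=> 0.
      by apply/funext => y; rewrite big_nil.
    exact: cst_continuous.
  have -> : (fun v : nzrow R k => \sum_(j <- i :: r) \val v 0 j * A j 0) =
      fun v : nzrow R k => \val v 0 i * A i 0 + \sum_(j <- r) \val v 0 j * A j 0.
    by apply/funext => y; rewrite big_cons.
  have ci : {for x, continuous (fun v : nzrow R k => val v 0 i)}.
    apply: (@continuous_comp _ _ _ (fun v : nzrow R k => val v)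
      (fun M : 'rV[C]_k.+1 => M 0 i)); last exact: coord_continuous.
    exact: initial_continuous.
  have cA : {for x, continuous (fun v : nzrow R k => val v 0 i * A i 0)}.
    exact: (cvgM ci (cvg_cst _)).
  exact: (cvgD cA IH).
have -> : [set v : nzrow R k | (val v *m A) 0 0 != 0] =
    (fun v : nzrow R k => (val v *m A) 0 0) @^-1` [set x | x != 0] by [].
move/continuousP : cont; apply.
rewrite openE => x /= x0; apply/nbhsC; exists (cn x); first by rewrite cn_gt0.
by move=> y; apply: contraTneq => ->; rewrite sub0r cnN ltxx.
Qed.

End ProjectiveCharts.

Section Uniformized.
Variables (R : realType) (k : nat).
Local Notation C := (cplx R).
Local Notation H := (@upper_half_plane R).
Variables (S : set (CP R k)) (G : set 'M[R]_2) (f : C -> CP R k).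
Hypotheses (hG : PSL2_subgroup G) (hf : uniformization G S f).
Implicit Types (A : 'M[C]_k.+1) (v : 'cV[C]_k.+1) (z w : C).

Definition chart_domain A : set C := H `&` f @^-1` finite_part A.

Lemma open_chart_domain A : open (chart_domain A).
Proof.
rewrite openE => z [Hz Az]; apply: filterI.
  exact: (open_nbhs_nbhs (conj (@open_half_plane R) Hz)).
case: hf => hol _ _; have [cf _] := hol z Hz.
exact: (nbhs_preimage cf (@open_finite_part R k A) Az).
Qed.

Lemma ratio_holo A v : A \in unitmx -> holo (chart_domain A) (ratio A v \o f).
Proof.
move=> uA z [Hz Az]; case: hf => hol _ _; have [_ hA] := hol z Hz.
have dA j := derivable_cder (hA A uA Az j).
apply: cder_derivable.
have := cderD (cder_cst ((invmx A *m v) 0 0) z)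
  (@cder_sum R _ (index_enum 'I_k) _ z _
    (fun j => cderM (dA j) (cder_cst ((invmx A *m v) (lift ord0 j) 0) z))).
apply: cder_near; have : nbhs z (chart_domain A).
  exact: (open_nbhs_nbhs (conj (@open_chart_domain A) (conj Hz Az))).
by apply: filterS => w [_ Aw]; rewrite /= ratioE.
Qed.

Lemma det_group a : G a -> \det a = 1.
Proof. by case: hG => h _ _ _ _; exact: h. Qed.

Lemma mobius_half_plane a z : \det a = 1 -> H z -> H (mobius a z).
Proof.
move=> da Hz; rewrite /upper_half_plane /= mobius_Im// mulr_gt0// cn_gt0 mobius_derE//.
by rewrite invr_eq0 expf_neq0// automorphy_neq0.
Qed.

Lemma uniform_mobius a z : G a -> H z -> f (mobius a z) = f z.
Proof.
move=> Ga Hz; case: hf => _ _ fE; apply/esym/fE => //; last by exists a.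
exact: mobius_half_plane (det_group Ga) Hz.
Qed.

Lemma mobius_continuous a z : \det a = 1 -> H z -> {for z, continuous (mobius a)}.
Proof. by move=> da Hz; exact: cder_continuous (mobius_cder da Hz). Qed.

Local Notation X A v := (ratio A v \o f).

(** Two lifts of the same point of S differ by a Moebius map of the group; m is its
    derivative at z, of modulus Im w / Im z. *)
Lemma chart_change A A' v0 v1 z w : A \in unitmx -> A' \in unitmx ->
  chart_domain A z -> chart_domain A' w -> f z = f w ->
  exists m : C, [/\ cn m = complex.Im w / complex.Im z,
    X A v0 z = ratio A (col ord0 A') (f z) * X A' v0 w,
    X A v1 z = ratio A (col ord0 A') (f z) * X A' v1 w,
    wronskian_of (X A v0) (X A v1) z = ratio A (col ord0 A') (f z) ^+ 2 * m *
      wronskian_of (X A' v0) (X A' v1) w &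
    schwarzian_of (X A v0) (X A v1) z = ratio A (col ord0 A') (f z) ^+ 4 * m ^+ 4 *
      schwarzian_of (X A' v0) (X A' v1) w].
Proof.
move=> uA uA' Dz Dw fzw; have [Hz Az] := Dz; have [Hw A'w] := Dw.
case: hf => _ _ fE; have [a Ga wE] := (fE z w Hz Hw).1 fzw.
have da := det_group Ga.
pose O := chart_domain A `&` mobius a @^-1` chart_domain A'.
have openO : open O.
  rewrite openE => t [[Ht At] Dt]; apply: filterI.
    exact: (open_nbhs_nbhs (conj (@open_chart_domain A) (conj Ht At))).
  exact: (nbhs_preimage (mobius_continuous da Ht) (@open_chart_domain A') Dt).
have Oz : O z by split; [exact: Dz|rewrite /preimage /mkset -wE; exact: Dw].
have sub (D : set C) h : chart_domain A `<=` D -> holo D h -> holo O h.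
  by move=> AD hh t [At _]; exact/hh/AD.
have XE v t : O t -> X A v t = X A (col ord0 A') t * X A' v (mobius a t).
  move=> [[Ht At] [_ A't]]; rewrite /= uniform_mobius//.
  by apply: ratio_change; move: A't; rewrite /= uniform_mobius.
have [W1 E1] := schwarzian_change openO (@open_chart_domain A')
  (sub _ _ (fun _ h => h) (ratio_holo (v := col ord0 A') uA))
  (sub _ _ (fun _ h => proj1 h) (mobius_holo da))
  (fun t Ot => proj2 Ot) (ratio_holo (v := v0) uA') (ratio_holo (v := v1) uA')
  (XE v0) (XE v1) (fun t Ot => mobius_schwarzian da (proj1 (proj1 Ot))) Oz.
exists (der (mobius a) z); split.
- by rewrite wE mobius_Im// mulrAC divff ?mul1r// gt_eqF.
- by have := XE v0 z Oz; rewrite -wE.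
- by have := XE v1 z Oz; rewrite -wE.
- by rewrite W1 -wE.
- by rewrite E1 -wE.
Qed.

End Uniformized.

(** * Algebraic dependence of invariant functions *)

Lemma linear_system (F : fieldType) (I J : finType) (M : I -> J -> F) :
  (#|J| < #|I|)%N ->
  exists2 c : I -> F, (exists i, c i != 0) & forall j, \sum_i c i * M i j = 0.
Proof.
move=> JI.
pose A : 'M[F]_(#|I|, #|J|) := \matrix_(i, j) M (enum_val i) (enum_val j).
have : kermx A != 0.
  rewrite -mxrank_eq0 mxrank_ker -lt0n subn_gt0.
  exact: leq_ltn_trans (rank_leq_col A) JI.
move=> /rowV0Pn[v /sub_kermxP vA /rV0Pn[i0 vi0]].
exists (fun i => v 0 (enum_rank i)).
  by exists (enum_val i0); rewrite enum_valK.
move=> j; have /matrixP/(_ 0 (enum_rank j)) := vA; rewrite !mxE => vj.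
apply: etrans vj; rewrite [RHS](reindex (@enum_rank I)) /=; last first.
  by apply: onW_bij; exact: enum_rank_bij.
by apply: eq_bigr => i _; rewrite !mxE !enum_rankK.
Qed.

Lemma seq_bound (R : realType) (I : eqType) (P : I -> R -> Prop) (s : seq I) :
  (forall i b b', b <= b' -> P i b -> P i b') ->
  (forall i, i \in s -> exists b, P i b) ->
  exists2 B, 1 <= B & forall i, i \in s -> P i B.
Proof.
move=> mono; elim: s => [|i s IH] Ps; first by exists 1.
have [j js|B B1 BP] := IH; first by apply: Ps; rewrite inE js orbT.
have [|b Pb] := Ps i; first by rewrite inE eqxx.
exists (Num.max B b); first by rewrite le_max B1.
move=> j; rewrite inE => /orP[/eqP ->|/BP Pj].
  by apply: mono Pb; rewrite le_max lexx orbT.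
by apply: mono Pj; rewrite le_max lexx.
Qed.

Section Siegel.
Variables (R : realType) (k : nat).
Local Notation C := (cplx R).
Local Notation H := (@upper_half_plane R).
Variables (S : set (CP R k)) (G : set 'M[R]_2) (f : C -> CP R k).
Hypotheses (hG : PSL2_subgroup G) (hf : uniformization G S f) (cS : compact S).
Variables (v0 v1 : 'cV[C]_k.+1).
Implicit Types (A : 'M[C]_k.+1) (z w : C).

Local Notation X A v := (ratio A v \o f).

(** The monomial y^a r^b for y = X1 / X0 and r = {y; z} / y'^2, cleared of its
    denominators: with w the Wronskian of X0 and X1, y' = w / X0^2 and r is e X0^4
    divided by 2 w^4, so this is y^a r^b (2 X0 w^4)^n. *)
Definition mono A n (p : 'I_n.+1 * 'I_n.+1) z : C :=
  (X A v1 z ^+ p.1 * X A v0 z ^+ (n - p.1)) *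
  ((schwarzian_of (X A v0) (X A v1) z * X A v0 z ^+ 4) ^+ p.2 *
   (2 * wronskian_of (X A v0) (X A v1) z ^+ 4) ^+ (n - p.2)).

Lemma wronskian_schwarzian_holo A : A \in unitmx ->
  holo (chart_domain f A) (wronskian_of (X A v0) (X A v1)) /\
  holo (chart_domain f A) (schwarzian_of (X A v0) (X A v1)).
Proof.
move=> uA; have oD := open_chart_domain (A := A) hf.
have jet v z : chart_domain f A z ->
  [/\ cder (X A v) z (der (X A v) z), cder (der (X A v)) z (der (der (X A v)) z),
      cder (der (der (X A v))) z (der (der (der (X A v))) z) &
      cder (der (der (der (X A v)))) z (der (der (der (der (X A v)))) z)].
  move=> Dz; have h0 := ratio_holo (v := v) hf uA; have h1 := der_holo oD h0.
  have h2 := der_holo oD h1; have h3 := der_holo oD h2.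
  by split; [exact: holo_cder h0 Dz|exact: holo_cder h1 Dz|exact: holo_cder h2 Dz|
    exact: holo_cder h3 Dz].
split=> z Dz; have [x0 x1 x2 x3] := jet v0 z Dz; have [y0 y1 y2 y3] := jet v1 z Dz.
  exact: cder_derivable (cderB (cderM y1 x0) (cderM y0 x1)).
have c n := cder_cst (n : C) z.
have w0 := cderB (cderM y1 x0) (cderM y0 x1).
have w1 := cderB (cderM y2 x0) (cderM y0 x2).
have w2 := cderB (cderB (cderD (cderM y3 x0) (cderM y2 x1)) (cderM y1 x2)) (cderM y0 x3).
have w3 := cderB (cderM y2 x1) (cderM y1 x2).
exact: cder_derivable (cderD (cderB (cderM (cderM (c 2) w0) w2)
  (cderM (c 3) (cderX 2 w1))) (cderM (cderM (c 4) w0) w3)).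
Qed.

Lemma mono_holo A n (p : 'I_n.+1 * 'I_n.+1) : A \in unitmx ->
  holo (chart_domain f A) (mono A p).
Proof.
move=> uA z Dz; have [hW hE] := wronskian_schwarzian_holo uA.
have dx := holo_cder (ratio_holo (v := v0) hf uA) Dz.
have dy := holo_cder (ratio_holo (v := v1) hf uA) Dz.
have dW := holo_cder hW Dz; have dE := holo_cder hE Dz.
exact: cder_derivable (cderM (cderM (cderX p.1 dy) (cderX (n - p.1) dx))
  (cderM (cderX p.2 (cderM dE (cderX 4 dx)))
    (cderX (n - p.2) (cderM (cder_cst 2 z) (cderX 4 dW))))).
Qed.

Definition form n (c : 'I_n.+1 * 'I_n.+1 -> C) A z := \sum_p c p * mono A p z.

Lemma form_holo n c A : A \in unitmx -> holo (chart_domain f A) (form (n := n) c A).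
Proof.
move=> uA z Dz; apply: cder_derivable.
apply: (@cder_sum R _ (index_enum _) (fun p z => c p * mono A p z)) => p.
exact: cderM (cder_cst _ _) (holo_cder (mono_holo (p := p) uA) Dz).
Qed.

(** The monomials of one n are all multiplied by the same factor under a change of
    lift and of chart, y and r being invariant. *)
Lemma form_change n c A A' z w : A \in unitmx -> A' \in unitmx ->
  chart_domain f A z -> chart_domain f A' w -> f z = f w ->
  exists2 m : C, cn m = complex.Im w / complex.Im z &
    form (n := n) c A z =
      (ratio A (col ord0 A') (f z) ^+ 9 * m ^+ 4) ^+ n * form c A' w.
Proof.
move=> uA uA' Dz Dw fzw.
have [m [mE x0 x1 WE EE]] := chart_change hG hf v0 v1 uA uA' Dz Dw fzw.
exists m => //; rewrite /form mulr_sumr; apply: eq_bigr => p _.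
rewrite [RHS]mulrCA; congr (_ * _).
rewrite /mono x0 x1 WE EE {x0 x1 WE EE mE}.
move: (ratio A (col ord0 A') (f z)) => l.
move: (X A' v0 w) (X A' v1 w) (wronskian_of _ _ _) (schwarzian_of _ _ _) => x0 x1 u e.
case: p => a b /=.
have an : (a <= n)%N by rewrite -ltnS.
have bn : (b <= n)%N by rewrite -ltnS.
have -> : l ^+ 4 * m ^+ 4 * e * (l * x0) ^+ 4 = (l ^+ 8 * m ^+ 4) * (e * x0 ^+ 4) by ring.
have -> : 2 * (l ^+ 2 * m * u) ^+ 4 = (l ^+ 8 * m ^+ 4) * (2 * u ^+ 4) by ring.
have -> : l ^+ 9 * m ^+ 4 = l * (l ^+ 8 * m ^+ 4) by ring.
move: (l ^+ 8 * m ^+ 4) (e * x0 ^+ 4) (2 * u ^+ 4) => q e' u'.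
rewrite !exprMn -[in l ^+ n](subnKC an) -[in q ^+ n](subnKC bn) !exprD.
by ring.
Qed.

(** By compactness, finitely many concentric discs of half the size of the charted
    squares cover S; one of the squares is centered at the given point, in the given
    chart. *)
Lemma finite_atlas zp Ap : H zp -> Ap \in unitmx -> finite_part Ap (f zp) ->
  exists (A : C -> 'M[C]_k.+1) (r : C -> R) (s : seq C), A zp = Ap /\
  [/\ forall i, i \in zp :: s -> [/\ H i, A i \in unitmx, 0 < r i &
        square i (r i) `<=` chart_domain f (A i)] &
      forall y, S y -> exists2 i, i \in zp :: s &
        exists2 w, cn (w - i) < r i / 2 & f w = y].
Proof.
move=> Hp uAp Apf.
have /choice[A AP] : forall z, exists A, (z = zp -> A = Ap) /\
    (A \in unitmx /\ finite_part A (f z)).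
  move=> z; have [->|zzp] := eqVneq z zp; first by exists Ap.
  have [A uA Af] := chart_exists (f z); exists A; split => // zE.
  by move: zzp; rewrite zE eqxx.
have /choice[r rP] : forall z, exists r : R,
    H z -> 0 < r /\ square z r `<=` chart_domain f (A z).
  move=> z; have [Hz|] := pselect (H z); last by exists 0.
  have [|r r0 rD] := @open_square R _ z (open_chart_domain (A := A z) hf).
    by split => //; case: (AP z) => _ [].
  by exists r.
have /choice[V VP] : forall z, exists V : set (CP R k), H z ->
    [/\ open V, V (f z) & forall y, V y -> S y ->
      exists2 w, cn (w - z) < r z / 2 & f w = y].
  move=> z; have [Hz|] := pselect (H z); last by exists setT.
  have [r0 _] := rP z Hz; case: hf => _ cov _.
  have [U [s [Uopen Uz UH _ opn]]] := covering_local cov Hz.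
  have [|N Nopen NP] := opn [set w : C | cn (w - z) < r z / 2].
    rewrite openE => w /= wz; apply/nbhsC; exists (r z / 2 - cn (w - z)).
      by rewrite subr_gt0.
    move=> t tw; have := cnD (t - w) (w - z); rewrite subrKA /= => h.
    by move: (le_lt_trans h (ltr_leD tw (lexx _))); rewrite subrK.
  exists N => _; split => //; last first.
    by move=> y Ny Sy; have [w [_ wz wy]] := (NP y).1 (conj Ny Sy); exists w.
  have [] := (NP (f z)).2 _; last by [].
  by exists z; split; rewrite //= subrr cn0 divr_gt0.
have fH : f @` H = S by case: hf => _ [].
have [z Hz|y|s sH sO] := @compact_subcover (CP R k) C S H V cS.
- by case: (VP z Hz).
- by rewrite -fH => -[z Hz <-]; exists z => //; case: (VP z Hz).
exists A, r, s; split; first by case: (AP zp) => h _; exact: h.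
split=> [i|y Sy].
  rewrite inE => /orP[/eqP ->|/sH Hi]; last first.
    by have [h1 h2] := rP i Hi; split => //; case: (AP i) => _ [].
  by have [h1 h2] := rP zp Hp; split => //; case: (AP zp) => _ [].
have [i si Vy] := sO y Sy; exists i; first by rewrite inE si orbT.
by case: (VP i (sH i si)) => _ _; apply.
Qed.

(** Vanishing to order m = K n at the nu centers of the atlas amounts to nu K n linear
    equations on the (n + 1)^2 coefficients of a polynomial in y and r, so that they
    have a solution for n > nu K. If |form| <= M on all half discs, then |form| <= B^n M
    on all squares, B being a bound for the factors of [form_change], and the Schwarz
    lemma gives |form| <= B^n M / 2^m <= M / 2 on the half discs if K is large, whence
    form = 0. *)
Theorem siegel zp Ap : H zp -> Ap \in unitmx -> finite_part Ap (f zp) ->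
  exists n (c : 'I_n.+1 * 'I_n.+1 -> C), (exists p, c p != 0) /\
    \forall z \near zp, form c Ap z = 0.
Proof.
move=> Hp uAp Apf.
have [A [r [s [Ap_ [sP cover]]]]] := finite_atlas Hp uAp Apf.
pose s' := zp :: s.
have ImB i : i \in s' -> 0 < complex.Im i - r i.
  move=> /sP[Hi _ r0 Q].
  have [|+ _ //] := Q (Complex (complex.Re i) (complex.Im i - r i) : C).
  apply/squareP; rewrite Re_B Im_B /= subrr normr0.
  have -> : complex.Im i - r i - complex.Im i = - r i by ring.
  by rewrite normrN (ger0_norm (ltW r0)) ltW.
have [B B1 BP] : exists2 B : R, 1 <= B & forall ij, ij \in [seq (i, j) | i <- s', j <- s'] ->
    forall z w (m : C), square ij.1 (r ij.1) z -> cn (w - ij.2) < r ij.2 / 2 ->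
    cn m = complex.Im w / complex.Im z ->
    cn (ratio (A ij.1) (col ord0 (A ij.2)) (f z) ^+ 9 * m ^+ 4) <= B.
  apply: seq_bound.
    move=> ij b b' bb h z w m Qz ww mE; exact: le_trans (h z w m Qz ww mE) bb.
  move=> _ /allpairsP[[i' j'] /= [si sj ->]].
  have [Hi uAi ri Qi] := sP _ si; have [Hj uAj rj Qj] := sP _ sj.
  have [L L0 LP] := compact_bound (@rect_compact R _ _ _ _) (fun z Qz =>
    derivable_continuous (ratio_holo (v := col ord0 (A j')) hf uAi (Qi z Qz))).
  exists (L ^+ 9 * ((complex.Im j' + r j') / (complex.Im i' - r i')) ^+ 4).
  move=> z w m Qz ww mE; rewrite cnM !cnX ler_pM ?exprn_ge0 ?cn_ge0//.
    by rewrite lerXn2r ?nnegrE ?cn_ge0 ?(ltW L0)//; exact: LP Qz.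
  have zi : complex.Im i' - r i' <= complex.Im z by case: Qz => _ /andP[].
  have z0 := lt_le_trans (ImB _ si) zi.
  have wj : complex.Im w <= complex.Im j' + r j'.
    have := cn_Im (w - j'); rewrite Im_B => /le_lt_trans/(_ ww).
    by rewrite ltr_norml => /andP[_ h]; lra.
  have rj0 : 0 <= complex.Im j' + r j'.
    by rewrite addr_ge0// ltW//; exact: Hj.
  rewrite lerXn2r ?nnegrE ?cn_ge0 ?divr_ge0 ?(ltW (ImB _ si))// mE.
  rewrite ler_pdivrMr// mulrAC ler_pdivlMr ?ImB// ler_pM ?(ltW (ImB _ si))//.
  by have := cn_ge0 m; rewrite mE pmulr_lge0 ?invr_gt0.
have [K BK] : exists K : nat, 2 * B <= 2 ^+ K.
  exists (Num.trunc (2 * B)).+1; apply: ltW; apply: (lt_trans (truncnS_gt _)).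
  by rewrite -natrX ltr_nat ltn_expl.
pose nu := size s'; pose n := (nu * K).+1; pose m := (K * n)%N.
have dom i : i \in s' -> chart_domain f (A i) i.
  by move=> /sP[_ _ r0 Q]; apply: Q; exact: square_shift.
have /choice[at_ atP] : forall ip : C * ('I_n.+1 * 'I_n.+1), exists at_ : (nat -> C) * (C -> C),
    ip.1 \in s' -> holo (chart_domain f (A ip.1)) at_.2 /\
    forall z, chart_domain f (A ip.1) z -> mono (A ip.1) ip.2 z =
      \sum_(k0 < m) at_.1 k0 * (z - ip.1) ^+ k0 + (z - ip.1) ^+ m * at_.2 z.
  move=> [i p]; have [si|] := boolP (i \in s'); last by exists (fun=> 0, id).
  have [_ uAi _ _] := sP _ si.
  have oD := open_chart_domain (A := A i) hf.
  have [|||||a [t [ht tE]]] := @taylor R _ (mono (A i) p) (fun z => z - i) i m oD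
    (mono_holo (p := p) uAi).
  - by move=> z _; exact: cder_derivable (cder_shift i z).
  - exact: dom.
  - exact: subrr.
  - by move=> z _ /eqP; rewrite subr_eq0 => /eqP.
  - by rewrite -derE (cder_der (cder_shift i i)) oner_neq0.
  by exists (a, t).
have [|c c0 cE] := @linear_system _ ('I_n.+1 * 'I_n.+1)%type ('I_nu * 'I_m)%type
    (fun p ik => (at_ (nth zp s' ik.1, p)).1 ik.2).
  rewrite !card_prod !card_ord /m mulnA.
  by rewrite (@leq_ltn_trans (n * n))// ?ltn_mul// leq_mul2r /n leqnSn orbT.
exists n, c; split => //.
pose Phi i := form c (A i).
have van i : i \in s' -> exists2 t, holo (chart_domain f (A i)) t &
    forall z, chart_domain f (A i) z -> Phi i z = (z - i) ^+ m * t z.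
  move=> si; exists (fun z => \sum_p c p * (at_ (i, p)).2 z).
    move=> z Dz; apply: cder_derivable.
    apply: (@cder_sum R _ (index_enum _) (fun p z => c p * (at_ (i, p)).2 z)) => p.
    have [ht _] := atP (i, p) si.
    exact: cderM (cder_cst _ _) (holo_cder ht Dz).
  move=> z Dz; rewrite /Phi /form.
  under eq_bigr => p _ do rewrite (atP (i, p) si).2//= mulrDr.
  rewrite big_split /= mulr_sumr [V in V + _](_ : _ = 0) ?add0r; last first.
    under eq_bigr do rewrite mulr_sumr.
    rewrite exchange_big /= big1// => k0 _.
    under eq_bigr do rewrite mulrA.
    rewrite -mulr_suml.
    have ii : (index i s' < nu)%N by rewrite index_mem.
    by have := cE (Ordinal ii, k0); rewrite /= nth_index// => ->; rewrite mul0r.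
  by apply: eq_bigr => p _; rewrite mulrCA.
have holP i : i \in s' -> holo (square i (r i)) (Phi i).
  move=> si z Qz; have [_ uAi _ Q] := sP _ si.
  exact: (form_holo (c := c) uAi (Q z Qz)).
have contract M : (forall i, i \in s' -> forall z, cn (z - i) <= r i / 2 -> cn (Phi i z) <= M) ->
    forall i, i \in s' -> forall z, cn (z - i) <= r i / 2 -> cn (Phi i z) <= M / 2.
  move=> hM i si z zi; have [Hi uAi ri Qi] := sP _ si.
  have M0 : 0 <= M.
    apply: le_trans (cn_ge0 _) (hM i si i _).
    by rewrite subrr cn0 divr_ge0// ltW.
  have [t ht tE] := van i si.
  have big x : square i (r i) x -> cn (Phi i x) <= B ^+ n * M.
    move=> Qx; have Dx := Qi _ Qx; have Hx : H x by case: Dx.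
    have [|j sj [w wj wx]] := cover (f x).
      by case: hf => _ [_ <- _] _; exists x.
    have [Hj uAj rj Qj] := sP _ sj.
    have Dw : chart_domain f (A j) w.
      apply: Qj; apply: ball_square; rewrite (le_trans (ltW wj))//.
      by rewrite ler_pdivrMr// ler_pMr// ler1n.
    have [m' mE FE] := form_change c uAi uAj Dx Dw (esym wx).
    rewrite /Phi FE cnM cnX ler_pM ?exprn_ge0 ?cn_ge0//; last first.
      exact: hM sj _ (ltW wj).
    rewrite lerXn2r ?nnegrE ?cn_ge0 ?(le_trans ler01)//.
    apply: (BP (i, j) _ x w) => //.
    by apply/allpairsP; exists (i, j).
  apply: (le_trans (schwarz ri Qi ht tE big zi)).
  have B0 : 0 <= B / 2 ^+ K.
    by apply: divr_ge0; [exact: le_trans ler01 B1|exact: exprn_ge0].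
  have BK2 : B / 2 ^+ K <= 2^-1.
    by rewrite ler_pdivrMr ?exprn_gt0// ler_pdivlMl.
  have BKn : (B / 2 ^+ K) ^+ n <= 2^-1.
    have pw : (B / 2 ^+ K) ^+ (nu * K) <= 1.
      by rewrite exprn_ile1// (le_trans BK2)// invf_le1// ler1n.
    by rewrite /n exprS -[leRHS]mulr1 ler_pM ?exprn_ge0.
  have -> : B ^+ n * M / 2 ^+ m = M * (B / 2 ^+ K) ^+ n.
    by rewrite /m exprM expr_div_n; ring.
  exact: ler_wpM2l.
have [M0 _ M0P] : exists2 M : R, 1 <= M &
    forall i, i \in s' -> forall z, cn (z - i) <= r i / 2 -> cn (Phi i z) <= M.
  apply: seq_bound => [i b b' bb h z zi|i si].
    by apply: le_trans bb; exact: h.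
  have [M M0 MP] := compact_bound (@rect_compact R _ _ _ _)
    (fun z Qz => derivable_continuous (holP i si z Qz)).
  exists M => z zi; apply: MP; apply: ball_square; rewrite (le_trans zi)//.
  have [_ _ ri _] := sP _ si.
  by rewrite ler_pdivrMr// ler_pMr// ler1n.
have all N : forall i, i \in s' -> forall z, cn (z - i) <= r i / 2 ->
    cn (Phi i z) <= M0 / 2 ^+ N.
  elim: N => [|N IH]; first by rewrite expr0 divr1.
  by have := contract _ IH; rewrite exprSr invfM mulrA.
have sp : zp \in s' by rewrite inE eqxx.
have [_ _ rp _] := sP _ sp.
apply/nbhsC; exists (r zp / 2); first by rewrite divr_gt0.
move=> z /ltW zr; rewrite -Ap_; apply/eqP; apply: contraT; rewrite -cn_gt0 => P0.
have : (2 : R) <= 1.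
  apply: (@geometric_le R _ _ (cn (form c (A zp) z)) M0) => // N.
  by rewrite expr1n mulr1 -ler_pdivlMr ?exprn_gt0// all.
by rewrite leNgt ltr1n.
Qed.

End Siegel.

(** * Desingularization of an algebraic relation *)

Section BivariatePolynomials.
Variable R : realType.
Local Notation C := (cplx R).
Implicit Types (P Q : {poly {poly C}}) (p q : {poly C}) (y s : C -> C) (u v z w : C).

(** The polynomial in two variables P is evaluated at u in its coefficients and at v
    in its main variable. *)
Definition ev P u v : C := (map_poly (horner_eval u) P).[v].

Lemma ev0 u v : ev 0 u v = 0.
Proof. by rewrite /ev rmorph0 horner0. Qed.

Lemma evMXaddC P c u v : ev (P * 'X + c%:P) u v = ev P u v * v + c.[u].
Proof.
rewrite /ev rmorphD rmorphM /= map_polyX map_polyC /= hornerMXaddC.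
by rewrite /horner_eval.
Qed.

Lemma ev_horner P (T : {poly C}) u : ev P u T.[u] = (P.[T]).[u].
Proof. exact: (horner_map (horner_eval u) P T). Qed.

Lemma ev_taylor P (T : {poly C}) u h :
  ev P u (T.[u] + h) = \sum_(j < size P) (P^`N(j).[T]).[u] * h ^+ j.
Proof.
rewrite /ev nderiv_taylor; last exact: mulrC.
have sz : (size (map_poly (horner_eval u) P) <= size P)%N by exact: size_poly.
rewrite (big_ord_widen _ (fun j => (map_poly (horner_eval u) P)^`N(j).[T.[u]] * h ^+ j) sz).
rewrite big_mkcond /=; apply: eq_bigr => j _.
rewrite -ev_horner /ev nderivn_map; case: ltnP => // szj.
by rewrite -nderivn_map nderivn_poly0 ?horner0 ?mul0r.
Qed.

Lemma cder_horner p y z d : cder y z d ->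
  cder (fun t => p.[y t]) z ((deriv p).[y z] * d).
Proof.
move=> dy; elim/poly_ind: p => [|p c IH].
  under eq_fun do rewrite horner0.
  by rewrite deriv0 horner0 mul0r; exact: cder_cst.
under eq_fun do rewrite hornerMXaddC.
apply: cder_eq (cderD (cderM IH dy) (cder_cst c z)) _.
by rewrite derivMXaddC hornerD hornerMX; ring.
Qed.

Lemma cder_ev P y s z d e : cder y z d -> cder s z e ->
  cder (fun t => ev P (y t) (s t)) z
    (ev (map_poly (@deriv C) P) (y z) (s z) * d + ev (deriv P) (y z) (s z) * e).
Proof.
move=> dy ds; elim/poly_ind: P => [|P c IH].
  under eq_fun do rewrite ev0.
  rewrite raddf0 deriv0 !ev0 !mul0r addr0; exact: cder_cst.
under eq_fun do rewrite evMXaddC.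
apply: cder_eq (cderD (cderM IH ds) (cder_horner c dy)) _.
have -> : map_poly (@deriv C) (P * 'X + c%:P) = map_poly (@deriv C) P * 'X + (deriv c)%:P.
  by apply/polyP => i; rewrite !(coef_map, coefD, coefMX, coefC) /=;
    case: i => [|i] /=; rewrite ?derivD ?deriv0 ?add0r ?addr0.
rewrite evMXaddC derivMXaddC.
have -> : ev (P + (deriv P) * 'X) (y z) (s z) =
    ev P (y z) (s z) + ev (deriv P) (y z) (s z) * s z.
  by rewrite /ev rmorphD rmorphM /= map_polyX hornerD hornerMX.
by ring.
Qed.

End BivariatePolynomials.

Section LocalUniformization.
Variable R : realType.
Local Notation C := (cplx R).
Implicit Types (P Q : {poly {poly C}}) (p q : {poly C}) (z : C).

Lemma near_punctured (f g : C -> C) w : {for w, continuous f} -> {for w, continuous g} ->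
  (\forall z \near w, z != w -> f z = g z) -> f w = g w.
Proof.
move=> cf cg fg; apply/eqP; rewrite -subr_eq0 -cn_eq0; apply/eqP/le_anti.
rewrite cn_ge0 andbT; apply/ler_addgt0Pr => e e0; rewrite add0r.
have e20 : 0 < e / 2 by rewrite divr_gt0.
have /cvgC/(_ _ e20)[r1 r10 H1] := cf; have /cvgC/(_ _ e20)[r2 r20 H2] := cg.
have /nbhsC[r3 r30 H3] := fg.
pose m := Num.min (Num.min r1 r2) r3 / 2.
have m0 : 0 < m by rewrite divr_gt0// !lt_min r10 r20.
have [m1 m2 m3] : [/\ m < r1, m < r2 & m < r3].
  have h : m < Num.min (Num.min r1 r2) r3.
    by rewrite ltr_pdivrMr// ltr_pMr ?ltr1n// !lt_min r10 r20.
  by move: h; rewrite !lt_min => /andP[/andP[]].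
pose z := w + m%:C%C; have zE : cn (z - w) = m.
  by rewrite /z addrC addKr cn_real gtr0_norm.
have zw : z != w by rewrite -subr_eq0 -cn_gt0 zE.
have h1 : cn (f z - f w) < e / 2 by apply: H1; rewrite zE.
have h2 : cn (g z - g w) < e / 2 by apply: H2; rewrite zE.
have h3 : f z = g z by apply: H3 => //; rewrite zE.
have -> : f w - g w = (f z - g w) - (f z - f w) by ring.
rewrite (le_trans (cnD _ _))// cnN [leRHS]splitr lerD//; last exact: ltW.
by rewrite h3 ltW.
Qed.

Section Coordinate.
Variables (D : set C) (w : C) (y : C -> C).
Hypotheses (oD : open D) (Dw : D w) (hy : holo D y).
Let a := y w.
Hypotheses (ya : forall z, D z -> y z = a -> z = w) (dy : 'D_1 y w != 0).
Let b z := y z - a.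

Let hb : holo D b.
Proof.
move=> z Dz; exact: cder_derivable (cderB (derivable_cder (hy Dz)) (cder_cst a z)).
Qed.

Let bw : b w = 0. Proof. exact: subrr. Qed.

Let b0 z : D z -> b z = 0 -> z = w.
Proof. by move=> Dz /eqP; rewrite subr_eq0 => /eqP; exact: ya. Qed.

Let db : 'D_1 b w != 0.
Proof.
rewrite -derE (cder_der (cderB (derivable_cder (hy Dw)) (cder_cst a w))).
by rewrite subr0.
Qed.

Let nD : nbhs w D. Proof. exact: open_nbhs_nbhs. Qed.

Let cy : {for w, continuous y}. Proof. exact: derivable_continuous (hy Dw). Qed.
Let cb : {for w, continuous b}. Proof. exact: derivable_continuous (hb Dw). Qed.

Lemma horner_continuous p : {for w, continuous (fun z => p.[y z])}.
Proof. exact: cder_continuous (cder_horner p (derivable_cder (hy Dw))). Qed.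

Lemma order_coord f : holo D f -> ~ (\forall z \near w, f z = 0) ->
  exists e h, [/\ holo D h, h w != 0 & forall z, D z -> f z = b z ^+ e * h z].
Proof.
move=> hf f0; have [e [h [hh hw fE]]] := holo_order oD hf Dw f0.
have hu := divdiff_holo oD hb Dw.
have u0 z : D z -> divdiff b w z != 0.
  move=> Dz; have [->|zw] := eqVneq z w; first by rewrite divdiff_id.
  rewrite divdiff_ne// bw subr0 mulf_neq0 ?invr_eq0 ?subr_eq0//.
  by apply: contraNneq zw => /(ya Dz) ->.
exists e, (fun z => h z / divdiff b w z ^+ e); split.
- move=> z Dz; apply: cder_derivable (cder_div _ (derivable_cder (hh _ Dz))
    (cderX e (derivable_cder (hu _ Dz)))).
  by rewrite expf_neq0// u0.
- by rewrite mulf_neq0// invr_eq0 expf_neq0// u0.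
move=> z Dz; rewrite fE//.
have bE : b z = (z - w) * divdiff b w z by have := divdiffE b w z; rewrite bw add0r.
by rewrite bE exprMn -mulrA [_ * (h z / _)]mulrC divfK// expf_neq0// u0.
Qed.

(** The order of vanishing of q(y) at w is the multiplicity of the root a of q, y - a
    being a local coordinate. *)
Lemma divide_power q m (k : C -> C) : {for w, continuous k} ->
  (\forall z \near w, q.[y z] = b z ^+ m * k z) ->
  exists2 q', q = q' * ('X - a%:P) ^+ m & q'.[a] = k w.
Proof.
move=> ck qE.
have bne : \forall z \near w, z != w -> b z != 0.
  by apply: filterS nD => z Dz; apply: contraNneq => /(b0 Dz) ->.
have [q' q'E] : exists q', q = q' * ('X - a%:P) ^+ m.
  have [->|q0] := eqVneq q 0; first by exists 0; rewrite mul0r.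
  have [l [c ca cE]] := multiplicity_XsubC q a.
  have [ml|lm] := leqP m l.
    by exists (c * ('X - a%:P) ^+ (l - m)); rewrite cE -mulrA -exprD subnK.
  have ra : ~~ root c a by move: ca; rewrite q0.
  exfalso; move/negP: ra; apply.
  rewrite rootE; apply/eqP.
  have -> : 0 = b w ^+ (m - l) * k w.
    by rewrite bw expr0n subn_eq0 leqNgt lm mul0r.
  apply: (@near_punctured (fun z => c.[y z]) (fun z => b z ^+ (m - l) * k z)).
  - exact: horner_continuous.
  - have c1 := cder_continuous (cderX (m - l) (derivable_cder (hb Dw))).
    exact: (cvgM c1 ck).
  near=> z => zw; have bz : b z != 0 by move: zw; near: z.
  apply: (mulfI (expf_neq0 l bz)); rewrite mulrA -exprD subnKC ?(ltnW lm)//.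
  have <- : q.[y z] = b z ^+ m * k z by near: z.
  by rewrite cE hornerM horner_exp hornerXsubC mulrC.
exists q' => //.
apply: (@near_punctured (fun z => q'.[y z]) k); [exact: horner_continuous|exact: ck|].
near=> z => zw; have bz : b z != 0 by move: zw; near: z.
apply: (mulfI (expf_neq0 m bz)).
have <- : q.[y z] = b z ^+ m * k z by near: z.
by rewrite q'E hornerM horner_exp hornerXsubC mulrC.
Unshelve. all: by end_near. Qed.

(** Differentiating P in its main variable, as long as the result is still a relation,
    ends before a polynomial in y alone is reached: as a relation, it would be divisible
    by all powers of X - a. *)
Lemma separable_relation P r : P != 0 -> (\forall z \near w, ev P (y z) (r z) = 0) ->
  exists2 P, (\forall z \near w, ev P (y z) (r z) = 0) &
    ~ (\forall z \near w, ev (deriv P) (y z) (r z) = 0).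
Proof.
have [n] := ubnP (size P); elim: n P => // n IH P szP P0 Pr.
have [P'r|P'r] := pselect (\forall z \near w, ev (deriv P) (y z) (r z) = 0); last first.
  by exists P.
have [P'0|P'0] := eqVneq (deriv P) 0; last first.
  apply: (IH (deriv P)) => //; apply: leq_trans (lt_size_deriv P0) _; by [].
exfalso; have [c c0 cE] : exists2 c : {poly C}, c != 0 & P = c%:P.
  have PE : P = (P`_0)%:P.
    apply/polyP => -[|i]; rewrite coefC//=; apply/eqP.
    have /polyP/(_ i) := P'0; rewrite coef_deriv coef0 => /eqP.
    rewrite -mulr_natr mulf_eq0 => /orP[//|].
    rewrite -[i.+1%:R]/(i.+1%:R : {poly C}) -polyC_natr polyC_eq0.
    by rewrite pnatr_eq0.
  by exists P`_0 => //; apply: contraNneq P0 => c0; rewrite PE c0.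
have ck : {for w, continuous (fun=> 0 : C)} by exact: cst_continuous.
have all m : ('X - a%:P) ^+ m %| c.
  have [|q' -> _] := @divide_power c m _ ck; last exact: dvdp_mulIr.
  apply: filterS Pr => z; rewrite mulr0 => <-.
  by rewrite cE /ev map_polyC /= hornerC.
have := dvdp_leq c0 (all (size c)); rewrite size_exp_XsubC.
by rewrite ltnn.
Qed.

(** Let P_r(y,r) vanish to order e at w, and let T be the Taylor polynomial of r in
    y - a of degree less than M = e + 1. In the expansion of P(y, T(y) + (y - a)^M s) in
    powers of s, the linear coefficient vanishes to order M + e exactly, the following
    ones to a higher order, and the constant one to order M + e at least because the
    whole is zero. Dividing by (y - a)^(M + e) leaves a relation Q(y,s) = 0 of which s
    is a simple root at w. *)
Theorem newton r P : holo D r -> (\forall z \near w, ev P (y z) (r z) = 0) ->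
  ~ (\forall z \near w, ev (deriv P) (y z) (r z) = 0) ->
  exists (T : {poly C}) (M : nat) (Q : {poly {poly C}}) (s : C -> C),
  [/\ holo D s, (forall z, D z -> r z = T.[y z] + (y z - a) ^+ M * s z),
      (\forall z \near w, ev Q (y z) (s z) = 0) & ev (deriv Q) a (s w) != 0].
Proof.
move=> hr Pr P'r.
have evh P' : holo D (fun z => ev P' (y z) (r z)).
  by move=> z Dz; apply: cder_derivable (cder_ev P' (derivable_cder (hy Dz))
    (derivable_cder (hr _ Dz))).
have [e [u [hu uw uE]]] := order_coord (evh (deriv P)) P'r.
have [al [s [hs rE]]] := taylor e.+1 oD hr hb Dw bw b0 db.
pose M := e.+1; pose T : {poly C} := \sum_(k < M) al k *: ('X - a%:P) ^+ k.
have {}rE z : D z -> r z = T.[y z] + b z ^+ M * s z.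
  move=> Dz; rewrite rE//; congr (_ + _); rewrite horner_sum.
  by apply: eq_bigr => k _; rewrite hornerZ horner_exp hornerXsubC.
have cs : {for w, continuous s} := derivable_continuous (hs _ Dw).
pose q j : {poly C} := (P^`N(j)).[T].
have cterm (F : nat -> {poly C}) (g : nat -> nat) (N : nat) :
    {for w, continuous (fun z => \sum_(j < N) (F j).[y z] * (b z ^+ g j * s z ^+ j))}.
  have h := @cder_sum R _ (index_enum 'I_N)
    (fun j z => (F j).[y z] * (b z ^+ g j * s z ^+ j)) w _
    (fun j : 'I_N => cderM (cder_horner (F j) (derivable_cder (hy Dw)))
      (cderM (cderX (g j) (derivable_cder (hb Dw))) (cderX j (derivable_cder (hs _ Dw))))).
  exact: cder_continuous h.
have szP : exists N, size P = N.+2.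
  case szP: (size P) => [|[|N]]; last by exists N.
    have P0 : P = 0 by apply/eqP; rewrite -size_poly_eq0 szP.
    by exfalso; apply: P'r; near=> z; rewrite P0 deriv0 ev0.
  exfalso; apply: P'r; near=> z.
  have /eqP/size_poly1P[c _ ->] := szP.
  by rewrite derivC ev0.
have [N szPN] := szP.
(* The linear coefficient is P_r(y, T(y)), which differs from P_r(y, r) by a multiple
   of (y - a)^M. *)
pose R1 z := \sum_(j < size (deriv P)) (if j == 0%N :> nat then 0 else
   ((deriv P)^`N(j)).[T]).[y z] * (b z ^+ (M * j - M) * s z ^+ j).
have q1E z : D z -> (q 1%N).[y z] = b z ^+ e * (u z - b z * R1 z).
  move=> Dz; rewrite /q nderivn1.
  have := uE z Dz; rewrite rE// ev_taylor.
  have sz1 : (0 < size (deriv P))%N.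
    rewrite lt0n size_poly_eq0; apply/eqP => h; apply: P'r.
    by near=> t; rewrite h ev0.
  rewrite (bigD1 (Ordinal sz1))//= nderivn0 expr0 mulr1 => h.
  have -> : (deriv P).[T].[y z] = b z ^+ e * u z -
      \sum_(i < size (deriv P) | i != Ordinal sz1)
        (deriv P)^`N(i).[T].[y z] * (b z ^+ M * s z) ^+ i by rewrite -h addrK.
  rewrite mulrBr; congr (_ - _); rewrite mulrA -exprSr /R1 mulr_sumr [RHS](bigD1 (Ordinal sz1))//=.
  rewrite horner0 mul0r mulr0 add0r; apply: eq_bigr => j j0.
  have jn0 : (j : nat) != 0%N by apply: contraNneq j0 => j0; apply/eqP/val_inj.
  rewrite (negbTE jn0) exprMn -exprM [RHS]mulrCA; congr (_ * _).
  rewrite [RHS]mulrA -exprD subnKC//.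
  by rewrite -[X in (X <= _)%N]muln1 leq_mul2l lt0n jn0 orbT.
have [q1' q1'E q1'a] : exists2 q', q 1%N = q' * ('X - a%:P) ^+ e & q'.[a] = u w - b w * R1 w.
  apply: (@divide_power _ _ (fun z => u z - b z * R1 z)).
    have c1 := derivable_continuous (hu _ Dw).
    have c2 : {for w, continuous R1}.
      exact: (cterm (fun j => if j == 0%N then 0 else ((deriv P)^`N(j)).[T])
        (fun j => (M * j - M)%N)).
    exact: (cvgB c1 (cvgM cb c2)).
  by apply: filterS nD => z /q1E.
have q1'0 : q1'.[a] != 0 by rewrite q1'a bw mul0r subr0.
(* F j and g j are the coefficient and the power of y - a of the term of degree j
   in s, once divided by (y - a)^(M + e). *)
pose F j := if j == 0%N then 0 else if j == 1%N then q1' else q j.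
pose g j := if j == 1%N then 0%N else (M * j - (M + e))%N.
have q0E z : D z -> ev P (y z) (r z) = 0 -> (q 0%N).[y z] =
    b z ^+ (M + e) * - (\sum_(j < size P) (F j).[y z] * (b z ^+ g j * s z ^+ j)).
  move=> Dz; rewrite rE// ev_taylor szPN big_ord_recl expr0 mulr1 => /eqP.
  rewrite addr_eq0 => /eqP ->; rewrite mulrN; congr (- _).
  rewrite [in RHS]big_ord_recl /F /= horner0 mul0r add0r mulr_sumr.
  apply: eq_bigr => j _; rewrite exprMn /bump /= add1n.
  case: j => -[|j] /= _.
    rewrite -/(q 1%N) q1'E hornerM horner_exp hornerXsubC /g /= expr0 !expr1 exprD.
    by ring.
  rewrite /g /= [RHS]mulrCA; congr (_ * _); rewrite -exprM [RHS]mulrA -exprD subnKC//.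
  by rewrite /M; lia.
have [q0' q0'E q0'a] : exists2 q', q 0%N = q' * ('X - a%:P) ^+ (M + e) & q'.[a] =
    - (\sum_(j < size P) (F j).[y w] * (b w ^+ g j * s w ^+ j)).
  apply: (@divide_power _ _
    (fun z => - (\sum_(j < size P) (F j).[y z] * (b z ^+ g j * s z ^+ j)))).
    exact: (cvgN (cterm F g (size P))).
  by near=> z; apply: q0E; near: z.
pose c j : {poly C} := if j == 0%N then q0' else
  if j == 1%N then q1' else q j * ('X - a%:P) ^+ (M * j - (M + e)).
pose Q : {poly {poly C}} := \poly_(j < size P) c j.
have QE u0 v : ev Q u0 v = \sum_(j < size P) (c j).[u0] * v ^+ j.
  rewrite /ev /Q poly_def rmorph_sum horner_sum; apply: eq_bigr => j _.
  by rewrite -mul_polyC rmorphM /= map_polyC map_polyXn hornerCM hornerXn.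
exists T, M, Q, s; split => //.
- near=> z; have Dz : D z by near: z.
  have -> : ev Q (y z) (s z) = q0'.[y z] +
      \sum_(j < size P) (F j).[y z] * (b z ^+ g j * s z ^+ j).
    rewrite QE szPN !big_ord_recl /F /c /g /= expr0 !expr1 mulr1 horner0 mul0r add0r mul1r.
    congr (_ + (_ + _)); first exact: mulr1.
    apply: eq_bigr => j _.
    by rewrite hornerM horner_exp hornerXsubC -mulrA.
  have [->|zw] := eqVneq z w; first by rewrite -/a q0'a addNr.
  have bz : b z != 0 by apply: contraNneq zw => /(b0 Dz) ->.
  apply: (mulfI (expf_neq0 (M + e) bz)).
  have Pz : ev P (y z) (r z) = 0 by near: z.
  have := q0E z Dz Pz; rewrite q0'E hornerM horner_exp hornerXsubC => h.
  by rewrite mulrDr [_ * q0'.[_]]mulrC h -mulrDr addNr.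
- have -> : ev (deriv Q) a (s w) = q1'.[a]; last exact: q1'0.
  rewrite /ev -deriv_map.
  have -> : map_poly (horner_eval a) Q = q0'.[a]%:P + q1'.[a] *: 'X.
    apply/polyP => j; rewrite coef_map coef_poly szPN coefD coefC coefZ coefX /=.
    rewrite /horner_eval /c; case: j => [|[|j]] /=; first by rewrite mulr0 addr0.
      by rewrite mulr1 add0r.
    rewrite mulr0 addr0; case: ifP => _; last by rewrite horner0.
    rewrite hornerM horner_exp hornerXsubC subrr expr0n.
    have -> : (M * j.+2 - (M + e) == 0)%N = false by rewrite /M; lia.
    by rewrite mulr0.
  by rewrite derivD derivC add0r derivZ derivX alg_polyC hornerC.
Unshelve. all: by end_near. Qed.

End Coordinate.
End LocalUniformization.

(** * Chains of functions of one variable *)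

Section NoetherianChains.
Variable R : realType.
Local Notation C := (cplx R).
Variables (D : set C) (l : nat) (phi : 'I_l -> C -> C).

Definition chain_row (x : 'rV[C]_1) : 'rV[C]_l := \row_i phi i (x 0 0).

Definition polynomial_in (g : C -> C) :=
  exists P : mpoly.mpoly (1 + l) C, forall x : 'rV[C]_1, D (x 0 0) ->
    g (x 0 0) = eval_at chain_row P x.

Lemma polynomial_cst (c : C) : polynomial_in (fun=> c).
Proof. by exists (mpoly.mpolyC _ c) => x _; rewrite /eval_at mpoly.mevalC. Qed.

Lemma polynomial_chain i : polynomial_in (phi i).
Proof.
exists (mpoly.mpolyX _ (mpoly.mnm1 (rshift 1 i))) => x _.
by rewrite /eval_at mpoly.mevalXU row_mxEr mxE.
Qed.

Lemma polynomialD g h : polynomial_in g -> polynomial_in h ->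
  polynomial_in (fun z => g z + h z).
Proof.
move=> [P PE] [Q QE]; exists (P + Q) => x Dx.
by rewrite /eval_at mpoly.mevalD PE// QE.
Qed.

Lemma polynomialM g h : polynomial_in g -> polynomial_in h ->
  polynomial_in (fun z => g z * h z).
Proof.
move=> [P PE] [Q QE]; exists (P * Q) => x Dx.
by rewrite /eval_at mpoly.mevalM PE// QE.
Qed.

Lemma polynomialN g : polynomial_in g -> polynomial_in (fun z => - g z).
Proof.
move=> hg; have := polynomialM (polynomial_cst (-1)) hg.
by under eq_fun do rewrite mulN1r.
Qed.

Lemma polynomialX g n : polynomial_in g -> polynomial_in (fun z => g z ^+ n).
Proof.
move=> hg; elim: n => [|n IH].
  by under eq_fun do rewrite expr0; exact: polynomial_cst.
by under eq_fun do rewrite exprS; exact: polynomialM.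
Qed.

Lemma polynomial_horner (p : {poly C}) g : polynomial_in g ->
  polynomial_in (fun z => p.[g z]).
Proof.
move=> hg; elim/poly_ind: p => [|p c IH].
  by under eq_fun do rewrite horner0; exact: polynomial_cst.
under eq_fun do rewrite hornerMXaddC.
by apply: polynomialD (polynomial_cst c); exact: polynomialM.
Qed.

Lemma polynomial_ev (P : {poly {poly C}}) g h : polynomial_in g -> polynomial_in h ->
  polynomial_in (fun z => ev P (g z) (h z)).
Proof.
move=> hg hh; elim/poly_ind: P => [|p c IH].
  by under eq_fun do rewrite ev0; exact: polynomial_cst.
under eq_fun do rewrite evMXaddC.
by apply: polynomialD (polynomial_horner c hg); exact: polynomialM.
Qed.

Lemma polynomial_eq g h : (forall z, D z -> g z = h z) -> polynomial_in g ->
  polynomial_in h.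
Proof. by move=> gh [P PE]; exists P => x Dx; rewrite -gh// PE. Qed.

Lemma chain_row_differentiable (x : 'rV[C]_1) : (forall i, derivable (phi i) (x 0 0) 1) ->
  differentiable chain_row x.
Proof.
move=> dphi.
pose psi (t : C) : 'rV[C]_l := \sum_i phi i t *: delta_mx 0 i.
have -> : chain_row = psi \o (fun y : 'rV[C]_1 => y 0 0).
  apply/funext => y /=; rewrite [LHS]row_sum_delta; apply: eq_bigr => i _.
  by rewrite mxE.
have d1 : differentiable (fun y : 'rV[C]_1 => y 0 0 : C) x.
  exact: (@differentiable_coord C 1 1 x 0 0).
have d2 : differentiable psi (x 0 0).
  have -> : psi = \sum_i (fun t : C => phi i t *: delta_mx 0 i : 'rV[C]_l).
    by apply/funext => t; rewrite fct_sumE.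
  apply: differentiable_sum => i; apply: differentiableZl.
  exact/derivable1_diffP/dphi.
exact: (@differentiable_comp C _ _ _ (fun y : 'rV[C]_1 => y 0 0 : C) psi x d1 d2).
Qed.

Lemma chain_row_derive (x : 'rV[C]_1) (j : 'I_1) i : (forall i, derivable (phi i) (x 0 0) 1) ->
  ('D_(delta_mx 0 j) chain_row x) 0 i = 'D_1 (phi i) (x 0 0).
Proof.
move=> dphi; have dr := chain_row_differentiable dphi.
have dv : derivable chain_row x (delta_mx 0 j) by exact: diff_derivable.
have c1 : (h^-1 *: (phi i (h *: 1 + x 0 0) - phi i (x 0 0))) @[h --> 0^'] -->
    ('D_(delta_mx 0 j) chain_row x) 0 i.
  have := cvg_comp _ _ dv (@coord_continuous C 1 l 0 i _).
  apply: cvg_trans; apply: near_eq_cvg; near=> h => /=.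
  by rewrite !mxE !ord1 eqxx.
exact: cvg_unique c1 (dphi i).
Unshelve. all: by end_near. Qed.

Lemma noetherian_of_chain (g : C -> C) :
  (forall i, exists2 d, polynomial_in d & forall z, D z -> cder (phi i) z (d z)) ->
  polynomial_in g -> noetherian_function1 D g.
Proof.
move=> hphi hg; have /choice[d dP] : forall i, exists d, polynomial_in d /\
    forall z, D z -> cder (phi i) z (d z).
  by move=> i; have [d d1 d2] := hphi i; exists d.
have /choice[P PE] : forall i, exists P : mpoly.mpoly (1 + l) C,
    forall x : 'rV[C]_1, D (x 0 0) -> d i (x 0 0) = eval_at chain_row P x.
  by move=> i; have [[P PE] _] := dP i; exists P.
have dphi x : D x -> forall i, derivable (phi i) x 1.
  by move=> Dx i; have [_ h] := dP i; exact: cder_derivable (h _ Dx).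
exists l, chain_row; split; last exact: hg.
split=> [x Dx|]; first by apply: chain_row_differentiable; exact: dphi.
exists (fun i _ => P i) => x Dx i j; rewrite chain_row_derive; last exact: dphi.
by rewrite -PE//; have [_ /(_ _ Dx)[_ <-]] := dP i.
Qed.

End NoetherianChains.

(** * The coordinate is unramified *)

Section Unramified.
Variable R : realType.
Local Notation C := (cplx R).
Implicit Types (f g y e s : C -> C) (D : set C) (z w t : C).

Definition disc w (r : R) : set C := [set z | cn (z - w) < r].

Lemma open_disc w r : open (disc w r).
Proof.
rewrite openE => z /= zw; apply/nbhsC; exists (r - cn (z - w)).
  by rewrite subr_gt0.
move=> x xz; have := cnD (x - z) (z - w); rewrite subrKA => h.
by move: (le_lt_trans h (ltr_leD xz (lexx _))); rewrite subrK.
Qed.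

Lemma disc_center w r : 0 < r -> disc w r w.
Proof. by move=> r0; rewrite /disc /= subrr cn0. Qed.

Lemma nbhs_disc w (U : set C) : nbhs w U -> exists2 r, 0 < r & disc w r `<=` U.
Proof. by move=> /nbhsC[r r0 rU]; exists r. Qed.

Lemma continuous_ne0 f w : {for w, continuous f} -> f w != 0 ->
  \forall z \near w, f z != 0.
Proof.
move=> cf f0; have c0 : 0 < cn (f w) by rewrite cn_gt0.
have /cvgC/(_ _ c0)[r r0 rP] := cf; apply/nbhsC; exists r => // z /rP.
by apply: contraTneq => ->; rewrite sub0r cnN ltxx.
Qed.

Lemma caratheodory f (k : C -> C) w : {for w, continuous k} ->
  (\forall z \near w, f z = f w + (z - w) * k z) -> cder f w (k w).
Proof.
move=> ck fk; apply/is_deriveC => e e0.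
have /cvgC/(_ e e0)[r1 r10 r1P] := ck; have /nbhsC[r2 r20 r2P] := fk.
exists (Num.min r1 r2); first by rewrite lt_min r10.
move=> z; rewrite lt_min => /andP[z1 z2]; rewrite r2P//.
have -> : f w + (z - w) * k z - f w - k w * (z - w) = (k z - k w) * (z - w) by ring.
by rewrite cnM ler_wpM2r ?cn_ge0// ltW// r1P.
Qed.

(** With q the divided difference of y at s(t), (s x - s t) q(s x) = e x - e t, and q(s x)
    tends to m. *)
Lemma section_cder y e s t d m : cder e t d -> cder y (s t) m -> m != 0 ->
  {for t, continuous s} -> (\forall x \near t, y (s x) = e x) -> cder s t (d / m).
Proof.
move=> de dy m0 cs yse.
have cq : {for t, continuous (fun x => divdiff y (s t) (s x))}.
  apply: continuous_comp; first exact: cs.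
  exact: divdiff_continuous (cder_derivable dy).
have q0 : divdiff y (s t) (s t) != 0.
  by rewrite divdiff_id -derE (cder_der dy).
have ce : {for t, continuous (divdiff e t)} := divdiff_continuous (cder_derivable de).
have -> : d / m = divdiff e t t / divdiff y (s t) (s t).
  by rewrite !divdiff_id -!derE (cder_der de) (cder_der dy).
apply: (@caratheodory s (fun x => divdiff e t x / divdiff y (s t) (s x))).
  exact: (cvgM ce (cvgV q0 cq)).
have nq := continuous_ne0 cq q0; have yst := nbhs_singleton yse.
near=> x; have qx : divdiff y (s t) (s x) != 0 by near: x.
have : (s x - s t) * divdiff y (s t) (s x) = (x - t) * divdiff e t x.
  apply: (addrI (y (s t))); rewrite -divdiffE yst -divdiffE.
  by near: x.
by move=> h; rewrite mulrA -h mulfK// subrKC.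
Unshelve. all: by end_near. Qed.

(** Suppose that y'(s t) = 0. Since e'(t) <> 0, y is not constant near s t, so that the
    zeros of y' are isolated there; as s x <> s t, s is differentiable at all x <> t
    near t by [section_cder]. So (x - t)(s x - s t) is holomorphic near t, and so is its
    divided difference s x - s t at t. The chain rule at t now contradicts
    e'(t) <> 0. *)
Lemma section_unramified D y e s t d : open D -> holo D y -> D (s t) ->
  (\forall x \near t, cder e x (der e x)) -> cder e t d -> d != 0 ->
  (\forall x \near t, {for x, continuous s}) ->
  (\forall x \near t, x != t -> s x != s t) ->
  (\forall x \near t, y (s x) = e x) -> der y (s t) != 0.
Proof.
move=> oD hy Dst he de d0 cs si yse; apply/eqP => y0.
have yst := nbhs_singleton yse; have cst := nbhs_singleton cs.
pose w := s t; pose a := y w.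
have hb : holo D (fun z => y z - a).
  move=> z Dz; exact: cder_derivable (cderB (derivable_cder (hy _ Dz)) (cder_cst a z)).
have [m [h [hh hw yE]]] : exists m h, [/\ holo D h, h w != 0 &
    forall z, D z -> y z - a = (z - w) ^+ m * h z].
  apply: holo_order oD hb Dst _ => ya.
  move/eqP: d0; apply; apply: cder_unique de _.
  apply: cder_near (cder_cst a t).
  have : nbhs t (s @^-1` [set z | y z - a = 0]) by exact: cst.
  by apply: filterS2 yse => x <- /= /eqP; rewrite subr_eq0 => /eqP.
have m0 : m != 0%N.
  apply/eqP => m0; have := yE w Dst; rewrite subrr m0 expr0 mul1r => /esym/eqP.
  by apply/negP.
have hder := der_holo oD hh.
have dyE z : D z -> der y z = (z - w) ^+ m.-1 * (m%:R * h z + (z - w) * der h z).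
  move=> Dz; have dh := holo_cder hh Dz.
  have := cderD (cder_cst a z) (cderM (cderX m (cder_shift w z)) dh).
  move=> h1; apply: cder_der; apply: cder_eq (cder_near _ h1) _.
    by apply: filterS (open_nbhs_nbhs (conj oD Dz)) => x Dx; rewrite -yE// subrKC.
  by rewrite -{3}(prednK (_ : 0 < m)%N) ?lt0n// exprSr; ring.
have dyne : \forall z \near w, z != w -> der y z != 0.
  have ck : {for w, continuous (fun z => m%:R * h z + (z - w) * der h z)}.
    exact: cder_continuous (cderD (cderM (cder_cst m%:R w) (holo_cder hh Dst))
      (cderM (cder_shift w w) (holo_cder hder Dst))).
  have k0 : m%:R * h w + (w - w) * der h w != 0.
    by rewrite subrr mul0r addr0 mulf_neq0// pnatr_eq0.
  have := continuous_ne0 ck k0.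
  apply: filterS2 (open_nbhs_nbhs (conj oD Dst)) => z Dz kz zw.
  by rewrite dyE// mulf_neq0// expf_neq0// subr_eq0.
have ds : \forall x \near t, x != t -> derivable s x 1.
  have n1 : nbhs t (s @^-1` [set z | z != w -> der y z != 0]) by exact: cst.
  have n2 : nbhs t (s @^-1` D) by exact: nbhs_preimage cst oD Dst.
  have n3 : \forall x \near t, \forall x' \near x, y (s x') = e x'.
    exact: nbhs_interior yse.
  near=> x => xt.
  have sx : s x != s t by move: xt; near: x.
  have dyx : der y (s x) != 0 by move: sx; near: x; exact: n1.
  have Dsx : D (s x) by near: x.
  have h1 : cder e x (der e x) by near: x.
  have h2 : {for x, continuous s} by near: x.
  have h3 : \forall x' \near x, y (s x') = e x' by near: x.
  exact: cder_derivable (section_cder h1 (holo_cder hy Dsx) dyx h2 h3).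
have [r r0 rP] := nbhs_disc (filterI cs ds).
pose k x := (x - t) * (s x - w).
have k_t : cder k t (s t - w).
  apply: (@caratheodory k (fun x => s x - w)).
    exact: (cvgB cst (cvg_cst _)).
  by near=> x; rewrite /k subrr mul0r add0r.
have hk : holo (disc t r) k.
  move=> x /rP[csx dsx]; have [->|xt] := eqVneq x t; first exact: cder_derivable k_t.
  exact: cder_derivable (cderM (cder_shift t x)
    (cderB (derivable_cder (dsx xt)) (cder_cst w x))).
have Dt := disc_center t r0.
have kE x : divdiff k t x = s x - w.
  have [->|xt] := eqVneq x t; first by rewrite divdiff_id -derE (cder_der k_t).
  by rewrite divdiff_ne// /k subrr mul0r subr0 mulrAC divff ?mul1r// subr_eq0.
have dst : derivable s t 1.
  have := cderD (derivable_cder (divdiff_holo (@open_disc t r) hk Dt Dt)) (cder_cst w t).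
  move=> /cder_near h1; apply: cder_derivable (h1 _ _).
  by near=> x; rewrite kE subrK.
have := cder_comp (holo_cder hy Dst) (derivable_cder dst).
rewrite y0 mul0r => /(cder_near yse) /(cder_unique de) dE.
by move: d0; rewrite dE eqxx.
Unshelve. all: by end_near. Qed.

End Unramified.

(** * Noetherian functions on the half plane *)

Lemma normalized_jet (R : realType) (D : set (cplx R)) (X Y : cplx R -> cplx R) :
  open D -> (forall z, D z -> X z = 1) -> forall z, D z ->
  wronskian_of X Y z = der Y z /\
  schwarzian_of X Y z = 2 * der Y z * der (der (der Y)) z - 3 * der (der Y) z ^+ 2.
Proof.
move=> Dopen x0.
have x1 : forall t, D t -> der X t = 0.
  by apply: (der_on Dopen x0) => t _; exact: cder_cst.
have x2 : forall t, D t -> der (der X) t = 0.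
  by apply: (der_on Dopen x1) => t _; exact: cder_cst.
have x3 : forall t, D t -> der (der (der X)) t = 0.
  by apply: (der_on Dopen x2) => t _; exact: cder_cst.
move=> z Dz; rewrite /wronskian_of /schwarzian_of (x0 z Dz) (x1 z Dz) (x2 z Dz) (x3 z Dz).
by rewrite /schwarzian /wronskian; split; ring.
Qed.

Section AffineCoordinate.
Variables (R : realType) (k : nat).
Local Notation C := (cplx R).
Local Notation H := (@upper_half_plane R).
Variables (S : set (CP R k)) (G : set 'M[R]_2) (f : C -> CP R k).
Hypotheses (hG : PSL2_subgroup G) (hf : uniformization G S f) (cS : compact S).
Variables (A : 'M[C]_k.+1) (j : 'I_k) (zp : C).
Hypotheses (uA : A \in unitmx) (Hp : H zp) (Ap : finite_part A (f zp)).

Local Notation Y := (affine_coord A j \o f).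
Local Notation v0 := (col ord0 A).
Local Notation v1 := (col (lift ord0 j) A).
Local Notation X0 := (ratio A v0 \o f).
Local Notation D := (chart_domain f A).

Lemma affine_ratio_comp : Y = ratio A v1 \o f.
Proof. by apply/funext => z; rewrite /= affine_ratio. Qed.

Lemma affine_holo : holo D Y.
Proof. by rewrite affine_ratio_comp; exact: (ratio_holo (v := v1) hf uA). Qed.

Let Dopen : open D. Proof. exact: (open_chart_domain hf). Qed.

(** A parametrization u of S lifts to a continuous map of the parameter disc to the
    half plane, injective as u is; its composite with y is the coordinate of u. *)
Lemma affine_unramified : ~ vanishes_at S (dform (affine_coord A j)) (f zp) ->
  der Y zp != 0.
Proof.
move=> nv; apply/eqP => y0; apply: nv => U u t [Uopen uS inj hu] Ut utE.
rewrite /dform derive1E -derE; apply: contrapT => /eqP e0.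
case: hf => _ cov _.
have [W [s [Wopen Wz WH sW opn]]] := covering_local cov Hp.
have [N0 N0open N0P] := opn D Dopen.
pose N := [set x | [/\ U x, finite_part A (u x) & N0 (u x)]].
have Nopen : open N.
  rewrite openE => x [Ux Ax Nx].
  have [cu _] := hu x Ux.
  have n1 := open_nbhs_nbhs (conj Uopen Ux).
  have n2 := nbhs_preimage cu (@open_finite_part R k A) Ax.
  have n3 := nbhs_preimage cu N0open Nx.
  by move: n1 n2 n3; apply: filterS3.
have Su x : U x -> S (u x) by move=> Ux; apply: uS; exists x.
have Nt : N t.
  split; rewrite ?utE//.
  have [] : N0 (f zp) /\ S (f zp); last by [].
  by apply/N0P; exists zp.
pose sx := s \o u.
have sxN x : N x -> [/\ W (sx x), D (sx x) & f (sx x) = u x].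
  move=> [Ux Ax Nx]; have [v [Wv Dv fv]] := (N0P (u x)).1 (conj Nx (Su _ Ux)).
  by rewrite /sx /= -fv sW.
have csx x : N x -> {for x, continuous sx}.
  move=> Nx; have [Wx Dx fx] := sxN x Nx; have [Ux _ _] := Nx.
  move=> V; rewrite nbhsE => -[V' [V'open V'x] V'V].
  have [N1 N1open N1P] := opn V' V'open.
  have [N1x _] : N1 (u x) /\ S (u x) by apply/N1P; exists (sx x).
  have [cu _] := hu x Ux.
  have n1 := open_nbhs_nbhs (conj Uopen Ux).
  have n2 := nbhs_preimage cu N1open N1x.
  move: n1 n2; apply: filterS2 => x' Ux' N1x'.
  have [v [Wv V'v fv]] := (N1P (u x')).1 (conj N1x' (Su _ Ux')).
  by apply: V'V; rewrite /sx /= -fv sW.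
have he x : N x -> derivable (affine_coord A j \o u) x 1.
  by move=> [Ux Ax _]; have [_ h] := hu x Ux; exact: h.
have sxt : sx t = zp by rewrite /sx /= utE sW.
have nN := open_nbhs_nbhs (conj Nopen Nt).
have Dsx : D (sx t) by rewrite sxt.
have := @section_unramified R D Y (affine_coord A j \o u) sx t _ Dopen affine_holo Dsx
  (filterS (fun x Nx => holo_cder he Nx) nN) (holo_cder he Nt) e0
  (filterS csx nN).
rewrite sxt y0 eqxx => h; suff : false by []; apply: h.
  apply: filterS nN => x Nx; apply: contraNneq => sxx.
  have [_ _ fx] := sxN x Nx; have [Ux _ _] := Nx.
  by apply/eqP; apply: inj; rewrite ?inE// -fx sxx utE.
by apply: filterS nN => x Nx; have [_ _ /= ->] := sxN x Nx.
Qed.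

Lemma jet_normalized z : D z ->
  wronskian_of X0 (ratio A v1 \o f) z = der Y z /\
  schwarzian_of X0 (ratio A v1 \o f) z =
    2 * der Y z * der (der (der Y)) z - 3 * der (der Y) z ^+ 2.
Proof.
rewrite affine_ratio_comp; apply: (normalized_jet _ Dopen).
by move=> t [_ At]; exact: ratio_id.
Qed.

(** The function {y; z} / y'^2, invariant under the group by [invariant_change]. *)
Definition invariant z :=
  (2 * der Y z * der (der (der Y)) z - 3 * der (der Y) z ^+ 2) / (2 * der Y z ^+ 4).

Lemma invariant_change z w : D z -> D w -> f z = f w ->
  exists2 m : C, m != 0 & der Y z = m * der Y w /\ invariant z = invariant w.
Proof.
move=> Dz Dw fzw.
have [m [mE _ _ WE EE]] := chart_change hG hf v0 v1 uA uA Dz Dw fzw.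
have Az : finite_part A (f z) by case: Dz.
have [W1 E1] := jet_normalized Dz; have [W2 E2] := jet_normalized Dw.
rewrite W1 W2 ratio_id// expr1n mul1r in WE.
rewrite E1 E2 ratio_id// expr1n mul1r in EE.
have m0 : m != 0.
  rewrite -cn_gt0 mE divr_gt0//; first by case: Dw.
  by case: Dz.
exists m => //; split => //; rewrite /invariant EE WE exprMn.
rewrite [2 * (m ^+ 4 * _)]mulrCA invfM mulrACA divff ?mul1r//.
by rewrite expf_neq0.
Qed.

Lemma invariant_holo (O : set C) : O `<=` D -> (forall z, O z -> der Y z != 0) ->
  holo O invariant.
Proof.
move=> OD y0 z Oz; have Dz := OD z Oz.
have h1 := der_holo Dopen affine_holo; have h2 := der_holo Dopen h1.
have h3 := der_holo Dopen h2.
have d1 := holo_cder h1 Dz; have d2 := holo_cder h2 Dz; have d3 := holo_cder h3 Dz.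
apply: cder_derivable (cder_div _ (cderB (cderM (cderM (cder_cst 2 z) d1) d3)
  (cderM (cder_cst 3 z) (cderX 2 d2))) (cderM (cder_cst 2 z) (cderX 4 d1))).
by rewrite mulf_neq0 ?pnatr_eq0// expf_neq0// y0.
Qed.

(** The relation of [siegel] in the chart A, divided by (2 y'^4)^n. *)
Lemma algebraic_relation : der Y zp != 0 -> exists2 P : {poly {poly C}}, P != 0 &
  \forall z \near zp, ev P (Y z) (invariant z) = 0.
Proof.
move=> y0; have Dp : D zp by split.
have [n [c [[p0 cp0] cE]]] := siegel hG hf cS v0 v1 Hp uA Ap.
pose P : {poly {poly C}} := \sum_p (c p *: 'X^(p.1)) *: 'X^(p.2).
exists P.
  have : P`_p0.2`_p0.1 = c p0.
    rewrite /P !coef_sum (bigD1 p0)//= coefZ coefXn eqxx mulr1 coefZ coefXn eqxx mulr1.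
    rewrite big1 ?addr0// => p pp0; rewrite coefZ coefXn.
    case: eqP => [e2|_]; last by rewrite mulr0 coef0.
    rewrite mulr1 coefZ coefXn; case: eqP => [e1|_]; last by rewrite mulr0.
    by case/eqP: pp0; apply: injective_projections; apply: val_inj; exact/esym.
  by move=> PE; apply: contraNneq cp0 => P0; rewrite -PE P0 !coef0.
have hy1 := der_holo Dopen affine_holo.
have ny := continuous_ne0 (derivable_continuous (hy1 _ Dp)) y0.
have nD := open_nbhs_nbhs (conj Dopen Dp).
move: cE ny nD; apply: filterS3 => z cz yz Dz.
have [W1 E1] := jet_normalized Dz.
have X1 : X0 z = 1 by case: Dz => _ Az; rewrite /= ratio_id.
have q0 : 2 * der Y z ^+ 4 != 0 by rewrite mulf_neq0 ?pnatr_eq0// expf_neq0.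
apply: (mulfI (expf_neq0 n q0)); rewrite mulr0 -[RHS]cz /form /P.
rewrite /ev rmorph_sum horner_sum mulr_sumr; apply: eq_bigr => -[a b] _ /=.
rewrite -mul_polyC rmorphM /= map_polyC map_polyXn hornerCM hornerXn.
rewrite -[LHS]/((2 * der Y z ^+ 4) ^+ n *
  ((c (a, b) *: 'X^a).[Y z] * invariant z ^+ b)) hornerZ hornerXn /mono W1 E1 X1 !expr1n !mulr1 -affine_ratio_comp.
rewrite /invariant /=.
have bn : (b <= n)%N by rewrite -ltnS.
rewrite -{1}(subnK bn) exprD.
have := expf_neq0 b q0.
move: (2 * der Y z ^+ 4) => q; move: (2 * der Y z * _ - _) => e qb.
by rewrite [(e / q) ^+ b]expr_div_n; field.
Qed.

(** U is the image of a disc around zp on which y is a coordinate and [newton] applies.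
    On the preimage Z of U the chain is y, y', y'', 1 / y', the function s of [newton]
    transported by the local section tau of f, and 1 / Q_s(y, s). As tau is locally a
    Moebius map of the group, the relations valid on the disc hold on Z. *)
Lemma noetherian_near : der Y zp != 0 -> exists U : set (CP R k),
  [/\ U `<=` S, within S (nbhs (f zp)) U &
   forall Omega : set C, Omega `<=` H `&` f @^-1` U -> noetherian_function1 Omega Y].
Proof.
move=> y0; have Dp : D zp by split.
have [P P0 PE] := algebraic_relation y0.
case: (hf) => _ cov fE.
have [Wst [sec [Wopen Wz WH secW opn]]] := covering_local cov Hp.
have hy := affine_holo; have hy1 := der_holo Dopen hy.
have hy2 := der_holo Dopen hy1; have hy3 := der_holo Dopen hy2.
have iso : \forall z \near zp, Y z = Y zp -> z = zp.
  have cq := divdiff_continuous (w := zp) (hy _ Dp).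
  have q0 : divdiff Y zp zp != 0 by rewrite divdiff_id -derE.
  have nq := continuous_ne0 cq q0.
  apply: filterS nq => z qz Yz; apply/eqP; rewrite -subr_eq0.
  have /esym/eqP := divdiffE Y zp z.
  rewrite Yz -[X in _ == X]addr0 (inj_eq (addrI _)) mulf_eq0 => /orP[//|/eqP z0].
  by move: qz; rewrite z0 eqxx.
have ny := continuous_ne0 (derivable_continuous (hy1 _ Dp)) y0.
have [r1 r10 r1P] := nbhs_disc (filterI iso (filterI ny
  (filterI (open_nbhs_nbhs (conj Dopen Dp)) (open_nbhs_nbhs (conj Wopen Wz))))).
pose D1 := disc zp r1.
have D1open : open D1 by exact: open_disc.
have D1D : D1 `<=` D by move=> z /r1P[_ [_ []]].
have D1y z : D1 z -> der Y z != 0 by move=> /r1P[_ []].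
have hy' : holo D1 Y by move=> z /D1D; exact: hy.
have D1iso z : D1 z -> Y z = Y zp -> z = zp by move=> /r1P[h _]; exact: h.
have D1p : D1 zp by exact: disc_center.
have hr := invariant_holo D1D D1y.
have dY0 : 'D_1 Y zp != 0 by rewrite -derE.
have [P1 P1E P1'] := separable_relation D1open D1p hy' D1iso P0 PE.
have [T [M [Q [s [hs rE QE Q'0]]]]] := newton D1open D1p hy' D1iso dY0 hr P1E P1'.
have cQ' : {for zp, continuous (fun z => ev (deriv Q) (Y z) (s z))}.
  exact: cder_continuous (cder_ev (deriv Q) (derivable_cder (hy _ Dp))
    (derivable_cder (hs _ D1p))).
have nQ' := continuous_ne0 cQ' Q'0.
have [r2 r20 r2P] := nbhs_disc (filterI QE (filterI nQ'
  (open_nbhs_nbhs (conj D1open D1p)))).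
pose W0 := disc zp r2.
have W0open : open W0 by exact: open_disc.
have W0P z : W0 z -> [/\ ev Q (Y z) (s z) = 0, ev (deriv Q) (Y z) (s z) != 0,
    D1 z & Wst z].
  by move=> /r2P[h1 [h2 h3]]; split => //; have [_ [_ [_ ]]] := r1P _ h3.
have [N Nopen NP] := opn W0 W0open.
pose U := [set q | N q /\ S q].
exists U; split => [q []//||Omega OmU].
  have [Np _] : N (f zp) /\ S (f zp).
    by apply/NP; exists zp; split => //; exact: disc_center.
  by apply: filterS (open_nbhs_nbhs (conj Nopen Np)) => q Nq Sq.
pose Z := H `&` f @^-1` U.
have tauP z : Z z -> W0 (sec (f z)) /\ f (sec (f z)) = f z.
  move=> [_ Uz]; have [x [Wx W0x fx]] := (NP (f z)).1 Uz.
  by rewrite -fx secW.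
have SH z : H z -> S (f z) by move=> Hz; case: cov => _ <- _; exists z.
have ZD z : Z z -> D z.
  move=> Zz; have [W0t ft] := tauP z Zz; split; first by case: Zz.
  have [_ _ /D1D[_]] := W0P _ W0t; by rewrite /= ft.
have Zopen : open Z.
  rewrite openE => z [Hz [Nz Sz]].
  have [hol _ _] := hf; have [cf _] := hol z Hz.
  have n1 := open_nbhs_nbhs (conj (@open_half_plane R) Hz).
  have n2 := nbhs_preimage cf Nopen Nz.
  by move: n1 n2; apply: filterS2 => x Hx Nx; split => //; split => //; exact: SH.
pose tau z := sec (f z).
have tau_der z : Z z -> derivable tau z 1.
  move=> Zz; have [W0t ft] := tauP z Zz; have Hz : H z by case: Zz.
  have [_ _ D1t Wt] := W0P _ W0t.
  have Ht : H (tau z) by exact: WH.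
  have [a Ga tauE] := (fE z (tau z) Hz Ht).1 (esym ft).
  have da := det_group hG Ga.
  have : cder (mobius a) z _ := mobius_cder da Hz.
  move=> dm; apply: cder_derivable (cder_near _ dm).
  have cm := cder_continuous dm.
  have Wmz : Wst (mobius a z) by rewrite -tauE.
  have n1 := open_nbhs_nbhs (conj (@open_half_plane R) Hz).
  move: n1 (nbhs_preimage cm Wopen Wmz); apply: filterS2 => x Hx Wx.
  by rewrite /tau -(uniform_mobius hG hf Ga Hx) secW.
have Ytau z : Z z -> Y (tau z) = Y z.
  by move=> Zz; have [_ /= ->] := tauP z Zz.
pose st z := s (tau z).
have st_der z : Z z -> derivable st z 1.
  move=> Zz; have [W0t _] := tauP z Zz; have [_ _ D1t _] := W0P _ W0t.
  exact: cder_derivable (cder_comp (derivable_cder (hs _ D1t)) (derivable_cder (tau_der z Zz))).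
have Q0 z : Z z -> ev Q (Y z) (st z) = 0.
  by move=> Zz; have [W0t _] := tauP z Zz; have [h _ _ _] := W0P _ W0t; rewrite -Ytau.
have Qs0 z : Z z -> ev (deriv Q) (Y z) (st z) != 0.
  by move=> Zz; have [W0t _] := tauP z Zz; have [_ h _ _] := W0P _ W0t; rewrite -Ytau.
have yrE z : Z z -> der Y z != 0 /\ invariant z = T.[Y z] + (Y z - Y zp) ^+ M * st z.
  move=> Zz; have [W0t ft] := tauP z Zz; have [_ _ D1t _] := W0P _ W0t.
  have [m m0 [dE iE]] := invariant_change (ZD _ Zz) (D1D _ D1t) (esym ft).
  split; first by rewrite dE; exact: mulf_neq0 m0 (D1y _ D1t).
  by rewrite iE (rE _ D1t) (Ytau z Zz).
have ZO : Omega `<=` Z by exact: OmU.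
pose v z := (ev (deriv Q) (Y z) (st z))^-1.
pose y1 := der Y; pose y2 := der y1.
pose yi z := (y1 z)^-1.
pose phi (i : 'I_6) : C -> C := nth (fun=> 0) [:: Y; y1; y2; yi; st; v] i.
have p0 : polynomial_in Omega phi Y by exact: (polynomial_chain Omega phi (@Ordinal 6 0 isT)).
have p1 : polynomial_in Omega phi y1 by exact: (polynomial_chain Omega phi (@Ordinal 6 1 isT)).
have p2 : polynomial_in Omega phi y2 by exact: (polynomial_chain Omega phi (@Ordinal 6 2 isT)).
have p3 : polynomial_in Omega phi yi by exact: (polynomial_chain Omega phi (@Ordinal 6 3 isT)).
have p4 : polynomial_in Omega phi st by exact: (polynomial_chain Omega phi (@Ordinal 6 4 isT)).
have p5 : polynomial_in Omega phi v by exact: (polynomial_chain Omega phi (@Ordinal 6 5 isT)).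
(* Q(y, st) = 0 determines the derivative of st. *)
pose ds z := - (ev (map_poly (@deriv C) Q) (Y z) (st z) * y1 z * v z).
have pds : polynomial_in Omega phi ds.
  apply: polynomialN; apply: polynomialM p5; apply: polynomialM p1.
  exact: polynomial_ev p0 p4.
have dst z : Z z -> cder st z (ds z).
  move=> Zz; have d1 := holo_cder hy (ZD _ Zz).
  have d2 := derivable_cder (st_der z Zz).
  have : ev (map_poly (@deriv C) Q) (Y z) (st z) * der Y z +
      ev (deriv Q) (Y z) (st z) * 'D_1 st z = 0.
    apply: cder_unique (cder_ev Q d1 d2) _.
    apply: cder_near (cder_cst 0 z).
    by apply: filterS (open_nbhs_nbhs (conj Zopen Zz)) => x Zx; rewrite Q0.
  move=> /eqP; rewrite addrC addr_eq0 => /eqP h; apply: cder_eq d2 _.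
  apply: (mulfI (Qs0 z Zz)); rewrite h /ds /v /y1.
  by have := Qs0 z Zz => q; field.
have dv z : Z z -> cder v z (- (ev (map_poly (@deriv C) (deriv Q)) (Y z) (st z) * y1 z +
    ev (deriv (deriv Q)) (Y z) (st z) * ds z) * v z ^+ 2).
  move=> Zz; have d1 := holo_cder hy (ZD _ Zz).
  apply: cder_eq (@cderV R (fun z => ev (deriv Q) (Y z) (st z)) z _ (Qs0 z Zz)
    (cder_ev (deriv Q) d1 (dst z Zz))) _.
  by rewrite /v exprVn.
pose r z := T.[Y z] + (Y z - Y zp) ^+ M * st z.
have pr : polynomial_in Omega phi r.
  apply: polynomialD; first exact: polynomial_horner.
  apply: polynomialM p4; apply: polynomialX.
  apply: polynomialD p0 _; exact: polynomial_cst.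
have dy2 z : Z z -> der y2 z = r z * y1 z ^+ 3 + 3 / 2 * (y2 z ^+ 2 * yi z).
  move=> Zz; have [yz] := yrE z Zz; rewrite /invariant -/(r z) -/y1 -/y2 => <-.
  rewrite /yi; have y1z : y1 z != 0 by [].
  by field.
have p6 : polynomial_in Omega phi (der y2).
  apply: (@polynomial_eq R Omega 6 phi
    (fun z => r z * y1 z ^+ 3 + 3 / 2 * (y2 z ^+ 2 * yi z))).
    by move=> z /ZO Zz; rewrite dy2.
  apply: polynomialD; first by apply: polynomialM pr _; exact: polynomialX.
  apply: polynomialM; first exact: polynomial_cst.
  by apply: polynomialM p3; exact: polynomialX.
have dY z : Z z -> cder Y z (y1 z) by move=> Zz; exact: holo_cder hy (ZD _ Zz).
have dy1 z : Z z -> cder y1 z (y2 z) by move=> Zz; exact: holo_cder hy1 (ZD _ Zz).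
have dy2' z : Z z -> cder y2 z (der y2 z) by move=> Zz; exact: holo_cder hy2 (ZD _ Zz).
have dyi z : Z z -> cder yi z (- (y2 z * yi z ^+ 2)).
  move=> Zz; have [yz _] := yrE z Zz.
  by apply: cder_eq (cderV yz (dy1 z Zz)) _; rewrite /yi exprVn mulNr.
have pdyi : polynomial_in Omega phi (fun z => - (y2 z * yi z ^+ 2)).
  by apply: polynomialN; apply: polynomialM p2 _; exact: polynomialX.
have pdv : polynomial_in Omega phi (fun z =>
    - (ev (map_poly (@deriv C) (deriv Q)) (Y z) (st z) * y1 z +
      ev (deriv (deriv Q)) (Y z) (st z) * ds z) * v z ^+ 2).
  apply: polynomialM; last exact: polynomialX.
  apply: polynomialN; apply: polynomialD.
    by apply: polynomialM p1; exact: polynomial_ev.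
  by apply: polynomialM pds; exact: polynomial_ev.
apply: (@noetherian_of_chain R Omega 6 phi _ _ p0).
case; case=> [|[|[|[|[|[|m]]]]]] ilt.
- by exists y1; [exact: p1|move=> z /ZO Zz; exact: dY].
- by exists y2; [exact: p2|move=> z /ZO Zz; exact: dy1].
- by exists (der y2); [exact: p6|move=> z /ZO Zz; exact: dy2'].
- by eexists; [exact: pdyi|move=> z /ZO Zz; exact: dyi].
- by exists ds; [exact: pds|move=> z /ZO Zz; exact: dst].
- by eexists; [exact: pdv|move=> z /ZO Zz; exact: dv].
- by [].
Qed.

End AffineCoordinate.

Theorem mainTheorem6 (R : realType) (k : nat) (C : set (CP R k)) (g : nat)
    (Gamma : set 'M[R]_2) (f : cplx R -> CP R k) (p : CP R k)
    (A : 'M[cplx R]_k.+1) :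
  compact C -> connected C -> smooth_algebraic_curve C ->
  has_genus C g -> (1 < g)%N ->
  PSL2_subgroup Gamma -> discrete_set Gamma -> acts_freely Gamma ->
  uniformization Gamma C f ->
  C p -> A \in unitmx -> finite_part A p ->
  (forall j, ~ vanishes_at C (dform (affine_coord A j)) p) ->
  exists U : set (CP R k),
    [/\ U `<=` C, within C (nbhs p) U &
     forall Omega : set (cplx R),
       domain Omega -> compact (closure Omega) ->
       closure Omega `<=` @upper_half_plane R `&` f @^-1` U ->
       forall j, noetherian_function1 Omega (affine_coord A j \o f)].
Proof.
move=> cC _ _ _ _ hG _ _ hf Cp uA Ap nv.
have [zp Hp fzp] : exists2 z, upper_half_plane z & f z = p.
  by case: (hf) => _ [_ fH _] _; move: Cp; rewrite -fH => -[z ? <-]; exists z.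
rewrite -fzp in Ap nv *.
have /choice[U UP] j := noetherian_near hG hf cC uA Hp Ap
  (affine_unramified hf uA Hp Ap (nv j)).
exists (C `&` \bigcap_(j in [set: 'I_k]) U j); split => [q []//||].
  have near_U j : \forall q \near f zp, C q -> U j q by have [_ + _] := UP j.
  have nU : \forall q \near f zp, forall j, C q -> U j q.
    exact: (@filter_forall _ _ (fun j q => C q -> U j q) _
      (nbhs_filter (f zp)) near_U).
  apply: (@filterS _ (nbhs (f zp)) (nbhs_filter _) _ _ _ nU) => q Uq Cq.
  by split => // j _; exact: Uq.
move=> Omega _ _ sub j; have [_ _] := UP j; apply.
move=> z Oz; have [Hz [_ Uz]] := sub z (subset_closure Oz).
by split => //; exact: Uz.
Qed.
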